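(* There exist absolute constants $c, C > 0$ such that the following holds. Let $X$ be a random variable on a lattice $\mathcal{L} \subset \mathbb{R}^m$ such that $\mathbb{E}[XX^\dagger] = I_m$, $\operatorname{supp} X \subset B(L)$, and $\mathcal{L} = \operatorname{span}_{\mathbb{Z}} \operatorname{supp} X$. Let $$N_0 := c\max\left\{ m^2L^2(\log m + \log L)^2,\; s(X)^{-4}L^{-2},\; L^2\log^2 \det\mathcal{L}\right\}.$$ For $n \ge N_0$, let $M$ be an $m\times n$ random matrix whose columns are independent copies of $X$. With probability at least $1 - C L\sqrt{\frac{\log n}{n}}$ over the choice of the columns of $M$, the following two properties hold: 1. $MM^\dagger \succeq \frac12 n I_m$. 2. For all $\lambda \in \mathcal{L} - \frac12 M\mathbf{1}$, $$\left| \Pr_{y}[My = \lambda] - G_M(\lambda)\right| \le G_M(0)\cdot \frac{2m^2L^2}{n},$$ where $y$ is uniformly distributed on $\{\pm 1/2\}^n$. In particular, for all $\lambda \in \mathcal{L} - \frac12 M\mathbf{1}$ with $e^{-2\lambda^\dagger (MM^\dagger)^{-1}\lambda} > 2m^2L^2/n$ we have $\Pr_{y\in\{\pm1/2\}^n}[My = \lambda] > 0$.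
   Context: A lattice is a discrete subgroup of $\mathbb{R}^m$; $\det\mathcal{L}$ is the (absolute value of the) determinant of any matrix whose columns form a basis of $\mathcal{L}$; the dual lattice is $\mathcal{L}^* = \{z : \langle z,\lambda\rangle\in\mathbb{Z}\ \text{for all } \lambda\in\mathcal{L}\}$. $B(L)$ is the set of points of $\mathbb{R}^m$ of Euclidean length at most $L$; $\mathbf{1}$ is the all-ones vector. For Hermitian matrices, $A \succeq B$ means $A-B$ is positive semidefinite. The lattice Gaussian is $$G_M(\lambda) = \frac{2^{m/2}\det(\mathcal{L})}{\pi^{m/2}\sqrt{\det(MM^\dagger)}}\, e^{-2\lambda^\dagger (MM^\dagger)^{-1}\lambda}.$$ Spanningness: define $\tilde X(\theta) := \sqrt{\mathbb{E}[|\langle\theta,X\rangle \bmod 1|^2]}$, where $y \bmod 1$ is the representative of $y$ modulo $\mathbb{Z}$ in $(-1/2,1/2]$. A vector $\theta\in\mathbb{R}^m$ is pseudodual if $\tilde X(\theta)\le d(\theta,\mathcal{L}^* )/2$, with $d$ Euclidean distance. Then $s(X) := \inf\{\tilde X(\theta) : \theta \text{ pseudodual},\ \theta\notin\mathcal{L}^*\}$ (equal to $\infty$ if there is no such $\theta$, in which case $s(X)^{-4}=0$).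
   Formalization: Assumes n ≥ 2: at n = 0 log n/n is undefined, and at n = 1 the claim would need probability 1, which fails for X in {0, a, -a} on aZ with P(X≠0) = 1/a², L = a slightly above 1 (s(X) = ∞, N_0 ≤ 1, but M = 0 with positive probability). *)

(* Defs.v *)
From HB Require Import structures.
From mathcomp Require Import all_boot all_order all_algebra.
From mathcomp Require Import all_classical all_reals all_analysis.

Set Implicit Arguments.
Unset Strict Implicit.
Unset Printing Implicit Defensive.

Import Order.TTheory GRing.Theory Num.Theory.
Import numFieldNormedType.Exports.

Local Open Scope classical_set_scope.
Local Open Scope ring_scope.

(* The library norm `|x| on matrices is the sup norm, hence eucl_norm below. *)
Definition dotv (R : realType) (m : nat) (u v : 'cV[R]_m) : R :=
  (u^T *m v) 0 0.

Definition eucl_norm (R : realType) (m : nat) (u : 'cV[R]_m) : R :=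
  Num.sqrt (dotv u u).

Definition eucl_dist (R : realType) (m : nat) (x : 'cV[R]_m) 
   (A : set 'cV[R]_m) : R :=
  inf [set eucl_norm (x - a) | a in A].

Definition eucl_ball (R : realType) (m : nat) (r : R) : set 'cV[R]_m :=
  [set x | eucl_norm x <= r].

Definition psd (R : realType) (m : nat) (A : 'M[R]_m) : Prop :=
  A^T = A /\ forall v : 'cV[R]_m, 0 <= dotv v (A *m v).

(* loewner_ge A B is A >= B in the positive semidefinite order. *)
Definition loewner_ge (R : realType) (m : nat) (A B : 'M[R]_m) : Prop :=
  psd (A - B).

Definition is_lattice (R : realType) (m : nat) (Lat : set 'cV[R]_m) : Prop :=
  [/\ Lat 0, forall x y, Lat x -> Lat y -> Lat (x - y)
    & forall x, Lat x -> isolated Lat x].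

Definition zspan (R : realType) (m : nat) (S : set 'cV[R]_m) : set 'cV[R]_m :=
  [set x | exists (k : nat) (v : 'I_k -> 'cV[R]_m) (a : 'I_k -> int),
     (forall i, S (v i)) /\ x = \sum_(i < k) v i *~ a i].

Definition lattice_basis (R : realType) (m : nat) (Lat : set 'cV[R]_m)
    (B : 'M[R]_m) : Prop :=
  B \in unitmx /\ Lat = zspan [set col j B | j in [set: 'I_m]].

(* The determinant of a full-rank lattice, by choosing a basis (the value does
   not depend on the choice). It is a junk value if Lat has rank less than m. *)
Definition lattice_det (R : realType) (m : nat) (Lat : set 'cV[R]_m) : R :=
  `| \det (get [set B | lattice_basis Lat B]) |.

Definition dual_lattice (R : realType) (m : nat) (Lat : set 'cV[R]_m) :
    set 'cV[R]_m :=
  [set z | forall l, Lat l -> dotv z l \is a Num.int].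

Definition mod1 (R : realType) (y : R) : R :=
  y - (Num.ceil (y - 2^-1))%:~R.

(* R^m with its Borel sigma-algebra. *)
Notation borel_cV R m := (g_sigma_algebraType (@open 'cV[R]_m)).

Definition random_vector (R : realType) (m : nat) (d : measure_display)
    (T : measurableType d) (X : T -> 'cV[R]_m) : Prop :=
  measurable_fun [set: T] (X : T -> borel_cV R m).

(* The support of a discrete random vector, i.e. its set of atoms. *)
Definition rv_supp (R : realType) (m : nat) (d : measure_display)
    (T : measurableType d) (P : probability T R) (X : T -> 'cV[R]_m) :
    set 'cV[R]_m :=
  [set x | (0 < P (X @^-1` [set x]))%E].

Definition second_moment (R : realType) (m : nat) (d : measure_display)
    (T : measurableType d) (P : probability T R) (X : T -> 'cV[R]_m) : 'M[R]_m :=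
  \matrix_(i, j) fine ('E_P[(fun w => (X w *m (X w)^T) i j)])%E.

Definition xtilde (R : realType) (m : nat) (d : measure_display)
    (T : measurableType d) (P : probability T R) (X : T -> 'cV[R]_m)
    (theta : 'cV[R]_m) : R :=
  Num.sqrt (fine ('E_P[(fun w => (`|mod1 (dotv theta (X w))| ^+ 2)%R)])%E).

Definition pseudodual (R : realType) (m : nat) (d : measure_display)
    (T : measurableType d) (P : probability T R) (X : T -> 'cV[R]_m)
    (Lat : set 'cV[R]_m) (theta : 'cV[R]_m) : Prop :=
  xtilde P X theta <= eucl_dist theta (dual_lattice Lat) / 2.

Definition spanningness (R : realType) (m : nat) (d : measure_display)
    (T : measurableType d) (P : probability T R) (X : T -> 'cV[R]_m)
    (Lat : set 'cV[R]_m) : \bar R :=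
  ereal_inf [set (xtilde P X theta)%:E | theta in
    [set theta | pseudodual P X Lat theta /\ ~ dual_lattice Lat theta]].

(* The threshold is extended-real because s(X) may be +oo, for which (+oo)^-1 = 0. *)
Definition n_threshold (R : realType) (c : R) (m : nat) (L : R) (s : \bar R) (D : R) :
    \bar R :=
  (c%:E * maxe (maxe (m%:R ^+ 2 * L ^+ 2 * (ln m%:R + ln L) ^+ 2)%:E
                     (s^-1 ^+ 4 * (L ^- 2)%:E))
               (L ^+ 2 * ln D ^+ 2)%:E)%E.

(* The columns of the random matrix M are mutually independent random vectors
   with the same law as X. Mutual independence is the product rule over all
   columns at once; a sub-family is recovered by taking A j = setT elsewhere. *)
Definition iid_columns (R : realType) (m n : nat)
    (d : measure_display) (T : measurableType d) (P : probability T R)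
    (X : T -> 'cV[R]_m)
    (d' : measure_display) (T' : measurableType d') (Q : probability T' R)
    (M : T' -> 'M[R]_(m, n)) : Prop :=
  [/\ forall j, random_vector (fun w => col j (M w)),
      forall j (A : set (borel_cV R m)), measurable A ->
        Q [set w | A (col j (M w))] = P [set w | A (X w)]
    & forall A : 'I_n -> set (borel_cV R m), (forall j, measurable (A j)) ->
        Q [set w | forall j, A j (col j (M w))] =
        (\prod_(j < n) Q [set w | A j (col j (M w))])%E].

Definition half_signs (R : realType) (n : nat) (e : {ffun 'I_n -> bool}) :
    'cV[R]_n :=
  \col_j (if e j then 2^-1 else - 2^-1).

(* Pr_y[M y = lambda] for y uniform on {1/2, -1/2}^n. *)
Definition sign_prob (R : realType) (m n : nat) (M : 'M[R]_(m, n))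
    (lambda : 'cV[R]_m) : R :=
  #|[set e : {ffun 'I_n -> bool} | M *m half_signs R e == lambda]|%:R / 2 ^+ n.

Definition gauss_exp (R : realType) (m n : nat) (M : 'M[R]_(m, n))
    (lambda : 'cV[R]_m) : R :=
  expR (- 2 * dotv lambda (invmx (M *m M^T) *m lambda)).

Definition lattice_gaussian (R : realType) (m n : nat) (Lat : set 'cV[R]_m)
    (M : 'M[R]_(m, n)) (lambda : 'cV[R]_m) : R :=
  (2 `^ (m%:R / 2) * lattice_det Lat)
    / (pi `^ (m%:R / 2) * Num.sqrt (\det (M *m M^T)))
    * gauss_exp M lambda.

Definition shifted_lattice (R : realType) (m n : nat) (Lat : set 'cV[R]_m)
    (M : 'M[R]_(m, n)) : set 'cV[R]_m :=
  [set l - 2^-1 *: (M *m const_mx 1) | l in Lat].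

(* Main.v *)
Require Import Defs.
From HB Require Import structures.
From mathcomp Require Import all_boot all_order all_algebra.
From mathcomp Require Import all_classical all_reals all_analysis.
From mathcomp Require Import complex measurable_realfun.
From mathcomp Require Import ring lra zify.

Set Implicit Arguments.
Unset Strict Implicit.
Unset Printing Implicit Defensive.

Import Order.TTheory GRing.Theory Num.Theory.
Import numFieldNormedType.Exports.

Local Open Scope classical_set_scope.
Local Open Scope ring_scope.

(** Fix a basis matrix B of the lattice.  The atoms of X are B z_i with integer
    vectors z_i, so M = B W with W an integer matrix, and the probability that
    M y = lambda is a Fourier coefficient on the torus of characters t modulo
    the integers: the integral over t of cos (2 pi <t, zeta>) Phi (t), where
    Phi (t) is the product over the columns w_j of W of cos (pi <t, w_j>) and
    zeta holds the coordinates of - lambda in the basis B.  A character t is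
    the point theta = B^-T t of the dual space (dual_pt), integer t forming the
    dual lattice, and <t, w_j> is the inner product of theta with column j of M.

    Near the dual lattice, |theta| <= 1 / (16 L), all angles are small and
    Phi (t) is close to exp (- q (t)), with q (t) = (pi^2 / 2) theta^T M M^T theta.
    The relative error is a tenth of the sum of the fourth powers of the
    angles, hence O ((L^2 / n) q^2), and integrating q^2 exp (- q) over R^m
    gives the factor m^2 (char_fun_near, main_constant).  The integral of
    exp (- q) cos is the lattice Gaussian.  Far from the dual lattice exp (- q)
    is negligible (gauss_far), and |Phi| is small in mean: since
    |cos (pi x)| <= 1 - (x mod 1)^2, the expectation of |Phi (t)| over M is at
    most exp (- n Xt (theta)^2), with Xt = X-tilde the function defining spanningness.
    Either theta is pseudodual, and then Xt (theta) >= s (X), or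
    Xt (theta) > d (theta, dual lattice) / 2, and the bound is again a
    Gaussian in theta (far_bound).  Markov's inequality discards the matrices
    for which the far part is large, and Chebyshev's inequality those for which
    M M^T is not close to n I (prob_frob_bad).

    Integration over the torus is replaced by averaging over the finite group of
    characters with coordinates in (1/K) Z.  For K large this inversion formula is
    exact (sign_prob_dft), and only Gaussian sums over (1/K) Z^m have to be compared
    with integrals; that is done one coordinate at a time, with Schur complements,
    from Riemann sums on the line (gauss_riemann_sum, lgauss_approx).  The set
    of good matrices found by Markov's inequality depends on K.  Bounded support
    makes X take finitely many values, so there are finitely many matrices, one
    set of good matrices occurs for infinitely many K, and for its members one
    lets K tend to infinity (local_limit, finite_limit).

    If C L sqrt (log n / n) >= 1 the empty event will do.  Otherwise the lower bound on n
    gives sqrt n >= 256 m L log n (log_n_le_sqrt), and every exponential term is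
    then smaller than a power of n (tail_total, bad_prob_le). *)

(** * Cosine against Gaussian and against distance to the integers *)

Section Elementary.
Variable R : realType.
Implicit Types x y u v : R.

(** One-sided comparison from the sign of a derivative, used to integrate
    elementary inequalities for sine and exponential. *)
Lemma sub_le_deriv (f f' : R -> R) (a x : R) : a <= x ->
  (forall t, is_derive t (1:R) f (f' t)) -> (forall t, a <= t <= x -> 0 <= f' t) ->
  f a <= f x.
Proof.
rewrite le_eqVlt => /predU1P[->//|ax] df f0.
have [c /andP[ac cx] E] : exists2 c, a < c < x & f x - f a = f' c * (x - a).
  have cf : {within `[a, x], continuous f}.
    by apply: derivable_within_continuous => t _; have [] := df t.
  have [c] := @MVT _ f f' a x ax (fun t _ => df t) cf.
  by rewrite in_itv/= => ? ?; exists c.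
rewrite -subr_ge0 E mulr_ge0 ?subr_ge0 ?(ltW ax)//.
by apply: f0; rewrite !ltW.
Qed.

Lemma normr_sin_le x : `|sin x| <= `|x|.
Proof.
wlog x0 : x / 0 <= x.
  move=> H; have [/H//|/ltW xN] := leP 0 x.
  by rewrite -[`|x|]normrN -[`|sin x|]normrN -sinN H ?oppr_ge0.
rewrite (ger0_norm x0) ler_norml; apply/andP; split.
  have : 0 + sin 0 <= x + sin x :> R.
    apply: (@sub_le_deriv (fun t => t + sin t) (fun t => 1 + cos t)) => [//|t _].
    by have := cos_geN1 t; lra.
  rewrite sin0; lra.
have : 0 - sin 0 <= x - sin x :> R.
  apply: (@sub_le_deriv (fun t => t - sin t) (fun t => 1 - cos t)) => [//|t _].
  by have := cos_le1 t; lra.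
rewrite sin0; lra.
Qed.

Lemma sqr_sin_le x : sin x ^+ 2 <= x ^+ 2.
Proof. by rewrite -[leLHS]real_normK ?num_real// -[leRHS]real_normK ?num_real// lerXn2r ?nnegrE ?normr_sin_le. Qed.

Lemma cos_half x : cos x = 1 - 2 * sin (x / 2) ^+ 2.
Proof.
have -> : cos x = cos ((x / 2) *+ 2) by congr cos; rewrite mulr2n; lra.
rewrite cos_mulr2n cos2sin2 mulr2n; ring.
Qed.

Lemma sin_half x : sin x = 2 * (sin (x / 2) * cos (x / 2)).
Proof.
have -> : sin x = sin ((x / 2) *+ 2) by congr sin; rewrite mulr2n; lra.
rewrite sin_mulr2n mulr2n; ring.
Qed.

Lemma cos_ge_quad x : 1 - x ^+ 2 / 2 <= cos x.
Proof. by rewrite cos_half; have := sqr_sin_le (x / 2); nra. Qed.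

(** Half-angle formulas turn |sin u| <= |u| into an inequality with a quartic
    term: sin^2 u = 4 sin^2 (u/2) (1 - sin^2 (u/2)). *)
Lemma cos_ge_quartic x : x ^+ 2 <= 4 -> 1 - x ^+ 2 / 2 + x ^+ 4 / 32 <= cos x.
Proof.
move=> hx; rewrite cos_half sin_half.
have := sqr_sin_le (x / 2 / 2).
have -> : (x / 2 / 2) ^+ 2 = x ^+ 2 / 16 by field.
rewrite !exprMn cos2sin2; set s := sin _ ^+ 2 => hs.
have s0 : 0 <= s by apply: sqr_ge0.
have -> : x ^+ 4 = (x ^+ 2) ^+ 2 by rewrite -exprM.
set z := x ^+ 2 in hx hs *.
have ? : 0 <= z by apply: sqr_ge0.
nra.
Qed.

Lemma expR_ge_quad x : 0 <= x -> 1 + x + x ^+ 2 / 2 <= expR x.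
Proof.
move=> x0.
have : expR 0 - 1 - 0 - 0 ^+ 2 / 2 <= expR x - 1 - x - x ^+ 2 / 2 :> R.
  apply: (@sub_le_deriv (fun t => expR t - 1 - t - t ^+ 2 / 2)
    (fun t => expR t - 1 - t)) => [//|t|t _].
    apply: is_derive_eq.
    by rewrite /GRing.scale/=; lra.
  by have := expR_ge1Dx t; lra.
rewrite expR0; lra.
Qed.

Lemma sin_ge_cubic x : 0 <= x -> x - x ^+ 3 / 6 <= sin x.
Proof.
move=> x0.
have : sin 0 - 0 + 0 ^+ 3 / 6 <= sin x - x + x ^+ 3 / 6 :> R.
  apply: (@sub_le_deriv (fun t => sin t - t + t ^+ 3 / 6)
    (fun t => cos t - 1 + t ^+ 2 / 2)) => [//|t|t _].
    apply: is_derive_eq.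
    by rewrite /GRing.scale/=; field.
  by have := cos_ge_quad t; lra.
rewrite sin0; lra.
Qed.

Lemma sqr_sin_ge x : x ^+ 2 <= 1 -> x ^+ 2 * (1 - x ^+ 2 / 6) ^+ 2 <= sin x ^+ 2.
Proof.
wlog x0 : x / 0 <= x.
  move=> H; have [/H//|/ltW xN] := leP 0 x.
  by move=> hx; have := H (- x); rewrite sinN !sqrrN oppr_ge0; exact.
move=> hx; have := sin_ge_cubic x0.
have -> : x - x ^+ 3 / 6 = x * (1 - x ^+ 2 / 6) by field.
by rewrite -exprMn => h; rewrite lerXn2r ?nnegrE//; [|apply: le_trans h];
  rewrite mulr_ge0//; lra.
Qed.

Lemma cos_le_gauss x : x ^+ 2 <= 1 -> cos x <= expR (- (x ^+ 2 / 2)).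
Proof.
move=> hx; have e0 := expR_ge1Dx (- (x ^+ 2 / 4)).
have -> : - (x ^+ 2 / 2) = 2%:R * (- (x ^+ 2 / 4)) by lra.
rewrite expRM_natl cos_half.
have := @sqr_sin_ge (x / 2).
have -> : (x / 2) ^+ 2 = x ^+ 2 / 4 by field.
set z := x ^+ 2 in hx e0 *; move=> /(_ ltac:(lra)) hs.
have ? : 0 <= z by apply: sqr_ge0.
have : (1 - z / 4) ^+ 2 <= expR (- (z / 4)) ^+ 2.
  by rewrite lerXn2r ?nnegrE ?expR_ge0; lra.
nra.
Qed.

(** The two functions first differ in the fourth order, by x^4 / 12; replacing
    1/24 by the 1/32 of cos_ge_quartic gives 1/8 - 1/32 < 1/10. *)
Lemma gauss_sub_cos_le x : x ^+ 2 <= 16^-1 ->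
  expR (- (x ^+ 2 / 2)) - cos x <= expR (- (x ^+ 2 / 2)) * (x ^+ 4 / 10).
Proof.
move=> hx; have hx4 : x ^+ 2 <= 4 by lra.
have h1 := cos_ge_quartic hx4.
have h2 : 1 + x ^+ 2 / 2 + (x ^+ 2 / 2) ^+ 2 / 2 <= expR (x ^+ 2 / 2).
  by apply: expR_ge_quad; have := sqr_ge0 x; lra.
have e0 := expR_gt0 (x ^+ 2 / 2).
rewrite expRN; move: h1 h2 e0 hx {hx4}; have -> : x ^+ 4 = (x ^+ 2) ^+ 2 by rewrite -exprM.
have : 0 <= x ^+ 2 by exact: sqr_ge0.
set z := x ^+ 2; set e := expR _ => z0 h1 h2 e0 hz.
rewrite -(ler_pM2l e0) mulrBr [leRHS]mulrA divff ?gt_eqF// mul1r.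
suff : 1 - z ^+ 2 / 10 <= e * cos x by lra.
apply: le_trans (_ : e * (1 - z / 2 + z ^+ 2 / 32) <= _); last by rewrite ler_pM2l.
apply: le_trans (_ : (1 + z / 2 + (z / 2) ^+ 2 / 2) * (1 - z / 2 + z ^+ 2 / 32) <= _).
  nra.
by apply: ler_wpM2r => //; nra.
Qed.

Lemma mod1E x : {k : int | mod1 x = x - k%:~R}.
Proof. by exists (Num.ceil (x - 2^-1)). Qed.

Lemma mod1_le x : mod1 x ^+ 2 <= 4^-1.
Proof.
rewrite /mod1; have := ceil_itv (x - 2^-1); set k := Num.ceil _.
move=> /andP[]; rewrite intrB => h1 h2.
have ? : - 2^-1 <= x - k%:~R <= 2^-1 by apply/andP; split; lra.
nra.
Qed.

Lemma sin_pi_int (k : int) : sin (pi * k%:~R) = 0 :> R.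
Proof.
have H (n : nat) : sin (pi * n%:R) = 0 :> R.
  by elim: n => [|n IH]; rewrite ?mulr0 ?sin0// -natr1 mulrDr mulr1 sinD IH sinpi mulr0 mul0r addr0.
by case: k => n; rewrite ?NegzE ?mulrNz ?mulrN ?sinN; rewrite H ?oppr0.
Qed.

Lemma normr_cos_pi_int x (k : int) : `|cos (pi * (x - k%:~R))| = `|cos (pi * x)| :> R.
Proof.
rewrite mulrBr cosB sin_pi_int mulr0 addr0 normrM.
have : cos (pi * k%:~R) ^+ 2 = 1 :> R by rewrite cos2sin2 sin_pi_int expr0n subr0.
by move=> /eqP; rewrite sqrf_eq1 => /orP[]/eqP ->; rewrite ?normrN normr1 mulr1.
Qed.

(** The left side has period one in x, so x may be replaced by mod1 x, which
    lies in [-1/2, 1/2].  There the cosine is nonnegative and at most 1 - x^2. *)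
Lemma normr_cos_pi_le x : `|cos (pi * x)| <= 1 - mod1 x ^+ 2.
Proof.
have [k hk] := mod1E x; rewrite -(normr_cos_pi_int x k) -hk; move: (mod1_le x) {hk}.
set y := mod1 x => hy.
have p2 := pi_ge2 R; have p4 : pi <= 4 :> R by have := pihalf_lt2 R; lra.
have z0 : 0 <= y ^+ 2 by apply: sqr_ge0.
have p16 : 4 <= (pi : R) ^+ 2 <= 16 by apply/andP; split; nra.
move: p16 => /andP[p16 p16'].
have h1 : (pi * y / 2) ^+ 2 <= 1.
  have -> : (pi * y / 2) ^+ 2 = (pi ^+ 2) * y ^+ 2 / 4 by field.
  by move: (pi ^+ 2) (y ^+ 2) p16 p16' z0 hy => a b; nra.
have h2 : y ^+ 2 <= (pi * y / 2) ^+ 2.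
  have -> : (pi * y / 2) ^+ 2 = (pi ^+ 2) * y ^+ 2 / 4 by field.
  by move: (pi ^+ 2) (y ^+ 2) p16 p16' z0 hy => a b; nra.
have s1 := sqr_sin_ge h1.
have y12 : - 2^-1 <= y <= 2^-1 by apply/andP; split; nra.
rewrite ger0_norm; last first.
  by apply: cos_ge0_pihalf; apply/andP; move: y12 => /andP[? ?]; split; nra.
rewrite cos_half; set s := sin _ ^+ 2 in s1 *.
set z := (pi * y / 2) ^+ 2 in h1 h2 s1.
have : 25 / 36 <= (1 - z / 6) ^+ 2 by nra.
have ? : 0 <= z by apply: sqr_ge0.
by nra.
Qed.

End Elementary.

(** * Fourier integral of the Gaussian on the line *)

Section GaussianWave.
Variable R : realType.
Implicit Types b g s t x : R.

Notation mu := (@lebesgue_measure R).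

(** The phase g turns the cosine transform, the sine transform and all the
    translates of them into one family closed under derivation in b. *)
Definition gauss_wave b g x := expR (- x ^+ 2) * cos (b * x + g).

(** A wider Gaussian that dominates, up to constants, the waves, their derivatives in x
    and in b, and their values at points moved by at most one. *)
Definition gauss_env x : R := expR (- (x ^+ 2 / 4)).

Lemma integrable_gauss_env : mu.-integrable [set: R] (EFin \o gauss_env).
Proof.
have s2 : Num.sqrt 2 != 0 :> R by rewrite gt_eqF// sqrtr_gt0.
have := @integrable_normal_pdf R 0 (Num.sqrt 2).
move=> /(integrableZl measurableT (normal_peak (Num.sqrt 2))^-1).
congr (_.-integrable _ _); apply/funext => x /=.
rewrite normal_pdfE// -EFinM mulrA mulVf ?gt_eqF ?normal_peak_gt0// mul1r.
rewrite /normal_fun subr0 sqr_sqrtr// /gauss_env; congr (expR _)%:E.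
by rewrite -mulr_natr mulNr -natrM.
Qed.

Definition gauss_wave' b g x :=
  - (2 * x * expR (- x ^+ 2) * cos (b * x + g)) - b * expR (- x ^+ 2) * sin (b * x + g).

Lemma is_derive_gauss_wave b g x : is_derive x (1:R) (gauss_wave b g) (gauss_wave' b g x).
Proof.
rewrite /gauss_wave; apply: is_derive_eq.
by rewrite /GRing.scale/= /gauss_wave'; ring.
Qed.

Lemma is_derive_gauss_wave_freq g x b :
  is_derive b (1:R) (fun b => gauss_wave b g x) (- (x * expR (- x ^+ 2) * sin (b * x + g))).
Proof.
rewrite /gauss_wave; apply: is_derive_eq.
by rewrite /GRing.scale/=; ring.
Qed.

Lemma normr_mul_gauss_le x : `|x| * expR (- x ^+ 2) <= expR (- (x ^+ 2 / 2)).
Proof.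
have -> : - x ^+ 2 = - (x ^+ 2 / 2) + - (x ^+ 2 / 2) by lra.
rewrite expRD mulrA ler_piMl ?expR_ge0//.
rewrite expRN ler_pdivrMr ?expR_gt0// mul1r.
apply: le_trans (expR_ge1Dx _).
have := sqr_ge0 (`|x| - 1); rewrite sqrrB1 real_normK ?num_real//; lra.
Qed.

Lemma gauss_le_env x : expR (- x ^+ 2) <= gauss_env x.
Proof. by rewrite ler_expR; have := sqr_ge0 x; lra. Qed.

Lemma normr_gauss_wave_le b g x : `|gauss_wave b g x| <= gauss_env x.
Proof.
rewrite /gauss_wave normrM ger0_norm ?expR_ge0//.
by apply: le_trans (gauss_le_env x); rewrite ler_piMr ?expR_ge0 ?cos_max.
Qed.

Lemma gauss_half_shift_le x s : s ^+ 2 <= 1 ->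
  expR (- ((x + s) ^+ 2 / 2)) <= 2 * gauss_env x.
Proof.
move=> hs; apply: le_trans (_ : expR (2^-1 + - (x ^+ 2 / 4)) <= _).
  rewrite ler_expR; have := sqr_ge0 (x + 2 * s); nra.
rewrite expRD ler_pM2r ?expR_gt0//.
have : expR (- 2^-1) >= 2^-1 :> R by apply: le_trans (expR_ge1Dx _); lra.
by rewrite expRN lef_pV2 ?posrE ?expR_gt0.
Qed.

Lemma normr_gauss_wave'_le b g x s : s ^+ 2 <= 1 ->
  `|gauss_wave' b g (x + s)| <= 2 * (2 + `|b|) * gauss_env x.
Proof.
move=> hs; have h1 := gauss_half_shift_le x hs.
have h2 := normr_mul_gauss_le (x + s).
set t := x + s in h1 h2 *.
have h3 : expR (- t ^+ 2) <= expR (- (t ^+ 2 / 2)) by rewrite ler_expR; have := sqr_ge0 t; lra.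
rewrite /gauss_wave'; apply: le_trans (ler_normB _ _) _.
rewrite normrN !normrM (@ger0_norm _ 2)// (ger0_norm (expR_ge0 _)).
have c1 := cos_max (b * t + g); have s1 := sin_max (b * t + g).
have e0 := expR_ge0 (- t ^+ 2).
apply: le_trans (_ : 2 * (`|t| * expR (- t ^+ 2)) + `|b| * expR (- t ^+ 2) <= _).
  apply: lerD.
    by rewrite -!mulrA ler_pM2l// mulrA ler_piMr// mulr_ge0.
  by rewrite ler_piMr// mulr_ge0.
have -> : 2 * (2 + `|b|) * gauss_env x = 2 * (2 * gauss_env x) + `|b| * (2 * gauss_env x) by ring.
apply: lerD; first by rewrite ler_pM2l//; apply: le_trans h1.
by rewrite ler_wpM2l//; apply: le_trans h1.
Qed.

Lemma gauss_wave_lip b g x s : `|s| <= 1 ->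
  `|gauss_wave b g (x + s) - gauss_wave b g x| <= `|s| * (2 * (2 + `|b|) * gauss_env x).
Proof.
move=> s1.
have [c [c1 c2]] : exists c, `|c| <= 1 /\
    gauss_wave b g (x + s) - gauss_wave b g x = gauss_wave' b g (x + c) * s.
  have cf (u v : R) : {within `[u, v], continuous (gauss_wave b g)}.
    apply: derivable_within_continuous => t _.
    by have [] := is_derive_gauss_wave b g t.
  have [s0|s0|->] := ltgtP s 0.
  - have [|||c] := @MVT _ (gauss_wave b g) (gauss_wave' b g) (x + s) x.
    + by lra.
    + by move=> t _; exact: is_derive_gauss_wave.
    + exact: cf.
    rewrite in_itv/= => /andP[h1 h2] h3; exists (c - x); split.
      by move: s1; rewrite !ler_norml => /andP[? ?]; apply/andP; split; lra.
    rewrite addrCA subrr addr0; lra.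
  - have [|||c] := @MVT _ (gauss_wave b g) (gauss_wave' b g) x (x + s).
    + by lra.
    + by move=> t _; exact: is_derive_gauss_wave.
    + exact: cf.
    rewrite in_itv/= => /andP[h1 h2] h3; exists (c - x); split.
      by move: s1; rewrite !ler_norml => /andP[? ?]; apply/andP; split; lra.
    rewrite addrCA subrr addr0; lra.
  - by exists 0; rewrite normr0 mulr0 addr0 subrr.
rewrite c2 normrM mulrC ler_wpM2l//; apply: normr_gauss_wave'_le.
by rewrite -(real_normK (num_real c)) exprn_ile1.
Qed.

Lemma continuous_gauss_wave b g : continuous (gauss_wave b g).
Proof.
move=> x; have [d _] := is_derive_gauss_wave b g x.
exact/differentiable_continuous/derivable1_diffP.
Qed.

Lemma measurable_gauss_wave b g : measurable_fun setT (gauss_wave b g).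
Proof.
by apply: continuous_measurable_fun; exact: continuous_gauss_wave.
Qed.

Lemma integrable_gauss_wave b g : mu.-integrable [set: R] (EFin \o gauss_wave b g).
Proof.
apply: (le_integrable measurableT _ _ integrable_gauss_env).
  by apply/measurable_EFinP; exact: measurable_gauss_wave.
move=> x _; rewrite /= lee_fin (ger0_norm (expR_ge0 _)).
exact: normr_gauss_wave_le.
Qed.

(** Translation invariance, as a change of variables.  A signed wave becomes
    nonnegative by adding the wave of frequency and phase 0. *)
Lemma ge0_integral_shift (f : R -> R) s : continuous f -> (forall x, 0 <= f x) ->
  (\int[mu]_x (f x)%:E = \int[mu]_x (f (x + s))%:E)%E.
Proof.
move=> cf f0.
have d1 : derive1 (fun x : R => x + s) = cst 1.
  apply/funext => x; rewrite derive1E.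
  have h : is_derive x (1:R) (fun x : R => x + s) 1 by apply: is_derive_eq; rewrite addr0.
  by have [_ ->] := h.
rewrite (@increasing_ge0_integration_by_substitutionT R (fun x => x + s) f)//.
- by apply: eq_integral => x _; rewrite d1 /= mulr1.
- by move=> x y; rewrite ltrD2r.
- by rewrite d1 => x; exact: cvg_cst.
- by rewrite d1; apply: is_cvg_cst.
- by rewrite d1; apply: is_cvg_cst.
- exact: cvg_addrr_Ny.
- exact: cvg_addrr.
Qed.

Lemma integrable_gauss_wave_shift b g s : `|s| <= 1 ->
  mu.-integrable [set: R] (EFin \o (fun x => gauss_wave b g (x + s))).
Proof.
move=> s1.
apply: (le_integrable measurableT _ _
  (integrableZl measurableT (1 + 2 * (2 + `|b|)) integrable_gauss_env)).
  apply/measurable_EFinP; apply: (measurableT_comp (measurable_gauss_wave b g)).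
  by apply: measurable_funD => //; exact: measurable_cst.
move=> x _; rewrite /= lee_fin (ger0_norm (mulr_ge0 _ (expR_ge0 _))) ?addr_ge0 ?mulr_ge0 ?addr_ge0//.
have l := gauss_wave_lip b g x s1.
have n := normr_gauss_wave_le b g x.
rewrite mulrDl mul1r.
have -> : gauss_wave b g (x + s) = gauss_wave b g x + (gauss_wave b g (x + s) - gauss_wave b g x) by ring.
apply: le_trans (ler_normD _ _) _; apply: lerD => //; apply: le_trans l _.
by rewrite ler_piMl// !mulr_ge0// ?expR_ge0// addr_ge0.
Qed.

Lemma Rintegral_gauss_wave_shift b g s : `|s| <= 1 ->
  \int[mu]_x gauss_wave b g (x + s) = \int[mu]_x gauss_wave b g x.
Proof.
move=> s1.
have sh (h : R -> R) : continuous h -> (forall x, 0 <= h x) ->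
    \int[mu]_x h (x + s) = \int[mu]_x h x.
  by move=> ch h0; rewrite /Rintegral -(ge0_integral_shift s ch h0).
have g0 x : 0 <= gauss_wave 0 0 x by rewrite /gauss_wave mul0r add0r cos0 mulr1 expR_ge0.
have gg0 x : 0 <= gauss_wave 0 0 x + gauss_wave b g x.
  rewrite /gauss_wave mul0r add0r cos0 -mulrDr.
  by apply: mulr_ge0; [exact: expR_ge0|have := cos_geN1 (b * x + g); lra].
have := sh (fun x => gauss_wave 0 0 x + gauss_wave b g x) _ gg0.
rewrite RintegralD//; [|exact: integrable_gauss_wave_shift..].
rewrite RintegralD//; [|exact: integrable_gauss_wave..].
rewrite (sh (gauss_wave 0 0))//; last exact: continuous_gauss_wave.
move=> h; apply: (addrI (\int[mu]_x gauss_wave 0 0 x)); apply: h.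
by move=> x; apply: cvgD; exact: continuous_gauss_wave.
Qed.

(** Differentiating the translation-invariant integral of the shifted wave under
    the integral sign gives the vanishing of the integral of a derivative. *)
Lemma Rintegral_gauss_wave' b g : \int[mu]_x gauss_wave' b g x = 0.
Proof.
pose f s x := gauss_wave b g (x + s).
have df s x : is_derive s (1:R) (f ^~ x) (gauss_wave' b g (x + s)).
  have h : is_derive s (1:R) (fun s : R => x + s) 1 by apply: is_derive_eq; rewrite add0r mulr1.
  have := @is_derive1_comp R (gauss_wave b g) (fun s => x + s) s _ _ (is_derive_gauss_wave b g (x + s)) h.
  by rewrite mulr1.
have I0 : `](-1), 1[%classic (0:R) by rewrite /= in_itv/=; apply/andP; split; lra.
have p1 s x : partial1of2 f s x = gauss_wave' b g (x + s).
  by rewrite partial1of2E; have [_ ->] := df s x.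
have If s : `](-1), 1[%classic s -> `|s| <= 1.
  by rewrite /= in_itv/= => /andP[? ?]; rewrite ler_norml; apply/andP; split; exact: ltW.
have F' : \int[mu]_x gauss_wave' b g x = derive1 (fun s => \int[mu]_x f s x) 0.
  rewrite (@differentiation_under_integral R _ _ mu f setT measurableT 0 (-1) 1 I0 _ _
    (fun x => 2 * (2 + `|b|) * gauss_env x)).
  - by apply: eq_Rintegral => x _; rewrite p1 addr0.
  - by move=> s /If; exact: integrable_gauss_wave_shift.
  - by move=> s x _ _; have [] := df s x.
  - by move=> x; rewrite !mulr_ge0 ?expR_ge0 ?addr_ge0.
  - exact: (integrableZl measurableT _ integrable_gauss_env).
  - move=> s x /If s1 _; rewrite p1; apply: normr_gauss_wave'_le.
    by rewrite -(real_normK (num_real s)) exprn_ile1.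
rewrite F' derive1E.
have n0 : \forall s \near (0 : R), (fun s => \int[mu]_x f s x) s = (fun=> \int[mu]_x gauss_wave b g x) s.
  have : \forall s \near (0 : R), s \in `](-1), 1[ by apply: near_in_itvoo; exact: I0.
  by apply: filterS => s /If s1; rewrite /f Rintegral_gauss_wave_shift.
by rewrite (near_eq_derive _ n0) ?oner_neq0// derive_cst.
Qed.

Lemma integrable_id_gauss_wave b g :
  mu.-integrable [set: R] (EFin \o (fun x => x * expR (- x ^+ 2) * cos (b * x + g))).
Proof.
apply: (le_integrable measurableT _ _ (integrableZl measurableT 2 integrable_gauss_env)).
  apply/measurable_EFinP; under eq_fun do rewrite -mulrA.
  by apply: measurable_funM => //; exact: measurable_gauss_wave.
move=> x _; rewrite /= lee_fin (ger0_norm (mulr_ge0 _ (expR_ge0 _)))//.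
rewrite !normrM (ger0_norm (expR_ge0 _)).
have := @gauss_half_shift_le x 0; rewrite expr0n addr0 => /(_ ler01).
apply: le_trans; apply: le_trans (normr_mul_gauss_le x).
by rewrite ler_piMr ?cos_max// mulr_ge0 ?expR_ge0.
Qed.

(** The derivative in b brings out a factor x, which is, up to the vanishing
    integral of a derivative in x, a factor - b / 2. *)
Lemma is_derive_Rintegral_gauss_wave b g :
  is_derive b (1:R) (fun b => \int[mu]_x gauss_wave b g x) (- (b / 2) * \int[mu]_x gauss_wave b g x).
Proof.
pose f b x := gauss_wave b g x.
pose D b x := - (x * expR (- x ^+ 2) * sin (b * x + g)).
have sc t : sin t = cos (t - pi / 2) by rewrite cosBpihalf.
have bi : `](b - 1), (b + 1)[%classic b by rewrite /= in_itv/=; apply/andP; split; lra.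
have p1 t x : partial1of2 f t x = D t x.
  by rewrite partial1of2E; have [_ ->] := is_derive_gauss_wave_freq g x t.
have h1 : forall t, `](b - 1), (b + 1)[%classic t -> mu.-integrable setT (EFin \o f t).
  by move=> t _; exact: integrable_gauss_wave.
have h2 : forall t x, `](b - 1), (b + 1)[%classic t -> setT x -> derivable (f ^~ x) t 1.
  by move=> t x _ _; have [] := is_derive_gauss_wave_freq g x t.
have h3 : forall x, 0 <= 2 * gauss_env x by move=> x; rewrite mulr_ge0 ?expR_ge0.
have h4 : mu.-integrable setT (EFin \o (fun x => 2 * gauss_env x)).
  exact: (integrableZl measurableT _ integrable_gauss_env).
have h5 : forall t x, `](b - 1), (b + 1)[%classic t -> setT x -> `|partial1of2 f t x| <= 2 * gauss_env x.
  move=> t x _ _; rewrite p1 /D normrN !normrM (ger0_norm (expR_ge0 _)).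
  have := @gauss_half_shift_le x 0; rewrite expr0n addr0 => /(_ ler01).
  apply: le_trans; apply: le_trans (normr_mul_gauss_le x).
  by rewrite ler_piMr ?sin_max// mulr_ge0 ?expR_ge0.
have d1 := @derivable_under_integral R _ _ mu f setT measurableT b _ _ bi h1 h2 _ h3 h4 h5.
have d2 := @differentiation_under_integral R _ _ mu f setT measurableT b _ _ bi h1 h2 _ h3 h4 h5.
have -> : - (b / 2) * \int[mu]_x gauss_wave b g x = 'D_1 (fun b => \int[mu]_x gauss_wave b g x) b.
  have -> : 'D_1 (fun b => \int[mu]_x gauss_wave b g x) b = \int[mu]_x D b x.
    by rewrite -derive1E d2; apply: eq_Rintegral => x _; rewrite /= p1.
  have iD : mu.-integrable setT (EFin \o D b).
    have := integrableZl measurableT (-1) (integrable_id_gauss_wave b (g - pi / 2)).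
    congr (_.-integrable _ _); apply/funext => x /=.
    by rewrite -EFinM mulN1r addrA -sc.
  have := Rintegral_gauss_wave' b (g - pi / 2).
  have -> : gauss_wave' b (g - pi / 2) = fun x => 2 * D b x + b * gauss_wave b g x.
    apply/funext => x; rewrite /gauss_wave' /D addrA -sc sinBpihalf /gauss_wave; ring.
  rewrite RintegralD//.
  - rewrite (RintegralZl 2 measurableT iD).
    rewrite (RintegralZl b measurableT (integrable_gauss_wave b g)).
    by move=> h; lra.
  - exact: (integrableZl measurableT _ iD).
  - exact: (integrableZl measurableT _ (integrable_gauss_wave _ _)).
exact: DeriveDef.
Qed.

(** As a function of b the integral solves y' = - (b / 2) y, so the product with
    exp (b^2 / 4) is constant, and at b = 0 this is the Gaussian integral. *)
Lemma Rintegral_gauss_wave b g :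
  \int[mu]_x gauss_wave b g x = Num.sqrt pi * expR (- (b ^+ 2 / 4)) * cos g.
Proof.
pose H b := \int[mu]_x gauss_wave b g x.
pose K b := H b * expR (b ^+ 2 / 4).
have dK t : is_derive t (1:R) K 0.
  have dH := is_derive_Rintegral_gauss_wave t g.
  have dE : is_derive t (1:R) (fun t => expR (t ^+ 2 / 4)) (t / 2 * expR (t ^+ 2 / 4)).
    by apply: is_derive_eq; rewrite /GRing.scale/=; field.
  have := @is_deriveM _ _ H (fun t => expR (t ^+ 2 / 4)) t 1 _ _ dH dE.
  by move=> h; apply: (is_derive_eq h); rewrite /GRing.scale/= -/(H t); ring.
have := is_derive_0_is_cst b 0 dK.
rewrite /K expr0n mul0r expR0 mulr1.
have -> : H 0 = Num.sqrt pi * cos g.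
  rewrite /H; under eq_Rintegral do rewrite /gauss_wave mul0r add0r.
  rewrite RintegralZr//; last exact: integrableT_gauss.
  by congr (_ * _); rewrite /Rintegral integralT_gauss.
by move=> E; rewrite -/(H b) mulrAC -E -mulrA -expRD subrr expR0 mulr1.
Qed.

End GaussianWave.

(** * Riemann sums of Gaussian waves on the line *)

HB.instance Definition _ := isPointed.Build int 0.

Lemma esumZl (R : realType) (T : choiceType) (D : set T) (c : R) (a : T -> \bar R) :
  0 <= c -> (forall i, (0 <= a i)%E) ->
  (\esum_(i in D) (c%:E * a i) = c%:E * \esum_(i in D) a i)%E.
Proof.
have le1 (k : R) (f : T -> \bar R) : 0 <= k -> (forall i, (0 <= f i)%E) ->
    (\esum_(i in D) (k%:E * f i) <= k%:E * \esum_(i in D) f i)%E.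
  move=> k0 f0; apply: ge_ereal_sup => _ [X [finX XD] <-].
  rewrite -ge0_mule_fsumr//; apply: lee_wpmul2l; first by rewrite lee_fin.
  by apply: ereal_sup_ubound; exists X.
rewrite le_eqVlt => /predU1P[<- a0|c0 a0].
  by rewrite mul0e esum1// => i _; rewrite mul0e.
apply/eqP; rewrite eq_le le1 ?(ltW c0)//= muleC -lee_pdivlMr//.
rewrite muleC; apply: le_trans (le1 c^-1 (fun i => c%:E * a i)%E _ _).
- by apply: le_esum => i _; rewrite muleA -EFinM mulVf ?gt_eqF// mul1e.
- by rewrite invr_ge0 ltW.
- by move=> i; rewrite mule_ge0// lee_fin ltW.
Qed.

Section RiemannSum.
Variable R : realType.
Implicit Types b g d s t x : R.

Notation mu := (@lebesgue_measure R).

(** Half-open cells of side d, anchored at the points of the shifted grid, tile the line. *)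
Definition cell (d s : R) (k : int) : set R := `[d * k%:~R + s, d * k%:~R + s + d[%classic.

Lemma bigcup_cell d s : 0 < d -> \bigcup_k cell d s k = [set: R].
Proof.
move=> d0; apply/seteqP; split=> // x _; exists (Num.floor ((x - s) / d)) => //.
have /andP[] := floor_itv ((x - s) / d); rewrite /cell /= in_itv/= intrD.
by rewrite ler_pdivlMr// ltr_pdivrMr// => ? ?; apply/andP; split; lra.
Qed.

Lemma trivIset_cell d s : 0 < d -> trivIset [set: int] (cell d s).
Proof.
move=> d0 i j _ _ [x []]; rewrite /cell /= !in_itv/= => /andP[i1 i2] /andP[j1 j2].
have a1 : d * i%:~R < d * (j + 1)%:~R by rewrite intrD; lra.
have a2 : d * j%:~R < d * (i + 1)%:~R by rewrite intrD; lra.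
move: a1 a2; rewrite !ltr_pM2l// !ltr_int; lia.
Qed.

Lemma integral_cell d s (f : R -> \bar R) : 0 < d -> measurable_fun setT f ->
  (forall x, (0 <= f x)%E) ->
  (\int[mu]_x f x = \esum_(k in [set: int]) \int[mu]_(x in cell d s k) f x)%E.
Proof.
move=> d0 mf f0.
have cZ : ([set: nat] #= [set: int])%card.
  apply: card_esym; apply: eq_card_nat; first exact: countableP.
  apply/infiniteP/pcard_leTP/injPex; by exists Posz => m n _ _ [->].
have /card_set_bijP[e eb] := cZ.
rewrite (reindex_esum _ _ _ _ eb) -nneseries_esumT; last by move=> n; exact: integral_ge0.
have bc : \bigcup_k cell d s (e k) = [set: R].
  by case: eb => e1 _ e3; rewrite -(bigcup_cell s d0) -(reindex_bigcup e setT setT).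
rewrite -[in LHS]bc ge0_integral_bigcup//.
- by move=> k; exact: measurable_itv.
- by rewrite bc.
- have := @trivIset_cell d s d0; case: eb => _ e2 _.
  move=> tI i j _ _ /(tI _ _ I I) /e2; apply; exact: in_setT.
Qed.

(** The summand 1 keeps the term nonnegative, so that sums over infinite index
    sets need no summability condition; it is removed later by subtraction. *)
Definition gauss_sum_term b g x : R := expR (- x ^+ 2) * (1 + cos (b * x + g)).

Lemma integral_cell_cst d s k (r : R) : 0 <= d ->
  (\int[mu]_(x in cell d s k) r%:E = (d * r)%:E)%E.
Proof.
have [d0|d0 _|->] := ltgtP d 0; first by [].
  rewrite integral_cst; last exact: measurable_itv.
  rewrite [X in (_ * X)%E](_ : _ = d%:E); last first.
    apply: etrans (lebesgue_measure_itv _) _; rewrite /= lte_fin ltrDl d0 -EFinB.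
    by congr EFin; lra.
  by rewrite -EFinM mulrC.
by rewrite mul0r /cell addr0 set_itvco0 integral_set0.
Qed.

Lemma gauss_sum_termE b g x :
  gauss_sum_term b g x = gauss_wave 0 0 x + gauss_wave b g x.
Proof. by rewrite /gauss_sum_term /gauss_wave mul0r add0r cos0 mulrDr. Qed.

Lemma gauss_sum_term_ge0 b g x : 0 <= gauss_sum_term b g x.
Proof. by apply: mulr_ge0; [exact: expR_ge0|have := cos_geN1 (b * x + g); lra]. Qed.

Lemma gauss_sum_term_lip b g x t : `|t - x| <= 1 ->
  `|gauss_sum_term b g t - gauss_sum_term b g x| <=
  `|t - x| * ((8 + 2 * `|b|) * gauss_env x).
Proof.
move=> h; rewrite !gauss_sum_termE.
have l1 := gauss_wave_lip 0 0 x h; have l2 := gauss_wave_lip b g x h.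
have xt : x + (t - x) = t by ring.
move: l1 l2; rewrite xt normr0 => l1 l2.
rewrite opprD addrACA; apply: le_trans (ler_normD _ _) _.
apply: le_trans (lerD l1 l2) _.
by rewrite -mulrDr -mulrDl; apply: ler_wpM2l => //; apply: ler_wpM2r; [exact: expR_ge0|lra].
Qed.

Lemma integral_gauss_sum_term b g :
  (\int[mu]_x (gauss_sum_term b g x)%:E =
   (Num.sqrt pi * (1 + expR (- (b ^+ 2 / 4)) * cos g))%:E)%E.
Proof.
under eq_integral do rewrite gauss_sum_termE.
have i0 := integrable_gauss_wave (0:R) 0; have i1 := integrable_gauss_wave b g.
have := integrableD measurableT i0 i1.
move=> /integrable_fin_num => /(_ measurableT) /fineK <-.
have -> : fine (\int[mu]_x (gauss_wave 0 0 x + gauss_wave b g x)%:E) =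
  \int[mu]_x (gauss_wave 0 0 x + gauss_wave b g x) by [].
rewrite RintegralD// !Rintegral_gauss_wave cos0 expr0n mul0r oppr0 expR0; by congr EFin; ring.
Qed.

Definition gauss_sum b g d s : \bar R :=
  (d%:E * \esum_(k in [set: int]) (gauss_sum_term b g (d * k%:~R + s))%:E)%E.

Definition gauss_int b g : R := Num.sqrt pi * (1 + expR (- (b ^+ 2 / 4)) * cos g).

(** On each cell the term differs from its value at the grid point by at most d
    times an integrable envelope.  The constant does not depend on the offset s
    or on the phase g, which is what the induction on the dimension requires. *)
Lemma gauss_riemann_sum b : exists2 C : R, 0 <= C & forall d s g, 0 < d <= 1 ->
  ((gauss_int b g - C * d)%:E <= gauss_sum b g d s <= (gauss_int b g + C * d)%:E)%E.
Proof.
set c := 8 + 2 * `|b|.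
have c0 : 0 <= c by rewrite addr_ge0 ?mulr_ge0.
have ienv := integrable_gauss_env R.
have menv : measurable_fun setT (EFin \o @gauss_env R) by have /integrableP[] := ienv.
set E := \int[mu]_x gauss_env x.
have EE : (\int[mu]_x (gauss_env x)%:E = E%:E)%E.
  by rewrite /E /Rintegral fineK//; exact: integrable_fin_num.
have E0 : 0 <= E by apply: Rintegral_ge0 => x _; exact: expR_ge0.
exists (c * E); first exact: mulr_ge0.
move=> d s g /andP[d0 d1].
set S := gauss_sum b g d s; set v := gauss_int b g.
have mF : measurable_fun setT (fun x => (gauss_sum_term b g x)%:E).
  apply/measurable_EFinP; rewrite (_ : gauss_sum_term b g = gauss_wave 0 0 \+ gauss_wave b g).
    by apply: measurable_funD; exact: measurable_gauss_wave.
  by apply/funext => x; exact: gauss_sum_termE.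
have mE : measurable_fun setT (fun x => (d * c * gauss_env x)%:E).
  apply/measurable_EFinP; apply: measurable_funM; first exact: measurable_cst.
  exact/measurable_EFinP.
have F0 x : (0 <= (gauss_sum_term b g x)%:E)%E by rewrite lee_fin gauss_sum_term_ge0.
have G0 x : (0 <= (d * c * gauss_env x)%:E)%E.
  by rewrite lee_fin !mulr_ge0 ?expR_ge0// ltW.
have SE : S = (\esum_(k in [set: int]) \int[mu]_(x in cell d s k) (gauss_sum_term b g (d * k%:~R + s))%:E)%E.
  rewrite /S /gauss_sum.
  under [in RHS]eq_esum do rewrite (integral_cell_cst _ _ _ (ltW d0)) EFinM.
  by rewrite esumZl// ltW.
have intG : (\int[mu]_x (d * c * gauss_env x)%:E = (c * E * d)%:E)%E.
  under eq_integral do rewrite EFinM.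
  rewrite ge0_integralZl//; last 2 first.
  - by move=> x _; rewrite lee_fin expR_ge0.
  - by rewrite lee_fin mulr_ge0// ltW.
  by rewrite EE -EFinM; congr EFin; ring.
have near_cell k x : cell d s k x ->
    `|gauss_sum_term b g (d * k%:~R + s) - gauss_sum_term b g x| <= d * c * gauss_env x.
  rewrite /cell /= in_itv/= => /andP[x1 x2].
  have xd : `|d * k%:~R + s - x| <= d by rewrite ler_norml; apply/andP; split; lra.
  apply: le_trans (gauss_sum_term_lip _ _ (le_trans xd d1)) _.
  by rewrite -mulrA ler_wpM2r// mulr_ge0// expR_ge0.
have mc k : measurable (cell d s k) by exact: measurable_itv.
apply/andP; split.
- have : (v%:E <= S + (c * E * d)%:E)%E.
    rewrite -integral_gauss_sum_term -intG SE !(integral_cell s d0)// -esumD//; last 2 first.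
      by move=> k _; apply: integral_ge0 => x _; exact: F0.
      by move=> k _; apply: integral_ge0 => x _; exact: G0.
    apply: le_esum => k _.
    rewrite -ge0_integralD//; [|exact: mc|exact: measurable_funTS].
    apply: ge0_le_integral => //; [exact: mc|exact: measurable_funTS|..].
      by apply: emeasurable_funD => //; exact: measurable_funTS.
    move=> x /near_cell; rewrite -EFinD lee_fin ler_norml => /andP[? _]; lra.
  by rewrite EFinB leeBlDr.
- rewrite EFinD -integral_gauss_sum_term -intG SE !(integral_cell s d0)// -esumD//; last 2 first.
    by move=> k _; apply: integral_ge0 => x _; exact: F0.
    by move=> k _; apply: integral_ge0 => x _; exact: G0.
  apply: le_esum => k _.
  rewrite -ge0_integralD//; [|exact: mc|exact: measurable_funTS..].
  apply: ge0_le_integral => //; first exact: mc.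
    by apply: emeasurable_funD; exact: measurable_funTS.
  move=> x /near_cell; rewrite -EFinD lee_fin ler_norml => /andP[_ ?]; lra.
Qed.

End RiemannSum.

(** * Positive definite forms and Schur complements *)

Section Forms.
Variable R : realType.

Lemma dotvC m (u v : 'cV[R]_m) : dotv u v = dotv v u.
Proof. by rewrite /dotv -[u^T *m v]trmxK trmx_mul trmxK mxE. Qed.
Lemma dotvDl m (u v w : 'cV[R]_m) : dotv (u + v) w = dotv u w + dotv v w.
Proof. by rewrite /dotv linearD /= mulmxDl mxE. Qed.
Lemma dotvDr m (u v w : 'cV[R]_m) : dotv w (u + v) = dotv w u + dotv w v.
Proof. by rewrite /dotv mulmxDr mxE. Qed.
Lemma dotvZl m a (u v : 'cV[R]_m) : dotv (a *: u) v = a * dotv u v.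
Proof. by rewrite /dotv linearZ /= -scalemxAl mxE. Qed.
Lemma dotvZr m a (u v : 'cV[R]_m) : dotv u (a *: v) = a * dotv u v.
Proof. by rewrite /dotv -scalemxAr mxE. Qed.
Lemma dotvNl m (u v : 'cV[R]_m) : dotv (- u) v = - dotv u v.
Proof. by rewrite -scaleN1r dotvZl mulN1r. Qed.
Lemma dotvNr m (u v : 'cV[R]_m) : dotv u (- v) = - dotv u v.
Proof. by rewrite dotvC dotvNl dotvC. Qed.
Lemma dotv0l m (v : 'cV[R]_m) : dotv 0 v = 0.
Proof. by rewrite -(scale0r (0 : 'cV[R]_m)) dotvZl mul0r. Qed.
Lemma dotv0r m (v : 'cV[R]_m) : dotv v 0 = 0.
Proof. by rewrite dotvC dotv0l. Qed.
Lemma dotvE m (u v : 'cV[R]_m) : dotv u v = \sum_i u i 0 * v i 0.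
Proof. by rewrite /dotv mxE; apply: eq_bigr => i _; rewrite mxE. Qed.
Lemma dotv_tr m k (u : 'cV[R]_m) (A : 'M[R]_(m, k)) v : dotv u (A *m v) = dotv (A^T *m u) v.
Proof. by rewrite /dotv trmx_mul trmxK mulmxA. Qed.
Lemma dotv_ge0 m (u : 'cV[R]_m) : 0 <= dotv u u.
Proof. by rewrite dotvE sumr_ge0// => i _; rewrite -expr2 sqr_ge0. Qed.
Lemma dotv_gt0 m (u : 'cV[R]_m) : u != 0 -> 0 < dotv u u.
Proof.
rewrite lt0r dotv_ge0 andbT; apply: contraNN; rewrite dotvE psumr_eq0.
  move=> /allP h; apply/eqP/matrixP => i j; rewrite ord1 mxE.
  by have := h i (mem_index_enum _); rewrite mulf_eq0 orbb => /eqP.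
by move=> i _; rewrite -expr2 sqr_ge0.
Qed.

Definition posdef m (A : 'M[R]_m) := A^T = A /\ forall u, u != 0 -> 0 < dotv u (A *m u).

Section Schur.
Variables (m : nat) (a : R) (v : 'cV[R]_m) (A1 : 'M[R]_m).
Let A : 'M[R]_(1 + m) := block_mx a%:M v^T v A1.
(** The Schur complement of the upper left entry a in the matrix with blocks a, v^T, v, A1:
    the form left after completing the square in the first variable. *)
Definition schur : 'M[R]_m := A1 - a^-1 *: (v *m v^T).

Lemma dotv_block t1 t s1 s :
  dotv (col_mx t1%:M t) (A *m col_mx s1%:M s) =
  a * t1 * s1 + t1 * dotv v s + s1 * dotv v t + dotv t (A1 *m s).
Proof.
rewrite {1}/dotv /A mul_block_col tr_col_mx mul_row_col mxE.
rewrite tr_scalar_mx !mulmxDr !mul_scalar_mx !mul_mx_scalar !mxE eqxx !mulr1n.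
have -> : \sum_j t^T 0 j * (s1 *: v) j 0 = s1 * dotv v t.
  by rewrite dotvC -dotvZr /dotv mxE.
have -> : \sum_j v^T 0 j * s j 0 = dotv v s by rewrite /dotv mxE.
have -> : \sum_j t^T 0 j * (A1 *m s) j 0 = dotv t (A1 *m s) by rewrite /dotv mxE.
ring.
Qed.

Lemma dotv_schur_mul t s : dotv t (schur *m s) = dotv t (A1 *m s) - dotv v t * dotv v s / a.
Proof.
rewrite /schur mulmxBl dotvDr dotvNr -scalemxAl dotvZr -mulmxA (dotv_tr t v).
have -> : dotv (v^T *m t) (v^T *m s) = dotv v t * dotv v s.
  by rewrite dotvE big_ord1 /dotv.
by congr (_ - _); ring.
Qed.

Hypothesis a0 : 0 < a.

(** Completing the square in the first coordinate. *)
Lemma dotv_schur t1 t s1 s :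
  dotv (col_mx t1%:M t) (A *m col_mx s1%:M s) =
  a * (t1 + dotv v t / a) * (s1 + dotv v s / a) + dotv t (schur *m s).
Proof. by rewrite dotv_block dotv_schur_mul; field; rewrite gt_eqF. Qed.

Lemma det_schur : \det A = a * \det schur.
Proof.
have -> : A = block_mx 1%:M 0 (a^-1 *: v) 1%:M *m block_mx a%:M v^T 0 schur.
  rewrite mulmx_block !mul1mx !mul0mx !addr0 /A; congr block_mx.
    by rewrite mul_mx_scalar scalerA divff ?gt_eqF// scale1r.
  by rewrite -scalemxAl addrC subrK.
by rewrite det_mulmx det_lblock det_ublock !det1 !mul1r det_scalar1.
Qed.

Lemma posdef_schur : posdef A -> posdef schur.
Proof.
move=> [sA pA]; split.
  rewrite /schur linearB /= linearZ /= trmx_mul trmxK; congr (_ - _).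
  by move: sA; rewrite /A tr_block_mx => /eq_block_mx[].
move=> u u0; have := pA (col_mx (- (dotv v u / a))%:M u).
rewrite dotv_schur addNr mulr0 add0r; apply.
by rewrite col_mx_eq0 (negPf u0) andbF.
Qed.
End Schur.

(** Induction principle for positive definite matrices, by splitting off one coordinate. *)
Lemma posdef_block m (A : 'M[R]_(1 + m)) : posdef A -> exists a v A1,
  [/\ 0 < a, A = block_mx a%:M v^T v A1 & posdef (schur a v A1)].
Proof.
move=> pA; have [sA hA] := pA.
have bA : A = block_mx (ulsubmx A 0 0)%:M (dlsubmx A)^T (dlsubmx A) (drsubmx A).
  by rewrite -mx11_scalar trmx_dlsub sA submxK.
exists (ulsubmx A 0 0), (dlsubmx A), (drsubmx A).
have a0 : 0 < ulsubmx A 0 0.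
  have := hA (col_mx 1%:M 0); rewrite {1}bA dotv_block !dotv0r dotv0l; rewrite !mulr1 !mulr0 !addr0; apply.
  by rewrite col_mx_eq0 negb_and; apply/orP; left; apply/eqP => /matrixP /(_ 0 0); rewrite !mxE eqxx => /eqP; rewrite oner_eq0.
split=> //; apply: posdef_schur => //; by rewrite -bA.
Qed.

Lemma posdef_det_gt0 m (A : 'M[R]_m) : posdef A -> 0 < \det A.
Proof.
elim: m A => [|m IH] A pA; first by rewrite det_mx00.
have [a [v [A1 [a0 -> pS]]]] := posdef_block pA.
by rewrite det_schur// mulr_gt0 ?IH.
Qed.

End Forms.

(** * Gaussian sums over a fine grid in dimension m *)

Section LatticeGauss.
Variable R : realType.

Definition gridpt m (d : R) (z : 'cV[int]_m) : 'cV[R]_m := d *: map_mx intr z.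

Definition qform m (A : 'M[R]_m) (u : 'cV[R]_m) := dotv u (A *m u).

(** The Gaussian of the form A times 1 + cos <u, A y>.  Writing the frequency as
    A y makes the family stable under Schur complements. *)
Definition lgauss_term m (A : 'M[R]_m) (y : 'cV[R]_m) (u : 'cV[R]_m) : R :=
  expR (- qform A u) * (1 + cos (dotv u (A *m y))).

Definition lgauss m (A : 'M[R]_m) y d : \bar R :=
  ((d ^+ m)%:E * \esum_(z in [set: 'cV[int]_m]) (lgauss_term A y (gridpt d z))%:E)%E.

(** The integral of lgauss_term over R^m. *)
Definition lgauss_int m (A : 'M[R]_m) y : R :=
  Num.sqrt pi ^+ m / Num.sqrt (\det A) * (1 + expR (- (qform A y / 4))).

Lemma lgauss_term_ge0 m (A : 'M[R]_m) y u : 0 <= lgauss_term A y u.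
Proof. by apply: mulr_ge0; [exact: expR_ge0|have := cos_geN1 (dotv u (A *m y)); lra]. Qed.

Lemma esum_col_mx m (f : 'cV[int]_(1 + m) -> \bar R) : (forall z, (0 <= f z)%E) ->
  (\esum_(z in [set: 'cV[int]_(1 + m)]) f z =
   \esum_(z in [set: 'cV[int]_m]) \esum_(k in [set: int]) f (col_mx k%:M z))%E.
Proof.
move=> f0; rewrite esum_esum//.
have -> : [set: 'cV[int]_m] `*`` (fun=> [set: int]) = [set: 'cV[int]_m * int].
  by apply/seteqP; split.
apply: (@reindex_esum _ _ _ setT setT (fun p : 'cV[int]_m * int => col_mx p.2%:M p.1)).
split=> //.
- move=> [z k] [z' k'] _ _ /= /eq_col_mx[/matrixP/(_ 0 0)].
  by rewrite !mxE !eqxx !mulr1n => -> ->.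
- move=> z _; exists (dsubmx z, usubmx z 0 0) => //=.
  by rewrite -mx11_scalar vsubmxK.
Qed.

Lemma gridpt_col m d k (z : 'cV[int]_m) :
  gridpt d (col_mx k%:M z) = col_mx (d * k%:~R)%:M (gridpt d z).
Proof.
rewrite /gridpt map_col_mx scale_col_mx; congr col_mx.
by rewrite map_scalar_mx /= scale_scalar_mx.
Qed.

Section Step.
Variables (m : nat) (a : R) (v : 'cV[R]_m) (A1 : 'M[R]_m) (y1 : R) (y : 'cV[R]_m).
Hypothesis a0 : 0 < a.
Let A : 'M[R]_(1 + m) := block_mx a%:M v^T v A1.
Let S := schur a v A1.
Let Y : 'cV[R]_(1 + m) := col_mx y1%:M y.
Let b := Num.sqrt a * (y1 + dotv v y / a).

(** Completing the square in the first coordinate leaves a one-dimensional wave,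
    whose offset and phase depend on the other coordinates t but whose frequency b does not. *)
Lemma lgauss_term_col t1 t : lgauss_term A Y (col_mx t1%:M t) =
  expR (- qform S t) *
  gauss_sum_term b (dotv t (S *m y)) (Num.sqrt a * (t1 + dotv v t / a)).
Proof.
rewrite /lgauss_term /qform /Y !dotv_schur// /gauss_sum_term mulrA -expRD.
have aa : a = Num.sqrt a * Num.sqrt a by rewrite -expr2 sqr_sqrtr// ltW.
congr (expR _ * (1 + cos _)); first by rewrite -/S {1}aa; ring.
by rewrite -/S {1}aa /b; ring.
Qed.

Lemma esum_lgauss_term_col d t : 0 < d ->
  (d%:E * (\esum_(k in [set: int]) (lgauss_term A Y (col_mx (d * k%:~R)%:M t))%:E) =
   (expR (- qform S t) / Num.sqrt a)%:E *
     gauss_sum b (dotv t (S *m y)) (Num.sqrt a * d) (Num.sqrt a * (dotv v t / a)))%E.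
Proof.
move=> d0; have sa : 0 < Num.sqrt a by rewrite sqrtr_gt0.
rewrite /gauss_sum muleA -EFinM.
under eq_esum do rewrite lgauss_term_col EFinM mulrDr mulrA.
rewrite esumZl ?expR_ge0//; last by move=> i; rewrite lee_fin gauss_sum_term_ge0.
rewrite muleA -EFinM; congr (_%:E * _)%E; field.
by rewrite gt_eqF.
Qed.

Let rho := expR (- (b ^+ 2 / 4)).
Let lam := Num.sqrt pi / Num.sqrt a.

(** Summing out the first coordinate turns the term for A into
    sqrt (pi / a) exp (- S (t)) (1 + rho cos), written here as a combination of
    the terms for the Schur complement S at frequencies 0 and y so that all
    coefficients are nonnegative.  The error is O (d) uniformly in t because the
    Riemann sum bound is uniform in offset and phase. *)
Lemma lgauss_step : exists C d0 : R, [/\ 0 <= C, 0 < d0 & forall d, 0 < d <= d0 ->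
  ((lam * (1 - rho) / 2)%:E * lgauss S 0 d + (lam * rho)%:E * lgauss S y d
     <= lgauss A Y d + (C * d)%:E * lgauss S 0 d /\
   lgauss A Y d <=
   (lam * (1 - rho) / 2)%:E * lgauss S 0 d + (lam * rho)%:E * lgauss S y d +
     (C * d)%:E * lgauss S 0 d)%E].
Proof.
have sa : 0 < Num.sqrt a by rewrite sqrtr_gt0.
have [C C0 HC] := gauss_riemann_sum b.
exists (C / 2), (Num.sqrt a)^-1; split; [by rewrite divr_ge0|by rewrite invr_gt0|].
move=> d /andP[d0 d1].
have dm0 : 0 <= d ^+ m by rewrite exprn_ge0 ?ltW.
have rho1 : rho <= 1 by rewrite expR_le1 oppr_le0 divr_ge0 ?sqr_ge0.
have rho0 : 0 <= rho by exact: expR_ge0.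
have lam0 : 0 <= lam by rewrite divr_ge0 ?sqrtr_ge0.
have term0 (z : 'cV[int]_m) y' : (0 <= (lgauss_term S y' (gridpt d z))%:E)%E.
  by rewrite lee_fin lgauss_term_ge0.
have cterm0 (c : R) (z : 'cV[int]_m) y' : 0 <= c -> (0 <= c%:E * (lgauss_term S y' (gridpt d z))%:E)%E.
  by move=> ?; apply: mule_ge0; rewrite ?lee_fin// lgauss_term_ge0.
pose mid t := lam * (1 - rho) / 2 * lgauss_term S 0 t + lam * rho * lgauss_term S y t.
pose err t := C / 2 * d * lgauss_term S 0 t.
have E0 t : lgauss_term S 0 t = 2 * expR (- qform S t).
  by rewrite /lgauss_term mulmx0 dotv0r cos0; ring.
have c1 : 0 <= lam * (1 - rho) / 2 by rewrite divr_ge0// mulr_ge0// subr_ge0.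
have c2 : 0 <= lam * rho by rewrite mulr_ge0.
have c3 : 0 <= C / 2 * d by rewrite mulr_ge0 ?(ltW d0)// divr_ge0.
have mid0 t : 0 <= mid t by apply: addr_ge0; apply: mulr_ge0 => //; exact: lgauss_term_ge0.
have err0 t : 0 <= err t by rewrite mulr_ge0// lgauss_term_ge0.
have midE : ((lam * (1 - rho) / 2)%:E * lgauss S 0 d + (lam * rho)%:E * lgauss S y d =
    (d ^+ m)%:E * (\esum_(z in [set: 'cV[int]_m]) (mid (gridpt d z))%:E))%E.
  rewrite /lgauss (muleCA (lam * (1 - rho) / 2)%:E) (muleCA (lam * rho)%:E).
  rewrite -(esumZl _ c1 (fun z => term0 z 0)) -(esumZl _ c2 (fun z => term0 z y)).
  rewrite -ge0_muleDr; last 2 first.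
  - by apply: esum_ge0 => z _; exact: cterm0.
  - by apply: esum_ge0 => z _; exact: cterm0.
  rewrite -esumD //; last 2 first.
  - by move=> z _; exact: cterm0.
  - by move=> z _; exact: cterm0.
have errE : ((C / 2 * d)%:E * lgauss S 0 d =
    (d ^+ m)%:E * \esum_(z in [set: 'cV[int]_m]) (err (gridpt d z))%:E)%E.
  by rewrite /lgauss muleCA -(esumZl _ c3 (fun z => term0 z 0)).
pose inner t := (d%:E * \esum_(k in [set: int]) (lgauss_term A Y (col_mx (d * k%:~R)%:M t))%:E)%E.
have inner0 t : (0 <= inner t)%E.
  by rewrite mule_ge0 ?lee_fin ?(ltW d0)// esum_ge0// => *; rewrite lee_fin lgauss_term_ge0.
have AE : (lgauss A Y d = (d ^+ m)%:E * \esum_(z in [set: 'cV[int]_m]) inner (gridpt d z))%E.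
  rewrite /lgauss esum_col_mx; last by move=> z; rewrite lee_fin lgauss_term_ge0.
  rewrite exprD expr1 mulrC EFinM -muleA -esumZl ?(ltW d0)//; last first.
    by move=> z; rewrite esum_ge0// => *; rewrite lee_fin lgauss_term_ge0.
  congr (_ * _)%E; apply: eq_esum => z _; congr (_ * _)%E.
  by apply: eq_esum => k _; rewrite gridpt_col.
have H t : ((mid t)%:E <= inner t + (err t)%:E /\ inner t <= (mid t)%:E + (err t)%:E)%E.
  have hd : 0 < Num.sqrt a * d <= 1.
    by rewrite mulr_gt0//= -ler_pdivlMl// mulr1.
  have := HC _ (Num.sqrt a * (dotv v t / a)) (dotv t (S *m y)) hd.
  rewrite /inner esum_lgauss_term_col//.
  case: (gauss_sum _ _ _ _) => [r| |]; last 2 first.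
    by rewrite leye_eq andbF.
    by rewrite leeNy_eq.
  rewrite !lee_fin => /andP[h1 h2].
  have e0 : 0 <= expR (- qform S t) / Num.sqrt a by rewrite divr_ge0 ?expR_ge0// ltW.
  have -> : mid t = expR (- qform S t) / Num.sqrt a * gauss_int b (dotv t (S *m y)).
    rewrite /mid E0 /lgauss_term /gauss_int -/rho /lam; field.
    by rewrite gt_eqF.
  have -> : err t = expR (- qform S t) / Num.sqrt a * (C * (Num.sqrt a * d)).
    rewrite /err E0; field; by rewrite gt_eqF.
  by rewrite -!mulrDr; split; apply: ler_wpM2l => //; lra.
rewrite midE errE AE; split.
- rewrite -ge0_muleDr; last 2 first.
  + by rewrite esum_ge0.
  + by rewrite esum_ge0// => z _; rewrite lee_fin.
  rewrite -esumD//; last by move=> z _; rewrite lee_fin.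
  by apply: lee_wpmul2l; rewrite ?lee_fin//; apply: le_esum => z _; have [] := H (gridpt d z).
- rewrite -ge0_muleDr; last 2 first.
  + by rewrite esum_ge0// => z _; rewrite lee_fin.
  + by rewrite esum_ge0// => z _; rewrite lee_fin.
  rewrite -esumD//; try by move=> z _; rewrite lee_fin.
  by apply: lee_wpmul2l; rewrite ?lee_fin//; apply: le_esum => z _; have [] := H (gridpt d z).
Qed.

End Step.

Lemma lgauss_int_step m a v A1 y1 (y : 'cV[R]_m) : 0 < a ->
  let S := schur a v A1 in
  let b := Num.sqrt a * (y1 + dotv v y / a) in
  let rho := expR (- (b ^+ 2 / 4)) in let lam := Num.sqrt pi / Num.sqrt a in
  0 < \det S ->
  lam * (1 - rho) / 2 * lgauss_int S 0 + lam * rho * lgauss_int S y =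
  lgauss_int (block_mx a%:M v^T v A1) (col_mx y1%:M y).
Proof.
move=> a0 S b rho lam dS.
rewrite /lgauss_int det_schur// sqrtrM ?(ltW a0)// exprS.
have -> : qform S 0 = 0 by rewrite /qform dotv0l.
rewrite mul0r oppr0 expR0.
have -> : expR (- (qform (block_mx a%:M v^T v A1) (col_mx y1%:M y) / 4)) = rho * expR (- (qform S y / 4)).
  rewrite /rho /b -expRD; congr expR; rewrite /qform dotv_schur// -/S exprMn sqr_sqrtr ?(ltW a0)//.
  by field; rewrite gt_eqF.
by rewrite /lam -/S; field; rewrite !gt_eqF// sqrtr_gt0.
Qed.

(** Induction on the dimension through lgauss_step; the error terms stay
    bounded because the sums for the Schur complement are. *)
Lemma lgauss_approx m (A : 'M[R]_m) y : posdef A -> exists C d0, [/\ 0 <= C, 0 < d0 &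
  forall d, 0 < d <= d0 ->
  ((lgauss_int A y - C * d)%:E <= lgauss A y d <= (lgauss_int A y + C * d)%:E)%E].
Proof.
elim: m A y => [|m IH] A y pA.
  exists 0, 1; split=> // d _; rewrite mul0r addr0 subr0 /lgauss expr0 mul1e.
  have -> : [set: 'cV[int]_0] = [set 0] by apply/seteqP; split=> // z _; exact: flatmx0.
  rewrite esum_set1 ?lee_fin ?lgauss_term_ge0// /lgauss_int /lgauss_term det_mx00 expr0 sqrtr1.
  by rewrite /qform !dotvE !big_ord0 mul0r !oppr0 expR0 cos0 divr1 !mul1r lexx.
have [a [v [A1 [a0 -> pS]]]] := posdef_block pA.
rewrite -[y](@vsubmxK _ 1) [usubmx _]mx11_scalar.
set y1 := usubmx _ _ _; set y' := dsubmx _.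
have [C1 [d1 [C10 d10 H1]]] := IH _ 0 pS.
have [C2 [d2 [C20 d20 H2]]] := IH _ y' pS.
have [C3 [d3 [C30 d30 H3]]] := lgauss_step v A1 y1 y' a0.
rewrite -lgauss_int_step ?posdef_det_gt0//.
set alpha := _ / 2; set beta := _ * expR _; move: H1 H2 H3.
set S := schur a v A1; set I0 := lgauss_int S 0; set Iy := lgauss_int S y'.
rewrite -/alpha -/beta => H1 H2 H3.
have a_ge0 : 0 <= alpha.
  by rewrite !mulr_ge0 ?invr_ge0 ?sqrtr_ge0// subr_ge0 expR_le1 oppr_le0 divr_ge0 ?sqr_ge0.
have b_ge0 : 0 <= beta by rewrite !mulr_ge0 ?invr_ge0 ?sqrtr_ge0 ?expR_ge0.
have I00 : 0 <= I0 by rewrite mulr_ge0 ?divr_ge0 ?exprn_ge0 ?sqrtr_ge0 ?addr_ge0 ?expR_ge0.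
exists (alpha * C1 + beta * C2 + C3 * (I0 + C1)), (Num.min (Num.min d1 d2) (Num.min d3 1)).
split.
- by apply: addr_ge0; [apply: addr_ge0; exact: mulr_ge0|apply: mulr_ge0 => //; exact: addr_ge0].
- by rewrite !lt_min d10 d20 d30 ltr01.
move=> d; rewrite !le_min => /andP[dp /andP[/andP[dd1 dd2] /andP[dd3 dd4]]].
have := H1 d; rewrite dp dd1 => /(_ isT).
have := H2 d; rewrite dp dd2 => /(_ isT).
have := H3 d; rewrite dp dd3 => /(_ isT).
case: (lgauss S 0 d) => [g0| |]; last 2 first.
- by move=> _ _; rewrite leye_eq andbF.
- by move=> _ _; rewrite leeNy_eq.
case: (lgauss S y' d) => [gy| |]; last 2 first.
- by move=> _; rewrite leye_eq andbF.
- by move=> _; rewrite leeNy_eq.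
case: (lgauss _ _ d) => [g| |]; last 2 first.
- by move=> [_]; rewrite leye_eq.
- by move=> []; rewrite leeNy_eq.
rewrite -!EFinM -!EFinD !lee_fin => -[h1 h2] /andP[h3 h4] /andP[h5 h6].
have e1 : `|alpha * g0 - alpha * I0| <= alpha * C1 * d.
  rewrite -mulrBr normrM ger0_norm// -mulrA ler_wpM2l//.
  by rewrite ler_norml; apply/andP; split; lra.
have e2 : `|beta * gy - beta * Iy| <= beta * C2 * d.
  rewrite -mulrBr normrM ger0_norm// -mulrA ler_wpM2l//.
  by rewrite ler_norml; apply/andP; split; lra.
have e3 : C3 * d * g0 <= C3 * (I0 + C1) * d.
  rewrite -!mulrA ler_wpM2l// mulrC ler_wpM2r//; first exact: ltW.
  apply: le_trans h6 _; rewrite lerD2l ler_piMr//.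
move: e1 e2; rewrite !ler_norml => /andP[? ?] /andP[? ?].
by apply/andP; split; lra.
Qed.

(** Finite sums suffice later: every finite sum is at most the total, and
    some finite set already captures the total up to an arbitrarily small error. *)
Lemma lgauss_finite m (A : 'M[R]_m) y e : posdef A -> 0 < e -> exists2 d0, 0 < d0 &
  forall d, 0 < d <= d0 ->
  (forall U : seq 'cV[int]_m, uniq U ->
     d ^+ m * \sum_(z <- U) lgauss_term A y (gridpt d z) <= lgauss_int A y + e) /\
  (exists U0 : seq 'cV[int]_m, forall U : seq 'cV[int]_m, uniq U -> {subset U0 <= U} ->
     lgauss_int A y - e <= d ^+ m * \sum_(z <- U) lgauss_term A y (gridpt d z)).
Proof.
move=> pA e0; have [C [d0 [C0 d00 H]]] := lgauss_approx y pA.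
exists (Num.min d0 (e / 2 / (C + 1))).
  by rewrite lt_min d00 !divr_gt0// ltr_wpDl.
move=> d; rewrite le_min => /andP[dp /andP[dd0 dd1]].
have Cd : C * d <= e / 2.
  by move: dd1; rewrite ler_pdivlMr ?ltr_wpDl//; nra.
have := H d; rewrite dp dd0 => /(_ isT) /andP[h1 h2].
have dm : 0 < d ^+ m by rewrite exprn_gt0.
have t0 z : (0 <= (lgauss_term A y (gridpt d z))%:E)%E by rewrite lee_fin lgauss_term_ge0.
have sE (U : seq 'cV[int]_m) : uniq U ->
   (\sum_(z \in [set` U]) (lgauss_term A y (gridpt d z))%:E)%E =
   (\sum_(z <- U) lgauss_term A y (gridpt d z))%:E.
  by move=> uU; rewrite -fsbig_seq// sumEFin.
split=> [U uU|].
  rewrite -lee_fin; apply: le_trans (le_trans h2 _); last by rewrite lee_fin; lra.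
  rewrite /lgauss EFinM lee_wpmul2l ?lee_fin ?(ltW dm)// -sE//.
  by apply: ereal_sup_ubound; exists [set` U] => //; split=> //; exact: finite_seq.
have : ((lgauss_int A y - e)%:E < lgauss A y d)%E.
  by apply: lt_le_trans h1; rewrite lte_fin; lra.
rewrite /lgauss muleC -lte_pdivrMr// -EFinM.
move=> /ereal_sup_gt[_ [X [fX _] <-]] hX.
exists (finmap.enum_fset (fset_set X)) => U uU sU.
rewrite mulrC -ler_pdivrMr// -lee_fin; apply: le_trans (ltW hX) _.
rewrite -sE//; apply: lee_fsum_nneg_subset => //.
  exact: finite_seq.
by move=> z; rewrite !inE => Xz; apply: sU; rewrite in_fset_set// inE.
Qed.

End LatticeGauss.

(** * Characters of the cube and of the grid *)

Section Characters.
Variable R : realType.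
Implicit Types x y : R.

Definition cis x : complex.complex R := complex.Complex (cos x) (sin x).

Lemma cisD x y : cis (x + y) = cis x * cis y.
Proof. by apply/eqP; rewrite complex.eq_complex /= cosD sinD eqxx /= (addrC (_ * _)). Qed.

Lemma cis0 : cis 0 = 1.
Proof. by rewrite /cis cos0 sin0. Qed.

Lemma cis_sum (I : Type) (r : seq I) (P : pred I) (F : I -> R) :
  cis (\sum_(i <- r | P i) F i) = \prod_(i <- r | P i) cis (F i).
Proof. by apply: (big_morph cis cisD cis0). Qed.

Lemma cisX x k : cis (x * k%:R) = cis x ^+ k.
Proof.
by elim: k => [|k IH]; rewrite ?mulr0 ?cis0// -natr1 mulrDr mulr1 cisD IH exprSr.
Qed.

Lemma cis_2pi_int (k : int) : cis (2 * pi * k%:~R) = 1.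
Proof.
have s0 := sin_pi_int R k.
have -> : 2 * pi * k%:~R = (pi * k%:~R) *+ 2 :> R by rewrite mulr2n; ring.
by rewrite /cis sin_mulr2n cos_mulr2n cos2sin2 s0 mulr0 expr0n mulr2n subr0 mul0rn; congr complex.Complex; ring.
Qed.

(** Distinguishes the nontrivial roots of unity from 1. *)
Lemma cis_eq1 x : `|x| < 2 * pi -> cis x = 1 -> x = 0.
Proof.
move=> x2 [cx _]; have : sin (x / 2) ^+ 2 = 0 by have := cos_half x; rewrite cx; lra.
move=> /eqP; rewrite sqrf_eq0 => /eqP sx; apply/eqP; apply: contraT => x0.
have : 0 < sin `|x / 2|.
  apply: sin_gt0_pi; rewrite normr_gt0 mulf_neq0//= normrM [`|2^-1|]ger0_norm//; lra.
have [h|h] := ger0P (x / 2); first by rewrite sx ltxx.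
by rewrite sinN sx oppr0 ltxx.
Qed.

Lemma Re_sum (I : finType) (F : I -> complex.complex R) :
  complex.Re (\sum_i F i) = \sum_i complex.Re (F i).
Proof. by apply: (big_morph (@complex.Re R)) => // -[a b] [c d]. Qed.

(** Geometric sum of a root of unity that differs from 1 since |u| < K. *)
Lemma sum_cis_root (K : nat) (u : int) : (`|u| < K)%N ->
  \sum_(k < K) cis (2 * pi * (u%:~R / K%:R) * k%:R) = if u == 0 then K%:R else 0.
Proof.
move=> uK; have [->|u0] := eqVneq u 0.
  under eq_bigr do rewrite mul0r mulr0 mul0r cis0.
  by rewrite sumr_const card_ord.
have K0 : (0 < K)%N by apply: leq_ltn_trans uK.
have KR : 0 < K%:R :> R by rewrite ltr0n.
set w := cis (2 * pi * (u%:~R / K%:R)).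
under eq_bigr do rewrite cisX -/w.
have wK : w ^+ K = 1.
  by rewrite -cisX -mulrA divfK ?gt_eqF// cis_2pi_int.
have w1 : w - 1 != 0.
  rewrite subr_eq0; apply/eqP => /cis_eq1 h.
  have : 2 * pi * (u%:~R / K%:R) = 0 :> R.
    apply: h; rewrite normrM ger0_norm ?mulr_ge0 ?pi_ge0// gtr_pMr ?mulr_gt0 ?pi_gt0//.
    rewrite normrM normfV [`|K%:R|]ger0_norm// ltr_pdivrMr// mul1r -intr_norm.
    have : (`|u|%R)%:~R < (K%:Z)%:~R :> R by rewrite ltr_int; lia.
    by [].
  move=> /eqP; rewrite !mulf_eq0 invr_eq0 intr_eq0 (negPf u0) !gt_eqF ?pi_gt0//.
have := subrX1 w K; rewrite wK subrr => /esym/eqP.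
by rewrite mulf_eq0 (negPf w1) => /eqP.
Qed.

Definition rc x : complex.complex R := complex.Complex x 0.

Lemma rcM x y : rc (x * y) = rc x * rc y.
Proof. by apply/eqP; rewrite complex.eq_complex /= !(mulr0, mul0r) subr0 addr0 !eqxx. Qed.

Lemma Re_rcM x (z : complex.complex R) : complex.Re (rc x * z) = x * complex.Re z.
Proof. by case: z => a b /=; rewrite mul0r subr0. Qed.

Lemma rc_prod (I : finType) (F : I -> R) : rc (\prod_i F i) = \prod_i rc (F i).
Proof. exact: (big_morph rc rcM). Qed.

Lemma cis2D1 x : 1 + cis (2 * x) = rc (2 * cos x) * cis x.
Proof.
have -> : 2 * x = x *+ 2 by rewrite mulr2n; ring.
apply/eqP; rewrite complex.eq_complex /= sin_mulr2n cos_mulr2n mulr2n !mul0r.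
by apply/andP; split; apply/eqP; ring.
Qed.

Definition bits n (e : {ffun 'I_n -> bool}) : 'cV[int]_n := \col_j (e j : nat)%:Z.

Lemma intr_mxM m n p (A : 'M[int]_(m, n)) (B : 'M[int]_(n, p)) :
  map_mx intr (A *m B) = map_mx intr A *m map_mx intr B :> 'M[R]_(m, p).
Proof. exact: map_mxM. Qed.

(** The coordinates of the random sign vector are independent, so the
    exponential sum factors; each factor is 1 + exp (2 i a) = 2 cos (a) exp (i a),
    and the phases exp (i a) recentre the sum at half the row sums of W. *)
Lemma avg_cos_bits m n (W : 'M[R]_(m, n)) (l t : 'cV[R]_m) :
  \sum_(e : {ffun 'I_n -> bool})
     cos (2 * pi * dotv t (W *m map_mx intr (bits e) - l)) =
  2 ^+ n * (cos (2 * pi * dotv t (2^-1 *: (W *m const_mx 1) - l)) *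
            \prod_j cos (pi * dotv t (col j W))).
Proof.
pose x j := pi * dotv t (col j W).
have dW (u : 'cV[R]_n) : dotv t (W *m u) = \sum_j u j 0 * dotv t (col j W).
  rewrite dotvE; under eq_bigr do rewrite mxE mulr_sumr.
  rewrite exchange_big /=; apply: eq_bigr => j _.
  by rewrite dotvE mulr_sumr; apply: eq_bigr => i _; rewrite mxE; ring.
have E e : cis (2 * pi * dotv t (W *m map_mx intr (bits e) - l)) =
    cis (- (2 * pi * dotv t l)) * \prod_j (if e j then cis (2 * x j) else 1).
  rewrite dotvDr dotvNr mulrDr mulrN addrC cisD; congr (_ * _).
  rewrite dW mulr_sumr cis_sum; apply: eq_bigr => j _; rewrite !mxE.
  by case: (e j); rewrite ?mul0r ?mulr0 ?cis0// mul1r /x mulrA.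
transitivity (complex.Re (\sum_(e : {ffun 'I_n -> bool})
   cis (2 * pi * dotv t (W *m map_mx intr (bits e) - l)))); first by rewrite Re_sum.
rewrite (eq_bigr _ (fun e _ => E e)).
rewrite -mulr_sumr -(bigA_distr_bigA (fun j (b : bool) => if b then cis (2 * x j) else 1)).
have -> : \prod_j \sum_(b : bool) (if b then cis (2 * x j) else 1) =
   rc (2 ^+ n * \prod_j cos (x j)) * cis (\sum_j x j).
  have -> : 2 ^+ n * \prod_j cos (x j) = \prod_j (2 * cos (x j)).
    by rewrite big_split /= prodr_const card_ord.
  rewrite rc_prod cis_sum -big_split /=; apply: eq_bigr => j _.
  by rewrite big_bool /= addrC cis2D1.
rewrite mulrCA Re_rcM -cisD /= -mulrA; congr (_ * _); rewrite mulrC; congr (cos _ * _).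
have -> : dotv t (2^-1 *: (W *m const_mx 1) - l) = 2^-1 * (\sum_j dotv t (col j W)) - dotv t l.
  rewrite dotvDr dotvNr dotvZr dW; congr (_ * _ - _).
  by apply: eq_bigr => j _; rewrite mxE mul1r.
by rewrite /x -mulr_sumr; field.
Qed.

(** Orthogonality of characters of (Z / K)^m.  Only classes modulo K matter, so
    the representatives tau may be chosen freely. *)
Lemma sum_cos_grid m (K : nat) (tau : {ffun 'I_m -> 'I_K} -> 'cV[int]_m) (u : 'cV[int]_m) :
  (forall c i, exists k : int, tau c i 0 = (c i : nat)%:Z + K%:Z * k) ->
  (forall i, (`|(u i 0)%R| < K)%N) ->
  \sum_c cos (2 * pi * dotv (K%:R^-1 *: map_mx intr (tau c)) (map_mx intr u)) =
  (if u == 0 then K%:R ^+ m else 0) :> R.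
Proof.
move=> Htau Hu.
have KR (i : 'I_m) : 0 < K%:R :> R by rewrite ltr0n (leq_ltn_trans _ (Hu i)).
transitivity (complex.Re (\sum_c cis (2 * pi * dotv (K%:R^-1 *: map_mx intr (tau c)) (map_mx intr u)))).
  by rewrite Re_sum.
under eq_bigr => c _.
  have -> : cis (2 * pi * dotv (K%:R^-1 *: map_mx intr (tau c)) (map_mx intr u)) =
     \prod_i cis (2 * pi * ((u i 0)%:~R / K%:R) * (c i : nat)%:R).
    rewrite dotvZl dotvE !mulr_sumr cis_sum; apply: eq_bigr => i _; rewrite !mxE.
    have [k ->] := Htau c i.
    have -> : 2 * pi * (K%:R^-1 * ((Posz (c i) + Posz K * k)%:~R * (u i 0)%:~R)) =
       2 * pi * ((u i 0)%:~R / K%:R) * (c i : nat)%:R + 2 * pi * (k * u i 0)%:~R :> R.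
      by rewrite intrD !intrM -!pmulrn; field; rewrite gt_eqF// (KR i).
    by rewrite cisD cis_2pi_int mulr1.
  over.
rewrite -(bigA_distr_bigA (fun i (k : 'I_K) => cis (2 * pi * ((u i 0)%:~R / K%:R) * (k : nat)%:R))).
under eq_bigr do rewrite sum_cis_root//.
have [->|u0] := eqVneq u 0.
  under eq_bigr do rewrite mxE eqxx.
  rewrite prodr_const card_ord.
  have -> : K%:R = rc K%:R.
    elim: (K) => [//|k IH]; rewrite -natr1 IH -[in RHS]natr1.
    by apply/eqP; rewrite complex.eq_complex /= addr0 !eqxx.
  have -> : rc K%:R ^+ m = rc (K%:R ^+ m).
    by elim: (m) => [//|k IH]; rewrite !exprS IH rcM.
  by [].
have [i ui] : exists i, u i 0 != 0.
  apply/existsP; apply: contraT; rewrite negb_exists => /forallP h.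
  case/eqP: u0; apply/matrixP => i j; rewrite ord1 mxE; apply/eqP.
  by have := h i; rewrite negbK.
by rewrite (bigD1 i)//= (negPf ui) mul0r.
Qed.

End Characters.

(** * Fourier inversion for the signing probability *)

Section SignProb.
Variable R : realType.

(** The characteristic function of W y at 2 pi t, for y uniform on {-1/2, 1/2}^n. *)
Definition char_fun m n (W : 'M[R]_(m, n)) (t : 'cV[R]_m) : R :=
  \prod_j cos (pi * dotv t (col j W)).

Lemma bits_bij_half n (e : {ffun 'I_n -> bool}) :
  half_signs R e = map_mx intr (bits e) - 2^-1 *: const_mx 1.
Proof.
apply/matrixP => i j; rewrite !mxE; case: (e i) => /=; lra.
Qed.

Lemma intr_mx_eq0 m n (z : 'M[int]_(m, n)) : (map_mx intr z == 0 :> 'M[R]_(m, n)) = (z == 0).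
Proof.
apply/eqP/eqP => [/matrixP h|->]; last by rewrite map_mx0.
apply/matrixP => i j; rewrite mxE; apply/eqP.
by have := h i j; rewrite !mxE => /eqP; rewrite intr_eq0.
Qed.

(** Fourier inversion on the group of order K^m.  It is exact as soon as K exceeds all
    coordinates of W e - l over the finitely many bit vectors e, because then no
    nonzero value is congruent to 0 modulo K. *)
Lemma sign_prob_dft m n (B : 'M[R]_m) (W : 'M[int]_(m, n)) (l : 'cV[int]_m) :
  B \in unitmx ->
  let M := B *m map_mx intr W in
  exists K0 : nat, forall K : nat, (K0 <= K)%N ->
  forall tau : {ffun 'I_m -> 'I_K} -> 'cV[int]_m,
  (forall c i, exists k : int, tau c i 0 = (c i : nat)%:Z + K%:Z * k) ->
  sign_prob M (B *m map_mx intr l - 2^-1 *: (M *m const_mx 1)) =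
  K%:R ^- m * \sum_c (cos (2 * pi * dotv (gridpt K%:R^-1 (tau c))
                        (2^-1 *: (map_mx intr W *m const_mx 1) - map_mx intr l)) *
                      char_fun (map_mx intr W) (gridpt K%:R^-1 (tau c))).
Proof.
move=> uB M.
pose u e := W *m bits e - l.
exists (\max_(p : {ffun 'I_n -> bool} * 'I_m) `|(u p.1 p.2 0)%R|).+1 => K K0 tau Htau.
have Hu e i : (`|(u e i 0)%R| < K)%N.
  apply: leq_trans K0; rewrite ltnS.
  exact: (@leq_bigmax _ (fun p : {ffun 'I_n -> bool} * 'I_m => `|(u p.1 p.2 0)%R|%N) (e, i)).
have KR : 0 < K%:R :> R by rewrite ltr0n; apply: leq_trans K0.
have two0 : 0 < 2 ^+ n :> R by rewrite exprn_gt0.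
apply: (mulfI (lt0r_neq0 two0)); rewrite /sign_prob mulrCA divff ?gt_eqF// mulr1.
have E1 e : (M *m half_signs R e == B *m map_mx intr l - 2^-1 *: (M *m const_mx 1)) = (u e == 0).
  rewrite bits_bij_half mulmxBr -scalemxAr (inj_eq (addIr _)) /M -mulmxA.
  have -> : (B *m (map_mx intr W *m map_mx intr (bits e)) == B *m map_mx intr l) =
     (map_mx intr W *m map_mx intr (bits e) == map_mx intr l :> 'cV[R]_m).
    by apply/eqP/eqP => [/(congr1 (mulmx (invmx B)))|->//]; rewrite !mulKmx.
  by rewrite -intr_mxM -subr_eq0 -intr_mx_eq0 /u map_mxB.
rewrite mulrCA mulr_sumr.
under eq_bigr => c _.
  rewrite -avg_cos_bits.
  under eq_bigr => e _.
    have -> : map_mx intr W *m map_mx intr (bits e) - map_mx intr l = map_mx intr (u e) :> 'cV[R]_m.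
      by rewrite /u map_mxB intr_mxM.
    over.
  over.
rewrite exchange_big /=.
under eq_bigr => e _ do rewrite (sum_cos_grid R Htau (Hu e)).
rewrite -big_mkcond sumr_const mulrnAr mulVf ?expf_neq0 ?gt_eqF//.
congr (_%:R); apply: eq_card => e; rewrite -[RHS]/(u e == 0) -E1 unfold_in.
by apply/idP/idP => [/set_mem|h]; last exact: mem_set.
Qed.

(** Telescoping a product of factors with relative errors e_j. *)
Lemma prod_sub_le (n : nat) (a b e : 'I_n -> R) :
  (forall j, 0 <= b j <= a j) -> (forall j, a j - b j <= a j * e j) -> (forall j, 0 <= e j) ->
  0 <= \prod_j a j - \prod_j b j <= \prod_j a j * \sum_j e j.
Proof.
elim: n a b e => [|n IH] a b e Hb He e0.
  by rewrite !big_ord0 subrr mulr0 lexx.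
rewrite !big_ord_recl.
have /andP[b0 ba] := Hb ord0; have a0 := le_trans b0 ba.
have := IH (fun j => a (lift ord0 j)) (fun j => b (lift ord0 j)) (fun j => e (lift ord0 j))
  (fun j => Hb _) (fun j => He _) (fun j => e0 _).
set pa := \prod_(i < n) a _; set pb := \prod_(i < n) b _; set s := \sum_(i < n) _.
have pb0 : 0 <= pb by apply: prodr_ge0 => j _; have /andP[] := Hb (lift ord0 j).
have s0 : 0 <= s by apply: sumr_ge0 => j _.
move=> /andP[h1 h2]; have h3 := He ord0; have h4 := e0 ord0.
apply/andP; split.
  by rewrite subr_ge0; apply: ler_pM => //; lra.
have -> : a ord0 * pa - b ord0 * pb = a ord0 * (pa - pb) + (a ord0 - b ord0) * pb by ring.
have -> : a ord0 * pa * (e ord0 + s) = a ord0 * (pa * s) + (a ord0 * e ord0) * pa by ring.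
apply: lerD; first exact: ler_wpM2l.
by apply: ler_pM => //; lra.
Qed.

Lemma dotv_CS m (u v : 'cV[R]_m) : dotv u v ^+ 2 <= dotv u u * dotv v v.
Proof.
have [->|v0] := eqVneq v 0; first by rewrite !dotv0r expr0n mulr0.
have vv := dotv_gt0 v0.
have := dotv_ge0 (dotv v v *: u - dotv u v *: v).
rewrite !(dotvDl, dotvDr, dotvNl, dotvNr, dotvZl, dotvZr) (dotvC v u) => h.
have : 0 <= dotv v v * (dotv u u * dotv v v - dotv u v ^+ 2) by lra.
by rewrite pmulr_rge0// subr_ge0.
Qed.

(** Trades the factor x^2 for a slightly wider exponential.  The bound is sharp
    at h x = 2, and h = 4 / (m + 4) will be the choice adapted to dimension m. *)
Lemma sqr_gauss_le (h x : R) : 0 < h -> 0 <= x ->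
  x ^+ 2 * expR (- x) <= 4 / h ^+ 2 * expR (- 2) * expR (- ((1 - h) * x)).
Proof.
move=> h0 x0; set y := h * x / 2.
have y0 : 0 <= y by rewrite divr_ge0// mulr_ge0// ltW.
have -> : - x = - 2%:R * y + - ((1 - h) * x) by rewrite /y; field.
rewrite expRD mulrA; apply: ler_wpM2r; first exact: expR_ge0.
have -> : x ^+ 2 = 4 / h ^+ 2 * y ^+ 2 by rewrite /y; field; rewrite gt_eqF.
rewrite -[leLHS]mulrA; apply: ler_wpM2l; first by rewrite divr_ge0// sqr_ge0.
have h1 : y <= expR (y - 1) by apply: le_trans (expR_ge1Dx _); lra.
have h2 : y ^+ 2 <= expR (2%:R * (y - 1)) by rewrite expRM_natl lerXn2r ?nnegrE ?expR_ge0.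
have -> : expR (- 2) = expR (2%:R * (y - 1)) * expR (- 2%:R * y) :> R.
  by rewrite -expRD; congr expR; ring.
by apply: ler_wpM2r => //; exact: expR_ge0.
Qed.

(** The loss from widening the exponential by 1 - h = m / (m + 4) is (1 + 4/m)^(m/2),
    at most e^2.  With the factor 1/5 of char_fun_near, 9 m^2 becomes the 9/5 of local_limit. *)
Lemma main_constant (m : nat) : (0 < m)%N ->
  (m%:R + 4) ^+ 2 * expR (- 2) * Num.sqrt ((1 + 4 / m%:R) ^+ m) <= 9 * m%:R ^+ 2 :> R.
Proof.
case: m => // -[_|m _].
  have e2 : expR (- 2) <= 7^-1 :> R.
    rewrite expRN lef_pV2 ?posrE ?expR_gt0//.
    have -> : (2 : R) = 8%:R * 4^-1 by field.
    rewrite expRM_natl; apply: le_trans (_ : (1 + 4^-1 + 4^-1 ^+ 2 / 2) ^+ 8 <= _).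
      lra.
    by rewrite lerXn2r ?nnegrE ?expR_ge0//; apply: expR_ge_quad.
  have s5 : Num.sqrt ((1 + 4 / 1%:R) ^+ 1) <= 12 / 5 :> R.
    rewrite expr1 divr1 -[leRHS]ger0_norm; last by lra.
    rewrite -sqrtr_sqr ler_wsqrtr//; lra.
  have s0 : 0 <= Num.sqrt ((1 + 4 / 1%:R) ^+ 1) :> R by rewrite sqrtr_ge0.
  have e0 := expR_ge0 (- 2 : R).
  move: s5 s0 e2 e0; set s := Num.sqrt _; set e := expR _ => s5 s0 e2 e0.
  have : e * s <= 7^-1 * (12 / 5) by apply: ler_pM.
  lra.
set k : R := m.+2%:R; have k2 : 2 <= k by rewrite ler_nat.
have sq : Num.sqrt ((1 + 4 / k) ^+ m.+2) <= expR 2.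
  rewrite -[leRHS]ger0_norm ?expR_ge0// -sqrtr_sqr ler_wsqrtr//.
  rewrite -!expRM_natl; apply: le_trans (_ : expR (4 / k) ^+ m.+2 <= _).
    rewrite lerXn2r ?nnegrE ?expR_ge0 ?expR_ge1Dx// addr_ge0// divr_ge0//; lra.
  by rewrite -expRM_natl ler_expR -/k mulrCA divff ?mulr1; [lra|rewrite gt_eqF//; lra].
rewrite -mulrA; apply: le_trans (_ : (k + 4) ^+ 2 * (expR (- 2) * expR 2) <= _).
  by rewrite ler_wpM2l ?sqr_ge0// ler_wpM2l// expR_ge0.
by rewrite -expRD addNr expR0 mulr1; nra.
Qed.

End SignProb.

(** * The characteristic function of a fixed matrix *)

Section Core.
Variable R : realType.

Lemma dotv_gram m n (A : 'M[R]_(m, n)) v :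
  dotv v (A *m A^T *m v) = \sum_j dotv v (col j A) ^+ 2.
Proof.
rewrite -mulmxA dotv_tr dotvE; apply: eq_bigr => j _; rewrite -expr2; congr (_ ^+ 2).
by rewrite dotvE mxE; apply: eq_bigr => i _; rewrite !mxE mulrC.
Qed.

Variables (m n : nat) (B : 'M[R]_m) (W : 'M[int]_(m, n)) (L : R).
Hypothesis m0 : (0 < m)%N.
Hypothesis n0 : (0 < n)%N.
Hypothesis uB : B \in unitmx.
Hypothesis L0 : 0 < L.
Let Wr : 'M[R]_(m, n) := map_mx intr W.
Let M := B *m Wr.
Hypothesis HM : forall v, n%:R / 2 * dotv v v <= dotv v (M *m M^T *m v).
Hypothesis HL : forall j, dotv (col j M) (col j M) <= L ^+ 2.

(** The vector with coordinates t in the basis dual to the columns of B. *)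
Definition dual_pt (t : 'cV[R]_m) := invmx B^T *m t.
(** Squared length of the dual point theta = B^-T t. *)
Definition dual_sqn t := dotv (dual_pt t) (dual_pt t).
(** The form t |-> (pi^2 / 2) theta^T M M^T theta in coordinates: half the
    sum of squares of the angles pi <t, w_j>. *)
Definition cov_form : 'M[R]_m := (pi ^+ 2 / 2) *: (Wr *m Wr^T).

Lemma dotv_dual_pt t w : dotv t w = dotv (dual_pt t) (B *m w).
Proof. by rewrite dotv_tr /dual_pt mulKVmx// unitmx_tr. Qed.

Lemma dotv_col_dual t j : dotv t (col j Wr) = dotv (dual_pt t) (col j M).
Proof. by rewrite dotv_dual_pt /M !colE mulmxA. Qed.

Lemma qform_cov t : qform cov_form t = 2^-1 * \sum_j (pi * dotv t (col j Wr)) ^+ 2.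
Proof.
rewrite /qform /cov_form -scalemxAl dotvZr dotv_gram !mulr_sumr.
by apply: eq_bigr => j _; rewrite exprMn; ring.
Qed.

Lemma dual_sqn_ge0 t : 0 <= dual_sqn t. Proof. exact: dotv_ge0. Qed.

Lemma qform_cov_ge t : pi ^+ 2 * (n%:R / 4 * dual_sqn t) <= qform cov_form t.
Proof.
rewrite /qform /cov_form -scalemxAl dotvZr dotv_gram.
under eq_bigr do rewrite dotv_col_dual.
rewrite -dotv_gram; have := HM (dual_pt t); rewrite -/(dual_sqn t) => h.
have : pi ^+ 2 * (n%:R / 2 * dual_sqn t) <= pi ^+ 2 * dotv (dual_pt t) (M *m M^T *m dual_pt t).
  by rewrite ler_wpM2l// sqr_ge0.
lra.
Qed.

Lemma nR0 : 0 < n%:R :> R. Proof. by rewrite ltr0n. Qed.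
Lemma mR0 : 0 < m%:R :> R. Proof. by rewrite ltr0n. Qed.

Lemma pi2_ge4 : 4 <= (pi : R) ^+ 2.
Proof. have := pi_ge2 R; nra. Qed.

Lemma pi2_le16 : (pi : R) ^+ 2 <= 16.
Proof. have := pihalf_lt2 R; have := pi_ge2 R; nra. Qed.

Lemma posdef_cov : posdef cov_form.
Proof.
split; first by rewrite /cov_form linearZ /= trmx_mul trmxK.
move=> u u0; apply: lt_le_trans (qform_cov_ge u).
have ? := nR0; have p := pi2_ge4.
have : 0 < dual_sqn u.
  apply: dotv_gt0; apply: contraNN u0 => /eqP h.
  have uB' : B^T \in unitmx by rewrite unitmx_tr.
  by rewrite -[u](mulKVmx uB') -/(dual_pt u) h mulmx0.
by move=> h; apply: mulr_gt0; [lra|apply: mulr_gt0 => //; exact: divr_gt0].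
Qed.

Lemma qform_cov_ge0 t : 0 <= qform cov_form t.
Proof.
apply: le_trans (qform_cov_ge t).
by rewrite !mulr_ge0 ?invr_ge0 ?pi_ge0 ?ler0n ?dual_sqn_ge0// exprn_ge0 ?pi_ge0.
Qed.

Lemma qformZ a (A : 'M[R]_m) t : qform (a *: A) t = a * qform A t.
Proof. by rewrite /qform -scalemxAl dotvZr. Qed.

(** For |theta| <= 1 / (16 L) the angles v_j satisfy v_j^2 <= 1/16, where the
    cosine is a Gaussian up to the relative error v_j^4 / 10.  Since
    v_j^2 <= (4 L^2 / n) x with x the value of the form, the sum of v_j^4 is
    O (L^2 x^2 / n), and sqr_gauss_le absorbs x^2. *)
Lemma char_fun_near t : dual_sqn t <= (256 * L ^+ 2)^-1 ->
  `|char_fun Wr t - expR (- qform cov_form t)| <=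
  L ^+ 2 / (5 * n%:R) * (m%:R + 4) ^+ 2 * expR (- 2) *
    expR (- (m%:R / (m%:R + 4) * qform cov_form t)).
Proof.
move=> ht; have n_gt0 := nR0; have m_gt0 := mR0.
have L2 : 0 < L ^+ 2 by rewrite exprn_gt0.
pose v j := pi * dotv t (col j Wr).
set x := qform cov_form t.
have x0 : 0 <= x := qform_cov_ge0 t.
have xE : x = 2^-1 * \sum_j v j ^+ 2 by rewrite /x qform_cov.
have vb1 j : v j ^+ 2 <= pi ^+ 2 * (dual_sqn t * L ^+ 2).
  rewrite /v exprMn ler_wpM2l ?sqr_ge0// dotv_col_dual; apply: le_trans (dotv_CS _ _) _.
  by rewrite ler_wpM2l ?dual_sqn_ge0.
have vb2 j : v j ^+ 2 <= 16^-1.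
  apply: le_trans (vb1 j) _; apply: le_trans (_ : 16 * 256^-1 <= _); last by lra.
  apply: ler_pM; [exact: sqr_ge0|by apply: mulr_ge0; [exact: dual_sqn_ge0|exact: ltW]|exact: pi2_le16|].
  by move: ht; rewrite invfM -ler_pdivrMr ?invr_gt0// invrK.
have vb3 j : v j ^+ 2 <= 4 * L ^+ 2 / n%:R * x.
  apply: le_trans (vb1 j) _; have := qform_cov_ge t; rewrite -/x => h.
  have -> : pi ^+ 2 * (dual_sqn t * L ^+ 2) =
     4 * L ^+ 2 / n%:R * (pi ^+ 2 * (n%:R / 4 * dual_sqn t)) by field; rewrite gt_eqF.
  by rewrite ler_wpM2l// mulr_ge0 ?invr_ge0 ?ler0n// mulr_ge0// ltW.
have cosb j : 0 <= cos (v j) <= expR (- (v j ^+ 2 / 2)).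
  apply/andP; split; last by apply: cos_le_gauss; have := vb2 j; lra.
  by apply: le_trans (cos_ge_quad _); have := vb2 j; lra.
have /andP[d0 d1] := prod_sub_le cosb (fun j => gauss_sub_cos_le (vb2 j))
  (fun j => divr_ge0 (exprn_even_ge0 _ (isT : ~~ odd 4)) (ler0n R 10)).
have pe : \prod_j expR (- (v j ^+ 2 / 2)) = expR (- x).
  rewrite -expR_sum xE; congr expR; rewrite mulr_sumr -sumrN.
  by apply: eq_bigr => j _; rewrite mulrC.
rewrite pe in d0 d1; rewrite distrC ger0_norm//; apply: le_trans d1 _.
have s4 : \sum_j v j ^+ 4 / 10 <= 4 * L ^+ 2 / (5 * n%:R) * x ^+ 2.
  rewrite -mulr_suml ler_pdivrMr//.
  apply: le_trans (_ : \sum_j (4 * L ^+ 2 / n%:R * x) * v j ^+ 2 <= _).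
    apply: ler_sum => j _; have -> : v j ^+ 4 = v j ^+ 2 * v j ^+ 2 by ring.
    by rewrite ler_wpM2r ?sqr_ge0.
  have sv : \sum_j v j ^+ 2 = 2 * x by rewrite xE; field.
  rewrite -mulr_sumr sv le_eqVlt; apply/orP; left; apply/eqP; field; rewrite gt_eqF//.
(* The loss h = 4 / (m + 4) balances the factor 4 / h^2 against the wider Gaussian. *)
have h0 : 0 < 4 / (m%:R + 4) :> R by rewrite divr_gt0// ltr_wpDl// ltW.
have := sqr_gauss_le h0 x0.
have -> : 1 - 4 / (m%:R + 4) = m%:R / (m%:R + 4) :> R by field; rewrite gt_eqF// ltr_wpDl// ltW.
have -> : 4 / (4 / (m%:R + 4)) ^+ 2 = (m%:R + 4) ^+ 2 / 4 :> R.
  by field; rewrite gt_eqF// ltr_wpDl// ltW.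
set E := expR (- (_ * x)) => hs.
apply: le_trans (_ : expR (- x) * (4 * L ^+ 2 / (5 * n%:R) * x ^+ 2) <= _).
  by rewrite ler_wpM2l// expR_ge0.
have -> : expR (- x) * (4 * L ^+ 2 / (5 * n%:R) * x ^+ 2) =
  4 * L ^+ 2 / (5 * n%:R) * (x ^+ 2 * expR (- x)) by ring.
apply: le_trans (_ : 4 * L ^+ 2 / (5 * n%:R) * ((m%:R + 4) ^+ 2 / 4 * expR (- 2) * E) <= _).
  by rewrite ler_wpM2l// divr_ge0 ?mulr_ge0 ?ltW// mulr_gt0.
rewrite le_eqVlt; apply/orP; left; apply/eqP; field; rewrite gt_eqF//.
Qed.

(** Half of the exponent is at least n / (512 L^2) outside the ball, and the other
    half keeps the sum over the grid convergent. *)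
Lemma gauss_far t : (256 * L ^+ 2)^-1 < dual_sqn t ->
  expR (- qform cov_form t) <=
  expR (- (n%:R / (512 * L ^+ 2))) * expR (- (2^-1 * qform cov_form t)).
Proof.
move=> ht; rewrite -expRD ler_expR; have h := qform_cov_ge t.
have p4 := pi2_ge4; have n_gt0 := nR0.
have L2 : 0 < L ^+ 2 by rewrite exprn_gt0.
have : 4 * (n%:R / 4 * dual_sqn t) <= pi ^+ 2 * (n%:R / 4 * dual_sqn t).
  by rewrite ler_wpM2r// mulr_ge0 ?dual_sqn_ge0// divr_ge0// ltW.
have : n%:R * (256 * L ^+ 2)^-1 <= n%:R * dual_sqn t by rewrite ler_wpM2l ?ltW.
have -> : n%:R * (256 * L ^+ 2)^-1 = 2 * (n%:R / (512 * L ^+ 2)) by field; rewrite gt_eqF.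
lra.
Qed.

End Core.

(** * The local limit theorem for a fixed matrix *)

Section LocalLimit.
Variable R : realType.
Variables (m n : nat) (B : 'M[R]_m) (L : R).

(** The square of the radius 1 / (16 L), at which every angle pi <theta, M_j> is at most 1/4. *)
Definition cutoff : R := (256 * L ^+ 2)^-1.

Definition congruent_reps (K : nat) (tau : {ffun 'I_m -> 'I_K} -> 'cV[int]_m) :=
  forall c i, exists k : int, tau c i 0 = (c i : nat)%:Z + K%:Z * k.

(** A choice of one point in each class of the grid modulo the integers that
    contains every grid point near the origin, so that the near part of the
    Fourier sum is a full Gaussian sum over the ball. *)
Definition good_reps (K : nat) (tau : {ffun 'I_m -> 'I_K} -> 'cV[int]_m) :=
  congruent_reps tau /\
  forall z, dual_sqn B (gridpt K%:R^-1 z) <= cutoff -> exists c, tau c = z.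

Definition far_sum (W : 'M[R]_(m, n)) (K : nat) (tau : {ffun 'I_m -> 'I_K} -> 'cV[int]_m) : R :=
  K%:R ^- m * \sum_(c | cutoff < dual_sqn B (gridpt K%:R^-1 (tau c)))
     `|char_fun W (gridpt K%:R^-1 (tau c))|.

Lemma congruent_reps_inj K (tau : {ffun 'I_m -> 'I_K} -> 'cV[int]_m) :
  congruent_reps tau -> injective tau.
Proof.
move=> H c c' E; apply/ffunP => i; apply: val_inj => /=.
have [k hk] := H c i; have [k' hk'] := H c' i.
have hm (a : 'I_K) (q : int) : (((a : nat)%:Z + K%:Z * q) %% K)%Z = a.
  by rewrite mulrC addrC modzMDl modz_small//= ltz_nat ltn_ord.
have : (c i : nat)%:Z = (c' i : nat)%:Z.
  by rewrite -(hm (c i) k) -(hm (c' i) k') -hk -hk' E.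
by case.
Qed.

Lemma sum_codom (T : choiceType) (I : finType) (tau : I -> T) (U : seq T) (f : T -> R) :
  injective tau -> uniq U -> {subset codom tau <= U} ->
  \sum_i f (tau i) = \sum_(z <- U) (if z \in codom tau then f z else 0).
Proof.
move=> it uU sU; rewrite -big_mkcond -big_filter -big_image /=.
apply: perm_big; apply: uniq_perm.
- by rewrite map_inj_uniq ?enum_uniq.
- exact: filter_uniq.
- move=> z; rewrite mem_filter /codom /=; apply/idP/andP => [h|[]//].
  by split=> //; exact: sU.
Qed.

Variables (W : 'M[int]_(m, n)).
Hypothesis m0 : (0 < m)%N.
Hypothesis n0 : (0 < n)%N.
Hypothesis uB : B \in unitmx.
Hypothesis L0 : 0 < L.
Let Wr : 'M[R]_(m, n) := map_mx intr W.
Let M := B *m Wr.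
Hypothesis HM : forall v, n%:R / 2 * dotv v v <= dotv v (M *m M^T *m v).
Hypothesis HL : forall j, dotv (col j M) (col j M) <= L ^+ 2.
Let Q := cov_form R W.

Lemma posdef_Q : posdef Q. Proof. exact: (posdef_cov n0 uB HM). Qed.
Lemma det_Q_gt0 : 0 < \det Q. Proof. exact/posdef_det_gt0/posdef_Q. Qed.

(** The integral of exp (- Q) over R^m: the value of the lattice Gaussian at 0. *)
Definition gauss_mass : R := Num.sqrt pi ^+ m / Num.sqrt (\det Q).

Lemma gauss_mass_scale a : 0 < a ->
  lgauss_int (a *: Q) 0 = 2 * (gauss_mass * Num.sqrt (a^-1 ^+ m)).
Proof.
move=> a0; rewrite /lgauss_int /qform dotv0l mul0r oppr0 expR0 detZ.
have an : 0 < a ^+ m by rewrite exprn_gt0.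
rewrite sqrtrM ?(ltW an)// exprVn sqrtrV ?(ltW an)// /gauss_mass.
by field; rewrite !gt_eqF ?sqrtr_gt0// det_Q_gt0.
Qed.

Lemma lgauss_term0 (A : 'M[R]_m) u : lgauss_term A 0 u = 2 * expR (- qform A u).
Proof. by rewrite /lgauss_term mulmx0 dotv0r cos0; ring. Qed.

(** Both sides are compared termwise with the Gaussian exp (- Q) cos on the grid
    (1/K) Z^m: near the origin by char_fun_near, far away by bounding the two
    terms separately.  The three summands of the error are the near part, the
    Gaussian mass of the far part and the far part of the characteristic function.
    The vector y solves Q y = 2 pi zeta, so that <t, Q y> is the angle of
    the inversion formula and Q (y) / 4 is the Gaussian exponent. *)
Theorem local_limit (l : 'cV[int]_m) (y : 'cV[R]_m) (tau0 : R) :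
  Q *m y = (2 * pi) *: (2^-1 *: (Wr *m const_mx 1) - map_mx intr l) ->
  (forall K0 : nat, exists K : nat, [/\ (K0 <= K)%N, (0 < K)%N &
     exists2 tau : {ffun 'I_m -> 'I_K} -> 'cV[int]_m, good_reps tau & far_sum Wr tau <= tau0]) ->
  `|sign_prob M (B *m map_mx intr l - 2^-1 *: (M *m const_mx 1)) -
    gauss_mass * expR (- (qform Q y / 4))| <=
  gauss_mass * (9 / 5 * (m%:R ^+ 2 * L ^+ 2 / n%:R)) +
  expR (- (n%:R / (512 * L ^+ 2))) * (gauss_mass * Num.sqrt (2 ^+ m)) + tau0.
Proof.
move=> Hy HK; apply/ler_addgt0Pr => e e0.
have n_gt0 : 0 < n%:R :> R by rewrite ltr0n.
have m_gt0 : 0 < m%:R :> R by rewrite ltr0n.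
have L2 : 0 < L ^+ 2 by rewrite exprn_gt0.
have pQ : posdef Q by exact: posdef_Q.
have dQ := posdef_det_gt0 pQ.
have G0 : 0 <= gauss_mass by rewrite divr_ge0 ?exprn_ge0 ?sqrtr_ge0.
set kap := L ^+ 2 / (5 * n%:R) * (m%:R + 4) ^+ 2 * expR (- 2).
have kap0 : 0 <= kap.
  apply: mulr_ge0; last exact: expR_ge0.
  apply: mulr_ge0; last exact: sqr_ge0.
  by apply: divr_ge0; rewrite ?sqr_ge0// mulr_ge0.
set T1 := expR (- (n%:R / (512 * L ^+ 2))).
have T10 : 0 <= T1 by exact: expR_ge0.
have T11 : T1 <= 1 by rewrite expR_le1 oppr_le0 divr_ge0 ?mulr_ge0 ?ltW.
set h := m%:R / (m%:R + 4) : R.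
have h0 : 0 < h by rewrite divr_gt0// ltr_wpDl// ltW.
(* Error allowed in each Gaussian sum, so that all of them add up to e. *)
pose ee := e / (2 + kap / 2).
have ee0 : 0 < ee by rewrite divr_gt0// ltr_wpDr// divr_ge0.
have phQ a : 0 < a -> posdef (a *: Q).
  move=> a0; split; first by rewrite linearZ /= pQ.1.
  by move=> u u0; rewrite -scalemxAl dotvZr mulr_gt0// pQ.2.
have [dy dy0 Dy] := lgauss_finite y pQ ee0.
have [d1 d10 D1] := lgauss_finite 0 pQ ee0.
have [d2 d20 D2] := lgauss_finite 0 (phQ h h0) ee0.
have [d3 d30 D3] := lgauss_finite 0 (phQ 2^-1 ltac:(by rewrite invr_gt0)) ee0.
have [K1 HK1] := sign_prob_dft W l uB.
pose dm := Num.min (Num.min dy d1) (Num.min d2 d3).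
have dm0 : 0 < dm by rewrite !lt_min dy0 d10 d20 d30.
have [K [KK Kp [tau [Hc Hs] Hfar]]] := HK (maxn K1 (Num.truncn dm^-1).+1).
have KR : 0 < K%:R :> R by rewrite ltr0n.
have Kd : 0 < (K%:R^-1 : R) <= dm.
  apply/andP; split; first by rewrite invr_gt0.
  rewrite -[dm]invrK lef_pV2 ?posrE ?invr_gt0//.
  apply: le_trans (ltW (truncnS_gt _)) _; rewrite ler_nat.
  by apply: leq_trans KK; exact: leq_maxr.
move: Kd; rewrite !le_min => /andP[Kd0 /andP[/andP[Kdy Kd1] /andP[Kd2 Kd3]]].
have {Dy} [Dy1 [Uy Dy2]] := Dy K%:R^-1 (introT andP (conj Kd0 Kdy)).
have {D1} [D11 [U1 D12]] := D1 K%:R^-1 (introT andP (conj Kd0 Kd1)).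
have {D2} [D2 _] := D2 K%:R^-1 (introT andP (conj Kd0 Kd2)).
have {D3} [D3 _] := D3 K%:R^-1 (introT andP (conj Kd0 Kd3)).
have it := congruent_reps_inj Hc.
(* A finite set large enough for the two lower bounds and containing all representatives. *)
pose U := undup (codom tau ++ Uy ++ U1).
have uU : uniq U by exact: undup_uniq.
have sU : {subset codom tau <= U} by move=> z hz; rewrite mem_undup mem_cat hz.
have sUy : {subset Uy <= U} by move=> z hz; rewrite mem_undup !mem_cat hz orbT.
have sU1 : {subset U1 <= U} by move=> z hz; rewrite mem_undup !mem_cat hz !orbT.
pose g z := gridpt K%:R^-1 z : 'cV[R]_m.
set k := K%:R^-1 ^+ m in Dy1 Dy2 D11 D12 D2 D3.
have k0 : 0 <= k by rewrite exprn_ge0// ltW.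
pose SE z := expR (- qform Q (g z)).
pose C z := cos (dotv (g z) (Q *m y)).
pose E' := expR (- (qform Q y / 4)).
have SE0 z : 0 <= SE z by exact: expR_ge0.
have iy : lgauss_int Q y = gauss_mass * (1 + E') by [].
have i0 : lgauss_int Q 0 = gauss_mass * 2.
  by rewrite /lgauss_int /qform dotv0l mul0r oppr0 expR0.
have sy : \sum_(z <- U) lgauss_term Q y (gridpt K%:R^-1 z) = \sum_(z <- U) SE z + \sum_(z <- U) SE z * C z.
  by rewrite -big_split /=; apply: eq_bigr => z _; rewrite /lgauss_term -/(g z) -/(SE z) -/(C z) mulrDr mulr1.
have s0 a : \sum_(z <- U) lgauss_term (a *: Q) 0 (gridpt K%:R^-1 z) = 2 * \sum_(z <- U) expR (- (a * qform Q (g z))).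
  by rewrite mulr_sumr; apply: eq_bigr => z _; rewrite lgauss_term0 qformZ.
have s1 : \sum_(z <- U) lgauss_term Q 0 (gridpt K%:R^-1 z) = 2 * \sum_(z <- U) SE z.
  by rewrite mulr_sumr; apply: eq_bigr => z _; rewrite lgauss_term0.
(* The cosine sum is the difference of the terms 1 + cos and 1. *)
have b1 : `|k * \sum_(z <- U) SE z * C z - gauss_mass * E'| <= 3 / 2 * ee.
  have := Dy1 U uU; have := Dy2 U uU sUy; have := D11 U uU; have := D12 U uU sU1.
  rewrite sy s1 iy i0 !mulrDr mulr1 => h1 h2 h3 h4.
  by rewrite ler_norml; apply/andP; split; lra.
have b2 : k * \sum_(z <- U) expR (- (h * qform Q (g z))) <= gauss_mass * Num.sqrt (h^-1 ^+ m) + ee / 2.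
  have := D2 U uU; rewrite s0 gauss_mass_scale//; lra.
have b3 : k * \sum_(z <- U) expR (- (2^-1 * qform Q (g z))) <= gauss_mass * Num.sqrt (2 ^+ m) + ee / 2.
  have := D3 U uU; rewrite s0 gauss_mass_scale ?invr_gt0// invrK; lra.
pose ch z := char_fun Wr (g z).
pose P z := if z \in codom tau then C z * ch z else 0.
pose far z := if z \in codom tau then (if cutoff < dual_sqn B (g z) then `|ch z| else 0) else 0.
have PE : sign_prob M (B *m map_mx intr l - 2^-1 *: (M *m const_mx 1)) = k * \sum_(z <- U) P z.
  rewrite (HK1 K _ tau Hc); last by apply: leq_trans KK; exact: leq_maxl.
  rewrite -exprVn; congr (_ * _); rewrite /P -(sum_codom (fun z => C z * ch z) it uU sU).
  by apply: eq_bigr => c _; rewrite /C Hy dotvZr.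
have FE : far_sum Wr tau = k * \sum_(z <- U) far z.
  rewrite /far_sum -exprVn; congr (_ * _); rewrite big_mkcond /=.
  by rewrite (sum_codom (fun z => if cutoff < dual_sqn B (g z) then `|ch z| else 0) it uU sU).
have C1 z : `|C z| <= 1 by exact: cos_max.
have far0 z : 0 <= far z by rewrite /far; do 2!case: ifP => _ //; exact: normr_ge0.
(* Points of U that represent no class carry only the Gaussian, and are far. *)
have pt z : `|P z - SE z * C z| <= kap * expR (- (h * qform Q (g z))) + far z +
    T1 * expR (- (2^-1 * qform Q (g z))).
  have e1 := expR_ge0 (- (h * qform Q (g z))); have e2 := expR_ge0 (- (2^-1 * qform Q (g z))).
  have [ht|ht] := leP (dual_sqn B (g z)) cutoff.
    have [c hc] := Hs _ ht.
    have im : z \in codom tau by rewrite -hc codom_f.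
    rewrite /P im (mulrC (SE z)) -mulrBr normrM.
    have := char_fun_near m0 n0 uB L0 HM HL ht; rewrite -/kap => hn.
    apply: le_trans (_ : 1 * `|ch z - SE z| <= _); first by rewrite ler_wpM2r.
    rewrite mul1r; apply: le_trans hn _; rewrite -addrA lerDl.
    by apply: addr_ge0 => //; exact: mulr_ge0.
  have hf := gauss_far n0 uB L0 HM ht; rewrite -/T1 -/(SE z) in hf.
  have Pf : `|P z| <= far z.
    rewrite /P /far ht; case: ifP => _; last by rewrite normr0.
    by rewrite normrM ler_piMl.
  apply: le_trans (ler_normB _ _) _.
  rewrite -addrA; apply: le_trans (_ : far z + T1 * expR (- (2^-1 * qform Q (g z))) <= _).
    apply: lerD => //; apply: le_trans hf; rewrite normrM (ger0_norm (SE0 z)).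
    by rewrite ler_piMr.
  by rewrite lerDr mulr_ge0.
have b4 : `|k * \sum_(z <- U) P z - k * \sum_(z <- U) SE z * C z| <=
   kap * (k * \sum_(z <- U) expR (- (h * qform Q (g z)))) + far_sum Wr tau +
   T1 * (k * \sum_(z <- U) expR (- (2^-1 * qform Q (g z)))).
  rewrite -mulrBr -sumrB normrM (ger0_norm k0) FE.
  have -> : kap * (k * \sum_(z <- U) expR (- (h * qform Q (g z)))) + k * \sum_(z <- U) far z +
     T1 * (k * \sum_(z <- U) expR (- (2^-1 * qform Q (g z)))) =
     k * \sum_(z <- U) (kap * expR (- (h * qform Q (g z))) + far z +
    T1 * expR (- (2^-1 * qform Q (g z)))).
    by rewrite !big_split /= -!mulr_sumr; ring.
  rewrite ler_wpM2l//; apply: le_trans (ler_norm_sum _ _ _) _.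
  exact: ler_sum.
have mc : kap * (gauss_mass * Num.sqrt (h^-1 ^+ m)) <= gauss_mass * (9 / 5 * (m%:R ^+ 2 * L ^+ 2 / n%:R)).
  have hV : h^-1 = 1 + 4 / m%:R by rewrite /h; field; rewrite !gt_eqF// ltr_wpDl// ltW.
  have := main_constant R m0; rewrite -hV => mc.
  have -> : kap * (gauss_mass * Num.sqrt (h^-1 ^+ m)) =
     (gauss_mass * (L ^+ 2 / (5 * n%:R))) * ((m%:R + 4) ^+ 2 * expR (- 2) * Num.sqrt (h^-1 ^+ m)).
    by rewrite /kap; ring.
  have -> : gauss_mass * (9 / 5 * (m%:R ^+ 2 * L ^+ 2 / n%:R)) =
     (gauss_mass * (L ^+ 2 / (5 * n%:R))) * (9 * m%:R ^+ 2) by field; rewrite gt_eqF.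
  rewrite ler_wpM2l// mulr_ge0// divr_ge0 ?sqr_ge0// mulr_ge0//.
have b2' := ler_wpM2l kap0 b2; have b3' := ler_wpM2l T10 b3.
have T1e : T1 * (ee / 2) <= ee / 2 by rewrite ler_piMl// divr_ge0// ltW.
have eeE : 2 * ee + kap * (ee / 2) = e.
  by rewrite /ee; field; rewrite gt_eqF// ltr_pwDl// ltr_wpDl.
rewrite PE -/E'.
have -> : k * \sum_(z <- U) P z - gauss_mass * E' = (k * \sum_(z <- U) P z - k * \sum_(z <- U) SE z * C z) +
   (k * \sum_(z <- U) SE z * C z - gauss_mass * E') by ring.
apply: le_trans (ler_normD _ _) _.
rewrite mulrDr in b2'; rewrite mulrDr in b3'.
by move: b1 b4; set X := `|_ - _|; set Y := `|_ - _ |; lra.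
Qed.

End LocalLimit.

(** * Tuples of independent atoms *)

Section ProductWeights.
Variable R : realType.
Variables (k n : nat) (p : 'I_k -> R).
Hypothesis p0 : forall i, 0 <= p i.
Hypothesis p1 : \sum_i p i = 1.

Definition tuple_wt (f : {ffun 'I_n -> 'I_k}) : R := \prod_j p (f j).

Lemma tuple_wt_ge0 f : 0 <= tuple_wt f.
Proof. by apply: prodr_ge0. Qed.

(** Independence: the expectation of a product of functions of distinct columns factors. *)
Lemma tuple_wt_prod (u : 'I_n -> 'I_k -> R) :
  \sum_f tuple_wt f * \prod_j u j (f j) = \prod_j \sum_i p i * u j i.
Proof.
rewrite bigA_distr_bigA; apply: eq_bigr => f _.
by rewrite /tuple_wt -big_split.
Qed.

Lemma tuple_wt_sum : \sum_f tuple_wt f = 1.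
Proof.
transitivity (\sum_f tuple_wt f * \prod_(j < n) (fun=> 1) (f j)).
  by apply: eq_bigr => f _; rewrite big1 ?mulr1.
rewrite (tuple_wt_prod (fun _ _ => 1)) big1// => j _.
by rewrite -[RHS]p1; apply: eq_bigr => i _; rewrite mulr1.
Qed.

Lemma tuple_wt_pow (u : 'I_k -> R) :
  \sum_f tuple_wt f * \prod_j u (f j) = (\sum_i p i * u i) ^+ n.
Proof. by rewrite (tuple_wt_prod (fun=> u)) prodr_const card_ord. Qed.

(** Variance of a sum of independent centred variables. *)
Lemma tuple_wt_var (h : 'I_k -> R) : \sum_i p i * h i = 0 ->
  \sum_f tuple_wt f * (\sum_j h (f j)) ^+ 2 = n%:R * \sum_i p i * h i ^+ 2.
Proof.
move=> h0.
have E (j j' : 'I_n) : \sum_f tuple_wt f * (h (f j) * h (f j')) =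
    if j == j' then \sum_i p i * h i ^+ 2 else 0.
  have -> : \sum_f tuple_wt f * (h (f j) * h (f j')) =
    \sum_f tuple_wt f * \prod_l ((if l == j then h (f l) else 1) * (if l == j' then h (f l) else 1)).
    apply: eq_bigr => f _; rewrite big_split /= -!big_mkcond /= !big_pred1_eq //.
  rewrite (tuple_wt_prod (fun l i => (if l == j then h i else 1) * (if l == j' then h i else 1))).
  rewrite (bigD1 j)//= eqxx; have [<-|jj] := eqVneq j j'.
    rewrite [X in _ * X]big1 ?mulr1; last first.
      by move=> l /negPf ->; under eq_bigr do rewrite !mulr1.
    by apply: eq_bigr => i _; rewrite expr2.
  by under eq_bigr do rewrite mulr1; rewrite h0 mul0r.
under eq_bigr => f _ do rewrite expr2 mulr_suml mulr_sumr.
rewrite exchange_big /=.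
under eq_bigr => j _.
  under eq_bigr do rewrite mulr_sumr mulr_sumr.
  rewrite exchange_big /=; under eq_bigr do rewrite E.
  rewrite -big_mkcond /= (big_pred1 j); last by move=> j'; rewrite eq_sym.
  over.
by rewrite sumr_const card_ord mulr_natl.
Qed.

Lemma tuple_markov (g : {ffun 'I_n -> 'I_k} -> R) (a : R) : 0 < a -> (forall f, 0 <= g f) ->
  \sum_(f | a < g f) tuple_wt f <= (\sum_f tuple_wt f * g f) / a.
Proof.
move=> a0 g0; rewrite ler_pdivlMr// mulr_suml.
rewrite big_mkcond /=; apply: ler_sum => f _; case: ifP => [h|_].
  by rewrite ler_wpM2l ?tuple_wt_ge0// ltW.
by rewrite mulr_ge0 ?tuple_wt_ge0.
Qed.

Variables (m : nat) (x : 'I_k -> 'cV[R]_m) (L : R).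
Hypothesis xL : forall i, dotv (x i) (x i) <= L ^+ 2.
Hypothesis xcov : forall a b, \sum_i p i * (x i a 0 * x i b 0) = (a == b)%:R.

(** Isotropy: the covariance is the identity matrix. *)
Lemma cov_quad u : \sum_i p i * dotv u (x i) ^+ 2 = dotv u u.
Proof.
transitivity (\sum_a \sum_b u a 0 * u b 0 * \sum_i p i * (x i a 0 * x i b 0)).
  under [RHS]eq_bigr do under eq_bigr do rewrite mulr_sumr.
  under [RHS]eq_bigr do rewrite exchange_big /=.
  rewrite [RHS]exchange_big /=; apply: eq_bigr => i _.
  rewrite dotvE expr2 mulr_suml mulr_sumr; apply: eq_bigr => a _.
  by rewrite !mulr_sumr; apply: eq_bigr => b _; ring.
rewrite dotvE; apply: eq_bigr => a _; rewrite (bigD1 a)//= xcov eqxx mulr1.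
by rewrite big1 ?addr0// => b ba; rewrite xcov eq_sym (negPf ba) mulr0.
Qed.

Definition tuple_mx (f : {ffun 'I_n -> 'I_k}) : 'M[R]_(m, n) := \matrix_(a, j) x (f j) a 0.

Definition gram_dev f : 'M[R]_m := tuple_mx f *m (tuple_mx f)^T - n%:R%:M.
(** The squared Frobenius norm. *)
Definition frob (D : 'M[R]_m) : R := \sum_a \sum_b D a b ^+ 2.

Lemma gram_devE f a b : gram_dev f a b = \sum_j (x (f j) a 0 * x (f j) b 0 - (a == b)%:R).
Proof.
rewrite !mxE sumrB sumr_const card_ord; congr (_ - _); last first.
  by rewrite -!mulrnA mulnC.
by apply: eq_bigr => j _; rewrite !mxE.
Qed.

(** Each entry of M M^T - n I is a sum of n independent centred variables, and
    the second moments of the entries x_a x_b of one column sum to E |X|^4 <= m L^2. *)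
Lemma expected_frob : \sum_f tuple_wt f * frob (gram_dev f) <= n%:R * (m%:R * L ^+ 2).
Proof.
under eq_bigr => f _.
  rewrite mulr_sumr; under eq_bigr do rewrite mulr_sumr.
  over.
rewrite exchange_big /=.
under eq_bigr => a _.
  rewrite exchange_big /=.
  under eq_bigr => b _.
    under eq_bigr do rewrite gram_devE.
    rewrite (tuple_wt_var (h := fun i => x i a 0 * x i b 0 - (a == b)%:R)); last first.
      under eq_bigr do rewrite mulrBr; rewrite sumrB xcov -mulr_suml p1 mul1r subrr //.
    over.
  over.
under eq_bigr do rewrite -mulr_sumr.
rewrite -mulr_sumr ler_wpM2l ?ler0n//.
apply: le_trans (_ : \sum_a \sum_b \sum_i p i * (x i a 0 * x i b 0) ^+ 2 <= _).
  apply: ler_sum => a _; apply: ler_sum => b _.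
  have -> : \sum_i p i * (x i a 0 * x i b 0 - (a == b)%:R) ^+ 2 =
     \sum_i p i * (x i a 0 * x i b 0) ^+ 2 - (a == b)%:R ^+ 2.
    under eq_bigr do rewrite sqrrB mulrDr mulrBr.
    rewrite big_split /= sumrB -[X in _ + X]mulr_suml p1 mul1r -addrA; congr (_ + _).
    under eq_bigr do rewrite mulrnAr mulrA.
    rewrite sumrMnl -mulr_suml xcov -expr2; ring.
  by rewrite gerBl sqr_ge0.
have -> : \sum_a \sum_b \sum_i p i * (x i a 0 * x i b 0) ^+ 2 =
   \sum_i p i * (dotv (x i) (x i)) ^+ 2.
  under eq_bigr do rewrite exchange_big /=.
  rewrite exchange_big /=; apply: eq_bigr => i _.
  rewrite dotvE expr2 mulr_suml mulr_sumr; apply: eq_bigr => a _.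
  by rewrite !mulr_sumr; apply: eq_bigr => b _; ring.
apply: le_trans (_ : \sum_i p i * (dotv (x i) (x i) * L ^+ 2) <= _).
  apply: ler_sum => i _; rewrite ler_wpM2l// expr2 ler_wpM2l ?dotv_ge0//.
under eq_bigr do rewrite mulrA.
rewrite -mulr_suml ler_wpM2r ?sqr_ge0//.
under eq_bigr do rewrite dotvE mulr_sumr.
rewrite exchange_big /=; under eq_bigr do rewrite xcov eqxx.
by rewrite sumr_const card_ord.
Qed.

(** The Frobenius norm dominates the operator norm. *)
Lemma frob_bound (D : 'M[R]_m) v : dotv v (D *m v) ^+ 2 <= frob D * dotv v v ^+ 2.
Proof.
apply: le_trans (dotv_CS _ _) _; rewrite expr2 mulrCA ler_wpM2l ?dotv_ge0//.
rewrite {1}dotvE /frob mulr_suml; apply: ler_sum => a _.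
rewrite -expr2; have -> : (D *m v) a 0 = dotv (row a D)^T v.
  by rewrite dotvE mxE; apply: eq_bigr => b _; rewrite !mxE.
apply: le_trans (dotv_CS _ _) _; rewrite ler_wpM2r ?dotv_ge0// dotvE.
by apply: ler_sum => b _; rewrite !mxE expr2.
Qed.

Lemma frob_good f : frob (gram_dev f) <= (n%:R / 2) ^+ 2 -> forall v,
  n%:R / 2 * dotv v v <= dotv v (tuple_mx f *m (tuple_mx f)^T *m v) <= 3 * n%:R / 2 * dotv v v.
Proof.
move=> hf v; have h := frob_bound (gram_dev f) v.
have vv := dotv_ge0 v.
have h2 : dotv v (gram_dev f *m v) ^+ 2 <= (n%:R / 2 * dotv v v) ^+ 2.
  by rewrite exprMn; apply: le_trans h _; rewrite ler_wpM2r ?sqr_ge0.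
have h3 : `|dotv v (gram_dev f *m v)| <= n%:R / 2 * dotv v v.
  rewrite -[leRHS]ger0_norm; last by rewrite mulr_ge0// divr_ge0.
  by rewrite -ler_sqr ?nnegrE// !real_normK ?num_real.
have : dotv v (gram_dev f *m v) = dotv v (tuple_mx f *m (tuple_mx f)^T *m v) - n%:R * dotv v v.
  by rewrite /gram_dev mulmxBl dotvDr dotvNr mul_scalar_mx dotvZr.
by move: h3; rewrite ler_norml => /andP[? ?] ?; apply/andP; split; lra.
Qed.

Lemma prob_frob_bad : (0 < n)%N ->
  \sum_(f | (n%:R / 2) ^+ 2 < frob (gram_dev f)) tuple_wt f <= 4 * m%:R * L ^+ 2 / n%:R.
Proof.
move=> n0; have nR : 0 < n%:R :> R by rewrite ltr0n.
have c0 : 0 < (n%:R / 2) ^+ 2 :> R by rewrite exprn_gt0// divr_gt0.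
apply: le_trans (tuple_markov c0 _) _.
  by move=> f; apply: sumr_ge0 => a _; apply: sumr_ge0 => b _; exact: sqr_ge0.
rewrite ler_pdivrMr//; apply: le_trans expected_frob _.
by rewrite le_eqVlt; apply/orP; left; apply/eqP; field; rewrite gt_eqF.
Qed.

End ProductWeights.

(** * Short representatives of the grid modulo the dual lattice *)

Section Mono.
Variable R : realType.

(** The integrals are limits of Gaussian sums over the same grid, which are
    compared termwise; this avoids comparing determinants of ordered forms. *)
Lemma lgauss_int_mono m (A A' : 'M[R]_m) : posdef A -> posdef A' ->
  (forall u, qform A u <= qform A' u) -> lgauss_int A' 0 <= lgauss_int A 0.
Proof.
move=> pA pA' h; apply/ler_addgt0Pr => e e0.
have [C [d0 [C0 d00 H]]] := lgauss_approx 0 pA.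
have [C' [d0' [C0' d00' H']]] := lgauss_approx 0 pA'.
pose d := Num.min (Num.min d0 d0') (e / (C + C' + 1)).
have c1 : 0 < C + C' + 1 by rewrite ltr_wpDl// addr_ge0.
have dp : 0 < d by rewrite !lt_min d00 d00' divr_gt0.
have dd0 : d <= d0 by rewrite /d !ge_min lexx.
have dd0' : d <= d0' by rewrite /d !ge_min lexx orbT.
have de : (C + C' + 1) * d <= e by rewrite mulrC -ler_pdivlMr// /d ge_min lexx orbT.
have := H d; rewrite dp dd0 => /(_ isT) /andP[_ h1].
have := H' d; rewrite dp dd0' => /(_ isT) /andP[h2 _].
have h3 : (lgauss A' 0 d <= lgauss A 0 d)%E.
  rewrite /lgauss lee_wpmul2l ?lee_fin ?exprn_ge0 ?(ltW dp)//.
  apply: le_esum => z _; rewrite lee_fin !lgauss_term0 ler_pM2l// ler_expR lerN2.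
  exact: h.
have := le_trans h2 (le_trans h3 h1); rewrite lee_fin.
lra.
Qed.

End Mono.

Section Reps.
Variable R : realType.
Variables (m k : nat) (p : 'I_k -> R) (B : 'M[R]_m) (z : 'I_k -> 'cV[int]_m) (L : R).
Hypothesis p0 : forall i, 0 <= p i.
Hypothesis p1 : \sum_i p i = 1.
Hypothesis uB : B \in unitmx.
Hypothesis L0 : 0 < L.
Let x i : 'cV[R]_m := B *m map_mx intr (z i).
Hypothesis xL : forall i, dotv (x i) (x i) <= L ^+ 2.
Hypothesis xcov : forall a b, \sum_i p i * (x i a 0 * x i b 0) = (a == b)%:R.

Lemma dotv_intr (u v : 'cV[int]_m) : exists q : int, dotv (map_mx intr u) (map_mx intr v) = q%:~R :> R.
Proof.
exists (\sum_i u i 0 * v i 0); rewrite dotvE rmorph_sum /=.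
by apply: eq_bigr => i _; rewrite !mxE intrM.
Qed.

(** A dual lattice vector of length below 1/L has integer inner products of
    modulus below one with all atoms, hence vanishes by isotropy.  So distinct
    dual lattice points are at distance at least 1/L. *)
Lemma dual_short_eq0 (q : 'cV[int]_m) : dual_sqn B (map_mx intr q) * L ^+ 2 < 1 -> q = 0.
Proof.
move=> h; set u := dual_pt B (map_mx intr q : 'cV[R]_m).
have d0 i : dotv u (x i) = 0.
  have [r hr] := dotv_intr q (z i).
  have E : dotv u (x i) = r%:~R by rewrite -hr [RHS](dotv_dual_pt uB).
  have : dotv u (x i) ^+ 2 < 1.
    apply: le_lt_trans h; apply: le_trans (dotv_CS _ _) _.
    by rewrite ler_wpM2l ?dotv_ge0.
  rewrite E expr2 -intrM -[1]/(1%:~R) ltr_int => h2.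
  by have -> : r = 0 by nia.
have : dotv u u = 0 by rewrite -(cov_quad xcov) big1// => i _; rewrite d0 expr0n mulr0.
move=> uu; have u0 : u = 0.
  by apply/eqP; apply: contraT => /dotv_gt0; rewrite uu ltxx.
have uB' : B^T \in unitmx by rewrite unitmx_tr.
apply/eqP; rewrite -(intr_mx_eq0 R) -[map_mx _ _](mulKVmx uB') -/(dual_pt B _) -/u u0 mulmx0 //.
Qed.

Lemma dual_sqnB_le s t : dual_sqn B (s - t) <= 2 * (dual_sqn B s + dual_sqn B t).
Proof.
rewrite /dual_sqn /dual_pt mulmxBr; set a := _ *m s; set b := _ *m t.
have := dotv_ge0 (a + b); rewrite !(dotvDl, dotvDr, dotvNl, dotvNr) (dotvC b a); lra.
Qed.

Variable ds : 'cV[R]_m -> R.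
Hypothesis ds_le : forall t (q : 'cV[int]_m), ds t <= Num.sqrt (dual_sqn B (t + map_mx intr q)).
Hypothesis ds_lt : forall t e, 0 < e ->
  exists q : 'cV[int]_m, Num.sqrt (dual_sqn B (t + map_mx intr q)) < ds t + e.

(** The function ds stands for the distance to the dual lattice, of which only the two
    properties above, those of an infimum over integer translates, are used. *)
Lemma ds_ge0 t : 0 <= ds t.
Proof.
apply/ler_addgt0Pr => e e0; have [q hq] := ds_lt t e0.
by apply: le_trans (ltW hq); rewrite sqrtr_ge0.
Qed.

Lemma ds_periodic t (q : 'cV[int]_m) : ds (t + map_mx intr q) = ds t.
Proof.
have H s (r : 'cV[int]_m) : ds s <= ds (s + map_mx intr r).
  apply/ler_addgt0Pr => e e0; have [r' hr] := ds_lt (s + map_mx intr r) e0.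
  apply: le_trans (ltW hr); rewrite -addrA -map_mxD; exact: ds_le.
apply/eqP; rewrite eq_le H andbT.
by rewrite -{2}[t](addrK (map_mx intr q)) -map_mxN H.
Qed.

(** Take in each class a point with |theta| <= 1 / (16 L) if there is one, and
    otherwise one with |theta| at most twice the distance to the dual lattice.
    In the class of a near point both kinds have length at most 1 / (8 L), so the
    chosen point differs from the near one by a dual vector shorter than 1/L,
    that is, by 0. *)
Lemma reps_exist (K : nat) : (0 < K)%N ->
  exists2 tau : {ffun 'I_m -> 'I_K} -> 'cV[int]_m, good_reps B L tau &
    forall c, cutoff L < dual_sqn B (gridpt K%:R^-1 (tau c)) ->
      dual_sqn B (gridpt K%:R^-1 (tau c)) <= 4 * ds (gridpt K%:R^-1 (tau c)) ^+ 2.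
Proof.
move=> K0; have KR : K%:R != 0 :> R by rewrite pnatr_eq0 -lt0n.
have L2 : 0 < L ^+ 2 by rewrite exprn_gt0.
have cut0 : 0 < cutoff L by rewrite invr_gt0 mulr_gt0.
(* A translate by an integer vector of t is a translate by K times it of the grid index. *)
pose base (c : {ffun 'I_m -> 'I_K}) : 'cV[int]_m := \col_i (c i : nat)%:Z.
have gB c (q : 'cV[int]_m) : gridpt K%:R^-1 (base c + K%:Z *: q) = gridpt K%:R^-1 (base c) + map_mx intr q :> 'cV[R]_m.
  rewrite /gridpt map_mxD scalerDr; congr (_ + _); apply/matrixP => i j; rewrite !mxE. rewrite /= intrM mulrA.
  by rewrite -[(Posz K)%:~R]/(K%:R) mulVf// mul1r.
have : forall c, exists q : 'cV[int]_m, let t := gridpt K%:R^-1 (base c) + map_mx intr q in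
    dual_sqn B t <= cutoff L \/ dual_sqn B t <= 4 * ds t ^+ 2.
  move=> c; set t := gridpt _ _.
  have [d0|d0] := leP (ds t) 0.
    have sc : 0 < Num.sqrt (cutoff L) by rewrite sqrtr_gt0.
    have [q hq] := ds_lt t sc.
    exists q => /=; left; rewrite -ler_sqrt ?(ltW cut0)//; apply: ltW; apply: lt_le_trans hq _; lra.
  have [q hq] := ds_lt t d0; exists q => /=; right; rewrite ds_periodic.
  rewrite -[dual_sqn _ _]sqr_sqrtr ?dual_sqn_ge0//.
  have -> : 4 * ds t ^+ 2 = (ds t + ds t) ^+ 2 by ring.
  by rewrite lerXn2r ?nnegrE ?sqrtr_ge0 ?addr_ge0 ?ds_ge0// ltW.
move=> /choice[kap hkap].
pose tau c := base c + K%:Z *: kap c.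
exists tau; last first.
  move=> c; rewrite /tau gB => hc; have [/= h|//] := hkap c.
  by move: (lt_le_trans hc h); rewrite ltxx.
split.
  by move=> c i; exists (kap c i 0); rewrite /tau !mxE.
move=> w hw.
pose c : {ffun 'I_m -> 'I_K} := [ffun i => Ordinal (ltn_pmod (absz (w i 0%R %% K%:Z)%Z) K0)].
exists c.
pose q : 'cV[int]_m := \col_i (w i 0%R %/ K%:Z)%Z.
have wE : w = base c + K%:Z *: q.
  apply/matrixP => i j; rewrite ord1 !mxE ffunE /=.
  have Kz : K%:Z != 0 by rewrite -lt0n in KR *; lia.
  have m1 : 0 <= (w i 0%R %% K%:Z)%Z by rewrite modz_ge0.
  have m2 : (w i 0%R %% K%:Z)%Z < K%:Z by rewrite ltz_pmod.
  rewrite modn_small; last by lia.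
  by rewrite gez0_abs// mulrC addrC -divz_eq.
have E : kap c - q = 0.
  apply: dual_short_eq0.
  have E1 : map_mx intr (kap c - q) = gridpt K%:R^-1 (tau c) - gridpt K%:R^-1 w :> 'cV[R]_m.
    by rewrite /tau wE !gB map_mxB opprD addrACA subrr add0r.
  have d1 : dual_sqn B (gridpt K%:R^-1 (tau c)) <= 4 * cutoff L.
    have [h|h] := hkap c; rewrite /tau gB.
      by apply: le_trans h _; lra.
    apply: le_trans h _; rewrite ler_pM2l//.
    have -> : gridpt K%:R^-1 (base c) + map_mx intr (kap c) = gridpt K%:R^-1 w + map_mx intr (kap c - q) :> 'cV[R]_m.
      by rewrite wE gB map_mxB addrACA subrr addr0.
    rewrite ds_periodic.
    have := ds_le (gridpt K%:R^-1 w) 0; rewrite map_mx0 addr0 => h2.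
    apply: le_trans (_ : Num.sqrt (dual_sqn B (gridpt K%:R^-1 w)) ^+ 2 <= _).
      by rewrite lerXn2r ?nnegrE ?sqrtr_ge0 ?ds_ge0.
    by rewrite sqr_sqrtr ?dual_sqn_ge0.
  rewrite E1; apply: le_lt_trans (_ : 2 * (4 * cutoff L + cutoff L) * L ^+ 2 < 1).
    rewrite ler_wpM2r ?(ltW L2)//; apply: le_trans (dual_sqnB_le _ _) _; lra.
  have -> : 2 * (4 * cutoff L + cutoff L) * L ^+ 2 = 10 / 256 by rewrite /cutoff; field; rewrite gt_eqF.
  lra.
by rewrite [RHS]wE /tau; congr (_ + _ *: _); apply/eqP; rewrite -subr_eq0 E.
Qed.

End Reps.

(** * The local limit theorem for most tuples of atoms *)

(** Pigeonhole principle for infinitely many indices. *)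
Lemma frequent_value (T : finType) (F : nat -> T) : exists s, forall K0 : nat, exists2 K, (K0 <= K)%N & F K = s.
Proof.
apply: contrapT => H.
have : forall s, exists K0, forall K, (K0 <= K)%N -> F K <> s.
  move=> s; apply: contrapT => Hs; apply: H; exists s => K0; apply: contrapT => HK.
  by apply: Hs; exists K0 => K KK E; apply: HK; exists K.
move=> /choice[b hb]; pose K := \max_s b s.
by apply: (hb (F K) K) => //; exact: leq_bigmax.
Qed.

Lemma sum_union_le (R : realType) (T : finType) (P P1 P2 : pred T) (w : T -> R) :
  (forall f, 0 <= w f) -> (forall f, P f -> P1 f || P2 f) ->
  \sum_(f | P f) w f <= \sum_(f | P1 f) w f + \sum_(f | P2 f) w f.
Proof.
move=> w0 h; rewrite !(big_mkcond _ w) -big_split /=; apply: ler_sum => f _.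
have := h f; have := w0 f.
by case: (P f) (P1 f) (P2 f) => [] [] [] w1 //=; rewrite ?addr0 ?add0r ?lerDr ?addr_ge0// => /(_ isT).
Qed.

Section Far.
Variable R : realType.
Variables (m k n : nat) (p : 'I_k -> R) (B : 'M[R]_m) (z : 'I_k -> 'cV[int]_m) (L : R).
Hypothesis m0 : (0 < m)%N.
Hypothesis n0 : (0 < n)%N.
Hypothesis p0 : forall i, 0 <= p i.
Hypothesis p1 : \sum_i p i = 1.
Hypothesis uB : B \in unitmx.
Hypothesis L0 : 0 < L.
Let x i : 'cV[R]_m := B *m map_mx intr (z i).
Hypothesis xL : forall i, dotv (x i) (x i) <= L ^+ 2.
Hypothesis xcov : forall a b, \sum_i p i * (x i a 0 * x i b 0) = (a == b)%:R.
Variable ds : 'cV[R]_m -> R.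
Hypothesis ds_le : forall t (q : 'cV[int]_m), ds t <= Num.sqrt (dual_sqn B (t + map_mx intr q)).
Hypothesis ds_lt : forall t e, 0 < e ->
  exists q : 'cV[int]_m, Num.sqrt (dual_sqn B (t + map_mx intr q)) < ds t + e.

(** The square of X-tilde at the point of coordinates t in the dual basis. *)
Definition xt2 t : R := \sum_i p i * mod1 (dotv t (map_mx intr (z i))) ^+ 2.

Variable sigma : R.
Hypothesis Hsigma : forall t, (forall q : 'cV[int]_m, t <> map_mx intr q) ->
  Num.sqrt (xt2 t) <= ds t / 2 -> sigma <= n%:R * xt2 t.

Definition tuple_coord (f : {ffun 'I_n -> 'I_k}) : 'M[int]_(m, n) := \matrix_(a, j) z (f j) a 0.

Lemma tuple_mxE f : tuple_mx x f = B *m map_mx intr (tuple_coord f).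
Proof.
apply/matrixP => a j; rewrite !mxE; apply: eq_bigr => b _.
by rewrite !mxE.
Qed.

Lemma char_fun_tuple f (t : 'cV[R]_m) : char_fun (map_mx intr (tuple_coord f)) t =
  \prod_j cos (pi * dotv t (map_mx intr (z (f j)))).
Proof.
apply: eq_bigr => j _; congr (cos (_ * dotv _ _)).
by apply/matrixP => a b; rewrite !mxE ord1.
Qed.

(** The columns are independent, and |cos (pi x)| <= 1 - (x mod 1)^2. *)
Lemma expected_char t : \sum_f tuple_wt p f * `|char_fun (map_mx intr (tuple_coord f)) t| <=
  expR (- (n%:R * xt2 t)).
Proof.
pose u i := `|cos (pi * dotv t (map_mx intr (z i)))|.
have -> : \sum_f tuple_wt p f * `|char_fun (map_mx intr (tuple_coord f)) t| =
    (\sum_i p i * u i) ^+ n.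
  rewrite -tuple_wt_pow; apply: eq_bigr => f _; congr (_ * _).
  by rewrite char_fun_tuple normr_prod.
have h : \sum_i p i * u i <= 1 - xt2 t.
  rewrite -p1 /xt2 -sumrB; apply: ler_sum => i _.
  by rewrite -[X in X - _]mulr1 -mulrBr ler_wpM2l// normr_cos_pi_le.
have h1 : 0 <= \sum_i p i * u i by apply: sumr_ge0 => i _; apply: mulr_ge0 => //; exact: normr_ge0.
have -> : - (n%:R * xt2 t) = n%:R * (- xt2 t) by rewrite mulrN.
rewrite expRM_natl lerXn2r ?nnegrE ?expR_ge0//; apply: le_trans h _.
exact: expR_ge1Dx.
Qed.

(** For pseudodual theta the hypothesis on sigma applies.  Otherwise
    Xt > d (theta) / 2 >= |theta| / 4, and the exponent n |theta|^2 / 16 is split into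
    one half bounded below by the cutoff and one half left as a Gaussian. *)
Lemma far_bound t : cutoff L < dual_sqn B t -> dual_sqn B t <= 4 * ds t ^+ 2 ->
  expR (- (n%:R * xt2 t)) <=
  expR (- sigma) + expR (- (n%:R * cutoff L / 32)) * expR (- (n%:R / 32 * dual_sqn B t)).
Proof.
move=> h1 h2; have cut0 : 0 < cutoff L by rewrite /cutoff invr_gt0; apply: mulr_gt0; [rewrite ltr0n|exact: exprn_gt0].
have nR : 0 < n%:R :> R by rewrite ltr0n.
have d0 := ds_ge0 ds_lt t.
have [hp|hp] := leP (Num.sqrt (xt2 t)) (ds t / 2).
  apply: (@le_trans _ _ (expR (- sigma))); last by rewrite lerDl mulr_ge0 ?expR_ge0.
  rewrite ler_expR lerN2; apply: Hsigma => // q E.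
  have : ds t <= 0.
    have := ds_le t (- q); rewrite E map_mxN subrr.
    by rewrite /dual_sqn /dual_pt mulmx0 dotv0l sqrtr0.
  nra.
apply: (@le_trans _ _ (expR (- (n%:R * cutoff L / 32)) * expR (- (n%:R / 32 * dual_sqn B t)))); last first.
  by rewrite lerDr expR_ge0.
rewrite -expRD ler_expR.
have x0 : 0 <= xt2 t by apply: sumr_ge0 => i _; rewrite mulr_ge0// sqr_ge0.
have h3 : ds t ^+ 2 / 4 <= xt2 t.
  rewrite -[xt2 t]sqr_sqrtr//; have := sqrtr_ge0 (xt2 t); nra.
have h4 : n%:R * (ds t ^+ 2 / 4) <= n%:R * xt2 t by rewrite ler_wpM2l// ltW.
have h5 : n%:R * cutoff L <= n%:R * dual_sqn B t by rewrite ler_wpM2l// ltW.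
have h6 : n%:R * dual_sqn B t <= n%:R * (4 * ds t ^+ 2) by rewrite ler_wpM2l// ltW.
lra.
Qed.

(** The quadratic form of dual_sqn. *)
Definition dual_form : 'M[R]_m := (invmx B^T)^T *m invmx B^T.

Lemma qform_dual t : qform dual_form t = dual_sqn B t.
Proof. by rewrite /qform /dual_form -mulmxA dotv_tr trmxK. Qed.

Lemma det_dual_form : \det dual_form = (\det B)^-1 ^+ 2.
Proof. by rewrite det_mulmx det_tr !det_inv det_tr expr2. Qed.

Lemma posdef_dual a : 0 < a -> posdef (a *: dual_form).
Proof.
move=> a0; split; first by rewrite linearZ /= /dual_form trmx_mul trmxK.
move=> u u0; rewrite -scalemxAl dotvZr mulr_gt0//.
rewrite -[dotv _ _]/(qform dual_form u) qform_dual; apply: dotv_gt0.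
have uB' : B^T \in unitmx by rewrite unitmx_tr.
by apply: contraNN u0 => /eqP h; rewrite -[u](mulKVmx uB') -/(dual_pt B u) h mulmx0.
Qed.

(** The integral over t in R^m of exp (- a |B^-T t|^2). *)
Definition dual_mass (a : R) : R := `|\det B| * Num.sqrt (pi / a) ^+ m.

Lemma dual_massE a : 0 < a -> lgauss_int (a *: dual_form) 0 = 2 * dual_mass a.
Proof.
move=> a0; rewrite /lgauss_int /qform dotv0l mul0r oppr0 expR0 detZ det_dual_form.
have dB : 0 < `|\det B| by rewrite normr_gt0 -unitfE -unitmxE.
have -> : Num.sqrt (a ^+ m * (\det B)^-1 ^+ 2) = Num.sqrt a ^+ m / `|\det B|.
  rewrite sqrtrM ?exprn_ge0 ?(ltW a0)// sqrtr_sqr normfV; congr (_ * _).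
  elim: (m) => [|q IH]; rewrite ?expr0 ?sqrtr1// !exprS sqrtrM ?IH// ltW//.
rewrite /dual_mass sqrtrM ?pi_ge0// sqrtrV ?(ltW a0)// exprMn exprVn.
by field; rewrite !gt_eqF ?exprn_gt0 ?sqrtr_gt0.
Qed.

Lemma dual_mass_gt0 a : 0 < a -> 0 < dual_mass a.
Proof.
move=> a0; rewrite mulr_gt0 ?exprn_gt0 ?sqrtr_gt0 ?divr_gt0 ?pi_gt0//.
by rewrite normr_gt0 -unitfE -unitmxE.
Qed.

(** Bound for the expected far part: the grid average of far_bound. *)
Definition far_mean : R :=
  expR (- sigma) + expR (- (n%:R * cutoff L / 32)) * (2 * dual_mass (n%:R / 32)).

(** Average far_bound over the representatives.  The first term is constant, and
    the second is a Gaussian sum over distinct grid points, at most twice its integral. *)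
Lemma expected_far : exists K1 : nat, forall K, (K1 <= K)%N -> (0 < K)%N ->
  exists2 tau : {ffun 'I_m -> 'I_K} -> 'cV[int]_m, good_reps B L tau &
    \sum_f tuple_wt p f * far_sum B L (map_mx intr (tuple_coord f)) tau <= far_mean.
Proof.
have nR : 0 < n%:R :> R by rewrite ltr0n.
have a0 : 0 < n%:R / 32 :> R by rewrite divr_gt0.
have dm0 := dual_mass_gt0 a0.
have dm1 : 0 < 2 * dual_mass (n%:R / 32) by rewrite mulr_gt0.
have [d0 d00 D] := lgauss_finite 0 (posdef_dual a0) dm1.
exists (Num.truncn d0^-1).+1 => K K1 K0.
have KR : 0 < K%:R :> R by rewrite ltr0n.
have Kd : K%:R^-1 <= d0.
  rewrite -[d0]invrK lef_pV2 ?posrE ?invr_gt0//.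
  by apply: le_trans (ltW (truncnS_gt _)) _; rewrite ler_nat.
have Kp : 0 < (K%:R^-1 : R) by rewrite invr_gt0.
have [D1 _] := D K%:R^-1 (introT andP (conj Kp Kd)).
have [tau gt ft] := reps_exist uB L0 xL xcov ds_le ds_lt K0.
exists tau => //.
have it := congruent_reps_inj gt.1.
pose g c := gridpt K%:R^-1 (tau c) : 'cV[R]_m.
have k0 : 0 <= K%:R ^- m :> R by rewrite invr_ge0 exprn_ge0// ltW.
have -> : \sum_f tuple_wt p f * far_sum B L (map_mx intr (tuple_coord f)) tau =
  K%:R ^- m * \sum_(c | cutoff L < dual_sqn B (g c))
     \sum_f tuple_wt p f * `|char_fun (map_mx intr (tuple_coord f)) (g c)|.
  rewrite exchange_big /= mulr_sumr; apply: eq_bigr => f _.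
  by rewrite /far_sum mulrCA mulr_sumr.
apply: (@le_trans _ _ (K%:R ^- m * \sum_c (expR (- sigma) + expR (- (n%:R * cutoff L / 32)) *
   expR (- (n%:R / 32 * dual_sqn B (g c)))))).
  rewrite ler_wpM2l// big_mkcond /=; apply: ler_sum => c _; case: ifP => h.
    by apply: le_trans (expected_char _) _; apply: far_bound => //; exact: ft.
  by rewrite addr_ge0 ?mulr_ge0 ?expR_ge0.
rewrite big_split /= sumr_const mulrDr; apply: lerD.
  rewrite card_ffun !card_ord -[X in _ * X]mulr_natl natrX mulrA mulVf ?mul1r//.
  by rewrite expf_neq0// gt_eqF.
rewrite -mulr_sumr mulrCA ler_wpM2l ?expR_ge0//.
have uU : uniq (codom tau) by rewrite map_inj_uniq ?enum_uniq.
have := D1 _ uU; rewrite dual_massE// exprVn big_image /=.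
under eq_bigr do rewrite lgauss_term0 qformZ qform_dual.
rewrite -mulr_sumr; lra.
Qed.

(** The scale of cov_form when M M^T <= (3/2) n I. *)
Definition upper_form : R := 3 * pi ^+ 2 * n%:R / 4.

Lemma upper_form_gt0 : 0 < upper_form.
Proof. by rewrite divr_gt0// !mulr_gt0 ?exprn_gt0 ?pi_gt0// ltr0n. Qed.

(** On matrices with M M^T <= (3/2) n I the mass has a lower bound that does not
    depend on the matrix; this makes the level far_level deterministic. *)
Lemma gauss_mass_ge f : (forall v,
    n%:R / 2 * dotv v v <= dotv v (tuple_mx x f *m (tuple_mx x f)^T *m v) <= 3 * n%:R / 2 * dotv v v) ->
  dual_mass upper_form <= gauss_mass R (tuple_coord f).
Proof.
move=> H; have HM v := andP (H v).
have HM1 : forall v, n%:R / 2 * dotv v v <= dotv v (B *m map_mx intr (tuple_coord f) *m (B *m map_mx intr (tuple_coord f))^T *m v).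
  by move=> v; rewrite -tuple_mxE; have [] := HM v.
have pQ := posdef_cov n0 uB HM1.
have := lgauss_int_mono pQ (posdef_dual upper_form_gt0).
rewrite dual_massE ?upper_form_gt0//.
have -> : lgauss_int (cov_form R (tuple_coord f)) 0 = 2 * gauss_mass R (tuple_coord f).
  by rewrite /lgauss_int /qform dotv0l mul0r oppr0 expR0 /gauss_mass; ring.
rewrite ler_pM2l//; apply => u.
rewrite (qformZ upper_form) qform_dual /qform /cov_form -scalemxAl dotvZr dotv_gram.
under eq_bigr do rewrite (dotv_col_dual _ uB).
rewrite -dotv_gram -tuple_mxE; have [_] := HM (dual_pt B u).
rewrite -/(dual_sqn B u) => h.
have p2 : 0 <= pi ^+ 2 / 2 :> R by rewrite divr_ge0// sqr_ge0.
have := ler_wpM2l p2 h; rewrite /upper_form; lra.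
Qed.

Let mu : R := m%:R ^+ 2 * L ^+ 2 / n%:R.
(** One twentieth of the relative error m^2 L^2 / n, in units of the smallest possible mass;
    9/5 + 1/20 + 1/20 <= 2 leaves room for this and for the Gaussian tail. *)
Definition far_level : R := mu / 20 * dual_mass upper_form.

(** For each K, Markov's inequality gives a set of tuples whose far part is below
    far_level.  These sets range over finitely many values, so one of them
    occurs for arbitrarily large K, and local_limit applies to its members.  The
    other failure is a large deviation of M M^T. *)
Theorem finite_limit :
  expR (- (n%:R / (512 * L ^+ 2))) * Num.sqrt (2 ^+ m) <= mu / 20 ->
  exists good : {ffun 'I_n -> 'I_k} -> bool,
    \sum_(f | ~~ good f) tuple_wt p f <= 4 * m%:R * L ^+ 2 / n%:R + far_mean / far_level /\
    forall f, good f ->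
    let M := tuple_mx x f in
    (forall v, n%:R / 2 * dotv v v <= dotv v (M *m M^T *m v)) /\
    forall (l : 'cV[int]_m) (y : 'cV[R]_m),
      cov_form R (tuple_coord f) *m y =
        (2 * pi) *: (2^-1 *: (map_mx intr (tuple_coord f) *m const_mx 1) - map_mx intr l) ->
      `|sign_prob M (B *m map_mx intr l - 2^-1 *: (M *m const_mx 1)) -
        gauss_mass R (tuple_coord f) * expR (- (qform (cov_form R (tuple_coord f)) y / 4))| <=
      gauss_mass R (tuple_coord f) * (2 * mu).
Proof.
move=> HT; have nR : 0 < n%:R :> R by rewrite ltr0n.
have mR : 0 < m%:R :> R by rewrite ltr0n.
have mu0 : 0 < mu by rewrite divr_gt0// mulr_gt0// exprn_gt0.
have lev0 : 0 < far_level by rewrite mulr_gt0 ?dual_mass_gt0 ?upper_form_gt0// divr_gt0.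
have [K1 HK1] := expected_far.
have HK2 : forall K', exists tau : {ffun 'I_m -> 'I_(K1 + K').+1} -> 'cV[int]_m, good_reps B L tau /\
    \sum_f tuple_wt p f * far_sum B L (map_mx intr (tuple_coord f)) tau <= far_mean.
  move=> K'; have [|//|tau h1 h2] := HK1 (K1 + K').+1; first by rewrite -addnS leq_addr.
  by exists tau.
pose tau K' := projT1 (cid (HK2 K')).
have htau K' := projT2 (cid (HK2 K')).
pose G K' : {ffun {ffun 'I_n -> 'I_k} -> bool} :=
  [ffun f => far_sum B L (map_mx intr (tuple_coord f)) (tau K') <= far_level].
have [S HS] := frequent_value G.
exists (fun f => S f && (frob (gram_dev x f) <= (n%:R / 2) ^+ 2)); split.
  apply: (@le_trans _ _ (\sum_(f | (n%:R / 2) ^+ 2 < frob (gram_dev x f)) tuple_wt p f + \sum_(f | ~~ S f) tuple_wt p f)).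
    apply: sum_union_le => [f|f]; first exact: tuple_wt_ge0.
    by rewrite negb_and -ltNge orbC.
  apply: lerD; first exact: (prob_frob_bad p0 p1 xL xcov n0).
  have [K' _ SK] := HS 0%N.
  have [h1 h2] := htau K'.
  have f0 f : 0 <= far_sum B L (map_mx intr (tuple_coord f)) (tau K').
    by rewrite mulr_ge0 ?invr_ge0 ?exprn_ge0// sumr_ge0.
  apply: le_trans (_ : (\sum_f tuple_wt p f * far_sum B L (map_mx intr (tuple_coord f)) (tau K')) / far_level <= _).
    apply: le_trans (tuple_markov p0 lev0 f0).
    by rewrite le_eqVlt; apply/orP; left; apply/eqP; apply: eq_bigl => f; rewrite -SK ffunE ltNge.
  by rewrite ler_wpM2r// invr_ge0 ltW.
move=> f /andP[Sf Ff] M.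
have HH := frob_good Ff.
have HM1 v : n%:R / 2 * dotv v v <= dotv v (M *m M^T *m v) by have /andP[] := HH v.
split=> // l y Hy.
have gm := gauss_mass_ge HH.
have E := tuple_mxE f.
have HM2 : forall v, n%:R / 2 * dotv v v <= dotv v (B *m map_mx intr (tuple_coord f) *m (B *m map_mx intr (tuple_coord f))^T *m v).
  by move=> v; rewrite -E.
have HL2 : forall j, dotv (col j (B *m map_mx intr (tuple_coord f))) (col j (B *m map_mx intr (tuple_coord f))) <= L ^+ 2.
  move=> j; rewrite -E; have -> : col j (tuple_mx x f) = x (f j) by apply/matrixP => a b; rewrite ord1 !mxE.
  exact: xL.
have HK3 : forall K0 : nat, exists K : nat, [/\ (K0 <= K)%N, (0 < K)%N &
     exists2 tau : {ffun 'I_m -> 'I_K} -> 'cV[int]_m, good_reps B L tau &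
       far_sum B L (map_mx intr (tuple_coord f)) tau <= far_level].
  move=> K0; have [K' hK SK] := HS K0.
  exists (K1 + K').+1; split=> //; first by apply: leq_trans hK _; rewrite -addSn leq_addl.
  exists (tau K'); first by have [] := htau K'.
  by move: Sf; rewrite -SK ffunE.
have := local_limit m0 n0 uB L0 HM2 HL2 Hy HK3.
rewrite -E -/M => h; apply: le_trans h _.
set gmf := gauss_mass R (tuple_coord f) in gm *.
have gm0 : 0 <= gmf by apply: le_trans gm; rewrite ltW// dual_mass_gt0// upper_form_gt0.
have l1 : far_level <= gmf * (mu / 20) by rewrite /far_level mulrC ler_wpM2r// divr_ge0// ltW.
have l2 := ler_wpM2l gm0 HT.
rewrite -/mu; lra.
Qed.

End Far.

(** * Bases of lattices and of their duals *)

Section Lattice.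
Variable R : realType.

Lemma latticeD m (Lat : set 'cV[R]_m) x y : is_lattice Lat -> Lat x -> Lat y -> Lat (x + y).
Proof.
move=> [L0 Lsub _] hx hy; rewrite -[y]opprK; apply: (Lsub) => //.
by rewrite -[- y]add0r; exact: Lsub.
Qed.

Lemma latticeN m (Lat : set 'cV[R]_m) x : is_lattice Lat -> Lat x -> Lat (- x).
Proof. by move=> [L0 Lsub _] hx; rewrite -[- x]add0r; exact: Lsub. Qed.

Lemma latticeMn m (Lat : set 'cV[R]_m) x k : is_lattice Lat -> Lat x -> Lat (x *+ k).
Proof.
move=> hL hx; elim: k => [|k IH]; first by rewrite mulr0n; case: hL.
by rewrite mulrS; exact: latticeD.
Qed.

Lemma latticeMz m (Lat : set 'cV[R]_m) x (k : int) : is_lattice Lat -> Lat x -> Lat (x *~ k).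
Proof.
move=> hL hx; case: k => k; first exact: latticeMn.
by rewrite NegzE mulrNz; apply: latticeN => //; exact: latticeMn.
Qed.

Lemma lattice_sum m (Lat : set 'cV[R]_m) (I : finType) (F : I -> 'cV[R]_m) :
  is_lattice Lat -> (forall i, Lat (F i)) -> Lat (\sum_i F i).
Proof.
move=> hL hF; apply: (big_ind Lat) => //; first by case: hL.
by move=> x y; exact: latticeD.
Qed.

Lemma mulmx_intr_sum m k (V : 'M[R]_(m, k)) (a : 'cV[int]_k) :
  V *m map_mx intr a = \sum_i col i V *~ a i 0.
Proof.
apply/matrixP => i j; rewrite ord1 mxE summxE; apply: eq_bigr => l _.
by rewrite -scaler_int !mxE mulrC.
Qed.

Lemma lattice_mulmx m k (Lat : set 'cV[R]_m) (V : 'M[R]_(m, k)) (a : 'cV[int]_k) :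
  is_lattice Lat -> (forall i, Lat (col i V)) -> Lat (V *m map_mx intr a).
Proof.
move=> hL hV; rewrite mulmx_intr_sum; apply: lattice_sum => // i.
exact: latticeMz.
Qed.

(** Isolation of the origin, translated by differences, is uniform over the lattice. *)
Lemma lattice_gap m (Lat : set 'cV[R]_m) : is_lattice Lat ->
  exists2 e : R, 0 < e & forall x y, Lat x -> Lat y -> (forall i, `|x i 0 - y i 0| < e) -> x = y.
Proof.
move=> [L0 Lsub Liso]; have [_ [V /nbhs_ballP[e e0 eV] VL]] := Liso 0 L0.
exists e => // x y hx hy h.
have : (V `&` Lat) (x - y).
  split; last exact: Lsub.
  apply: eV; split=> // i j; rewrite ord1 /ball /= !mxE sub0r normrN; exact: h.
by rewrite VL => /= /eqP; rewrite subr_eq0 => /eqP.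
Qed.

(** Points are separated by the integer cells of side e that contain them, which gives
    countability of the lattice and finiteness of its bounded parts. *)
Lemma lattice_quantize m (Lat : set 'cV[R]_m) : is_lattice Lat ->
  exists2 e : R, 0 < e & forall x y, Lat x -> Lat y ->
    (forall i, Num.floor (x i 0 / e) = Num.floor (y i 0 / e)) -> x = y.
Proof.
move=> /lattice_gap[e e0 H]; exists e => // x y hx hy h; apply: H => // i.
have /andP[x1 x2] := floor_itv (x i 0 / e); have /andP[y1 y2] := floor_itv (y i 0 / e).
move: x1 x2; rewrite (h i) => x1 x2; rewrite intrD in x2 y2.
have : `|x i 0 / e - y i 0 / e| < 1 by rewrite ltr_norml; apply/andP; split; lra.
by rewrite -mulrBl normrM [`|e^-1|]gtr0_norm ?invr_gt0// ltr_pdivrMr// mul1r.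
Qed.

Lemma lattice_countable m (Lat : set 'cV[R]_m) : is_lattice Lat -> countable Lat.
Proof.
move=> /lattice_quantize[e e0 H]; apply/countable_injP.
exists (fun x : 'cV[R]_m => pickle [ffun i => Num.floor (x i 0 / e)]).
move=> x y /set_mem hx /set_mem hy /(pcan_inj pickleK) /ffunP E.
by apply: H => // i; have := E i; rewrite !ffunE.
Qed.

Lemma lattice_bounded_finite m (Lat : set 'cV[R]_m) (b : R) : is_lattice Lat ->
  finite_set (Lat `&` [set x | forall i, `|x i 0| <= b]).
Proof.
move=> /lattice_quantize[e e0 H]; set A := _ `&` _.
have [N hN] : exists N : nat, `|b / e| + 1 < N%:R.
  by exists (Num.truncn (`|b / e| + 1)).+1; exact: truncnS_gt.
pose key (x : 'cV[R]_m) : {ffun 'I_m -> 'I_(N + N).+1} :=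
  [ffun i => inord `|(Num.floor (x i 0 / e) + N%:Z)%R|].
have kinj x y : A x -> A y -> key x = key y -> x = y.
  have fl w i : A w -> 0 <= Num.floor (w i 0 / e) + N%:Z <= (N + N)%:Z.
    move=> [_ /(_ i)] hw; have /andP[w1 w2] := floor_itv (w i 0 / e).
    have : `|w i 0 / e| <= `|b / e|.
      rewrite !normrM ler_wpM2r//; apply: le_trans hw (ler_norm _).
    rewrite ler_norml intrD in w2 * => /andP[h1 h2].
    have a1 : (- N%:Z)%:~R <= (Num.floor (w i 0 / e))%:~R :> R.
      by rewrite mulrNz -[(N%:Z)%:~R]/(N%:R); lra.
    have a2 : (Num.floor (w i 0 / e))%:~R <= (N%:Z)%:~R :> R.
      by rewrite -[(N%:Z)%:~R]/(N%:R); lra.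
    by move: a1 a2; rewrite !ler_int; lia.
  move=> hx hy /ffunP E; apply: H => [||i]; [by case: hx|by case: hy|].
  have := E i; rewrite !ffunE => /(congr1 val); rewrite /= !inordK.
  - by have := fl x i hx; have := fl y i hy; lia.
  - by have := fl y i hy; lia.
  - by have := fl x i hx; lia.
pose g F := xget 0 [set x | A x /\ key x = F].
apply: (@sub_finite_set _ _ (g @` [set: {ffun 'I_m -> 'I_(N + N).+1}])); last first.
  by apply: finite_image; exact: finite_finset.
move=> x Ax; exists (key x) => //; rewrite /g.
by case: xgetP => [y _ [Ay /kinj ->]//|/(_ x)[]].
Qed.

(** Reduce the multiples of x modulo the sublattice spanned by V into a
    bounded region: finitely many lattice points, so two multiples coincide. *)
Lemma lattice_multiple m (Lat : set 'cV[R]_m) (V : 'M[R]_m) x :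
  is_lattice Lat -> V \in unitmx -> (forall i, Lat (col i V)) -> Lat x ->
  exists2 N : nat, (0 < N)%N & exists q : 'cV[int]_m, x *+ N = V *m map_mx intr q.
Proof.
move=> hL uV hV hx.
pose b : R := \sum_a \sum_c `|V a c|.
pose q (j : nat) : 'cV[int]_m := \col_i Num.floor ((invmx V *m (x *+ j)) i 0).
pose y j := x *+ j - V *m map_mx intr (q j).
have hy j : (Lat `&` [set x | forall i, `|x i 0| <= b]) (y j).
  split=> [|i].
    by have [_ Lsub _] := hL; apply: Lsub; [exact: latticeMn|exact: lattice_mulmx].
  have -> : y j = V *m (invmx V *m (x *+ j) - map_mx intr (q j)) by rewrite mulmxBr mulKVmx.
  rewrite /q; set u := invmx V *m (x *+ j).
  rewrite mxE; apply: le_trans (ler_norm_sum _ _ _) _.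
  apply: (@le_trans _ _ (\sum_c `|V i c|)).
    apply: ler_sum => c _; rewrite normrM ler_piMr//.
    have -> : (u - map_mx intr (\col_i Num.floor (u i 0))) c 0 = u c 0 - (Num.floor (u c 0))%:~R.
      by rewrite !mxE.
    have /andP[w1 w2] := floor_itv (u c 0).
    by rewrite intrD in w2; rewrite ler_norml; apply/andP; split; lra.
  rewrite /b [leRHS](bigD1 i)//= lerDl; apply: sumr_ge0 => a _; exact: sumr_ge0.
have /finite_seqP[s hs] := lattice_bounded_finite b hL.
have ys j : y j \in s by have := hy j; rewrite hs.
pose F j : 'I_(size s) := Ordinal (eq_ind_r is_true (ys j) (index_mem (y j) s)).
have [v hvF] := frequent_value F.
have [j1 _ h1] := hvF 0%N; have [j2 j12 h2] := hvF j1.+1.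
have E : y j1 = y j2.
  have : index (y j1) s = index (y j2) s by have := congr1 val (etrans h1 (esym h2)).
  by move=> e; rewrite -(nth_index 0 (ys j1)) e nth_index.
exists (j2 - j1)%N; first by rewrite subn_gt0.
exists (q j2 - q j1); rewrite map_mxB mulmxBr mulrnBr ?(ltnW j12)//.
have /matrixP E' := E; apply/matrixP => a c; have := E' a c; rewrite /y !mxE; lra.
Qed.

Lemma det_replace_col m (c : 'cV[R]_m) (i : 'I_m) :
  \det (\matrix_(a, b) (if b == i then c a 0 else (a == b)%:R)) = c i 0.
Proof.
set P := \matrix_(_, _) _.
rewrite (expand_det_row P i) (bigD1 i)//= big1 ?addr0; last first.
  by move=> b bi; rewrite mxE (negPf bi) eq_sym (negPf bi) mul0r.
rewrite mxE eqxx /cofactor; have -> : row' i (col' i P) = 1%:M.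
  apply/matrixP => a b; rewrite !mxE eq_sym (negPf (neq_lift _ _)).
  by rewrite (inj_eq lift_inj).
by rewrite det1 mulr1 -signr_odd addnn odd_double mulr1.
Qed.

Lemma zspan_cols m (W : 'M[R]_m) y : zspan [set col j W | j in [set: 'I_m]] y <->
  exists a : 'cV[int]_m, y = W *m map_mx intr a.
Proof.
split=> [[k [v [a [hv ->]]]]|[a ->]].
  have /choice[j hj] : forall i, exists j, col j W = v i.
    by move=> i; have [j _ <-] := hv i; exists j.
  exists (\sum_i (delta_mx (j i) 0) *~ a i).
  rewrite raddf_sum /= mulmx_sumr; apply: eq_bigr => i _.
  have -> : map_mx intr (delta_mx (j i) 0 *~ a i) = (a i)%:~R *: delta_mx (j i) 0 :> 'cV[R]_m.
    by apply/matrixP => b d; rewrite -scaler_int intz !mxE /= intrM; congr (_ * _); case: (_ && _).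
  by rewrite -scalemxAr -colE hj scaler_int.
exists m, (fun i => col i W), (fun i => a i 0); split; last exact: mulmx_intr_sum.
by move=> i; exists i.
Qed.

(** By lattice_multiple the lattice lies in V Z^m / N for a common N, so
    determinants of its m-tuples, relative to V, are multiples of N^-m and a
    nonzero one of least modulus exists.  Its tuple W is a basis: a lattice
    point with a fractional coordinate f in W could replace a column and
    multiply the determinant by f < 1. *)
Lemma lattice_basis_exists m (Lat : set 'cV[R]_m) (k : nat) (x : 'I_k -> 'cV[R]_m) :
  is_lattice Lat -> (forall i, Lat (x i)) -> Lat = zspan [set x i | i in [set: 'I_k]] ->
  (forall u : 'cV[R]_m, (forall i, dotv u (x i) = 0) -> u = 0) ->
  exists B, lattice_basis Lat B.
Proof.
move=> hL hx Lspan xspan.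
pose X0 : 'M[R]_(k, m) := \matrix_(i, a) x i a 0.
(* The generators span R^m, so some m of them form an invertible matrix V. *)
have fX : row_full X0.
  rewrite -cokermx_eq0; apply/eqP/matrixP => a b.
  suff /matrixP/(_ a 0) : col b (cokermx X0) = 0 by rewrite !mxE.
  apply: xspan => i; have /matrixP/(_ i b) := mulmx_coker X0.
  rewrite !mxE dotvC dotvE => E; rewrite -[RHS]E.
  by apply: eq_bigr => c _; rewrite !mxE.
have [V uV hV] : exists2 V : 'M[R]_m, V \in unitmx & forall i, Lat (col i V).
  pose f := fullrankfun fX.
  exists (rowsub f X0)^T; first by rewrite unitmx_tr fullrowsub_unit.
  by move=> i; have -> : col i (rowsub f X0)^T = x (f i) by apply/matrixP => a b; rewrite ord1 !mxE.
have /choice[Nx hNx] : forall i, exists N : nat, (0 < N)%N /\ exists q : 'cV[int]_m, x i *+ N = V *m map_mx intr q.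
  by move=> i; have [N N0 [q hq]] := lattice_multiple hL uV hV (hx i); exists N; split=> //; exists q.
pose N := (\prod_i Nx i)%N.
have N0 : (0 < N)%N by apply: prodn_gt0 => i; have [] := hNx i.
have HN y : Lat y -> exists q : 'cV[int]_m, y *+ N = V *m map_mx intr q.
  rewrite Lspan => -[l [v [a [hv ->]]]].
  have /choice[q hq] : forall i, exists q : 'cV[int]_m, v i *+ N = V *m map_mx intr q.
    move=> i; have [j _ <-] := hv i; have [_ [q hq]] := hNx j.
    exists (q *+ \prod_(i | i != j) Nx i)%N.
    rewrite /N (bigD1 j)//= mulrnA hq -[LHS](raddfMn (mulmx V)); congr (_ *m _).
    by rewrite raddfMn.
  exists (\sum_i q i *~ a i); rewrite -sumrMnl raddf_sum /= mulmx_sumr; apply: eq_bigr => i _.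
  rewrite [in RHS]raddfMz /= [RHS]raddfMz /= -hq.
  by rewrite !pmulrn mulrzAC.
(* The relative determinant, scaled to be a natural number on lattice tuples. *)
pose vol (W : 'M[R]_m) : R := `|\det (invmx V *m W)| * N%:R ^+ m.
have vol_nat W : (forall i, Lat (col i W)) -> exists d : nat, vol W = d%:R.
  move=> hW; have /choice[q hq] : forall i, exists q : 'cV[int]_m, col i W *+ N = V *m map_mx intr q.
    by move=> i; exact: HN.
  pose Z : 'M[int]_m := \matrix_(a, i) q i a 0.
  have E : N%:R *: (invmx V *m W) = map_mx intr Z :> 'M[R]_m.
    rewrite scalemxAr; apply: (canLR (mulKmx uV)); apply/matrixP => a i.
    have /matrixP/(_ a 0) := hq i; rewrite -scaler_nat !mxE => ->.
    by apply: eq_bigr => b _; rewrite !mxE.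
  exists `|\det Z|%N; rewrite /vol -[N%:R ^+ m]ger0_norm ?exprn_ge0// -normrM mulrC -detZ E det_map_mx.
  by rewrite -intr_norm; case: (\det Z).
pose Pd (d : nat) : bool := `[< exists W, [/\ forall i, Lat (col i W), (0 < d)%N & vol W = d%:R] >].
have exP : exists d, Pd d.
  exists (N ^ m)%N; apply/asboolP; exists V; split=> //; first by rewrite expn_gt0 N0.
  by rewrite /vol mulVmx// det1 normr1 mul1r natrX.
case: (ex_minnP exP) => d /asboolP[W [hW d0 vW]] dmin.
have NR : 0 < N%:R ^+ m :> R by rewrite exprn_gt0// ltr0n.
have uW : W \in unitmx.
  rewrite unitmxE unitfE; apply/eqP => dW.
  by move: vW; rewrite /vol det_mulmx dW mulr0 normr0 mul0r => /eqP; rewrite eq_sym pnatr_eq0 -leqn0 leqNgt d0.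
exists W; split=> //; apply/seteqP; split=> [y hy|y /zspan_cols[a ->]]; last exact: lattice_mulmx.
apply/zspan_cols; have [c yc] : exists c, y = W *m c by exists (invmx W *m y); rewrite mulKVmx.
pose fl : 'cV[int]_m := \col_i Num.floor (c i 0).
exists fl.
rewrite {1}yc; congr (_ *m _); apply/matrixP => i j; rewrite ord1 !mxE; apply/eqP; apply: contraT => ci.
pose c' := c - map_mx intr fl.
have c'i : c' i 0 = c i 0 - (Num.floor (c i 0))%:~R by rewrite !mxE.
have /andP[f1 f2] := floor_itv (c i 0).
have c'0 : 0 < c' i 0 by rewrite c'i subr_gt0 lt_neqAle eq_sym ci.
have c'1 : c' i 0 < 1 by rewrite c'i; rewrite intrD in f2; lra.
(* Column i of W replaced by the remainder of y, whose i-th coordinate is fractional. *)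
pose W' := W *m \matrix_(a, b) (if b == i then c' a 0 else (a == b)%:R).
have hW' b : Lat (col b W').
  have [->|bi] := eqVneq b i.
    have -> : col i W' = y - W *m map_mx intr fl.
      rewrite {1}yc -mulmxBr -/c' /W' colE -mulmxA -colE; congr (_ *m _).
      by apply/matrixP => e g; rewrite ord1 !mxE eqxx.
    have [_ Ls _] := hL; apply: Ls => //; exact: lattice_mulmx.
  have -> : col b W' = col b W; last exact: hW.
  rewrite /W' colE -mulmxA -colE [RHS]colE; congr (_ *m _).
  by apply/matrixP => e g; rewrite ord1 !mxE (negPf bi) eqxx andbT.
have [d' vd'] := vol_nat W' hW'.
have dd : d'%:R = d%:R * c' i 0.
  by rewrite -vd' -vW /vol /W' mulmxA det_mulmx det_replace_col normrM (gtr0_norm c'0); ring.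
have dR : 0 < d%:R :> R by rewrite ltr0n.
have d'0 : (0 < d')%N by rewrite -(ltr0n R) dd mulr_gt0.
have := dmin d'; have -> : Pd d' by apply/asboolP; exists W'.
move=> /(_ isT); rewrite leqNgt -(ltr_nat R) dd => /negP[]; rewrite gtr_pMr//.
Qed.

Lemma dual_lattice_basis m (Lat : set 'cV[R]_m) (B : 'M[R]_m) (th : 'cV[R]_m) :
  lattice_basis Lat B ->
  dual_lattice Lat th <-> exists q : 'cV[int]_m, th = dual_pt B (map_mx intr q).
Proof.
move=> [uB LB]; have uB' : B^T \in unitmx by rewrite unitmx_tr.
split=> [h|[q ->] y].
  have hc j : dotv th (col j B) \is a Num.int.
    apply: h; rewrite LB; apply/zspan_cols; exists (delta_mx j 0).
    rewrite colE; congr (_ *m _); apply/matrixP => a b; rewrite !mxE; by case: (_ && _).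
  exists (\col_j Num.floor (dotv th (col j B))).
  rewrite -[LHS](mulKmx uB') /dual_pt; congr (_ *m _); apply/matrixP => j b; rewrite ord1 !mxE.
  have := floorK (hc j); rewrite dotvC dotvE => ->.
  by apply: eq_bigr => a _; rewrite !mxE.
rewrite LB => /zspan_cols[a ->]; rewrite -dotv_dual_pt//.
by have [r ->] := dotv_intr R q a; rewrite intr_int.
Qed.

End Lattice.

(** * Random vectors with countably many values *)

Section DualDist.
Variables (R : realType) (m : nat) (Lat : set 'cV[R]_m) (B : 'M[R]_m).
Hypothesis LB : lattice_basis Lat B.

Definition dual_dist (t : 'cV[R]_m) : R := eucl_dist (dual_pt B t) (dual_lattice Lat).

Lemma eucl_norm_dual t : eucl_norm (dual_pt B t) = Num.sqrt (dual_sqn B t).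
Proof. by []. Qed.

Lemma dual_dist_set t : [set eucl_norm (dual_pt B t - a) | a in dual_lattice Lat] =
  [set Num.sqrt (dual_sqn B (t + map_mx intr q)) | q in [set: 'cV[int]_m]].
Proof.
apply/seteqP; split=> [r [a /(dual_lattice_basis _ LB)[q ->] <-]|r [q _ <-]].
  exists (- q) => //; rewrite -eucl_norm_dual; congr eucl_norm.
  by rewrite map_mxN /dual_pt mulmxDr mulmxN.
exists (dual_pt B (map_mx intr (- q))).
  by apply/(dual_lattice_basis _ LB); exists (- q).
by rewrite -eucl_norm_dual; congr eucl_norm; rewrite map_mxN /dual_pt mulmxDr mulmxN opprK.
Qed.

(** This and the next lemma are the two properties of the distance to the dual
    lattice on which the choice of representatives rests. *)
Lemma dual_dist_le t (q : 'cV[int]_m) : dual_dist t <= Num.sqrt (dual_sqn B (t + map_mx intr q)).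
Proof.
rewrite /dual_dist /eucl_dist dual_dist_set; apply: ge_inf; last by exists q.
by exists 0 => _ [r _ <-]; exact: sqrtr_ge0.
Qed.

Lemma dual_dist_lt t e : 0 < e ->
  exists q : 'cV[int]_m, Num.sqrt (dual_sqn B (t + map_mx intr q)) < dual_dist t + e.
Proof.
move=> e0; rewrite /dual_dist /eucl_dist dual_dist_set.
set A := [set _ | _ in _]; have hA : has_inf A.
  split; first by exists (Num.sqrt (dual_sqn B (t + map_mx intr 0))); exists 0.
  by exists 0 => _ [r _ <-]; exact: sqrtr_ge0.
by have [_ [q _ <-] hq] := inf_adherent e0 hA; exists q.
Qed.

End DualDist.

Section DiscreteLaw.
Variables (R : realType) (m : nat) (d : measure_display) (T : measurableType d).
Variables (P : probability T R) (X : T -> 'cV[R]_m).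
Hypothesis hX : random_vector X.

Lemma measurable_point (y : 'cV[R]_m) : measurable ([set y] : set (borel_cV R m)).
Proof.
rewrite -[[set y]]setCK; apply: measurableC; apply: sub_sigma_algebra.
rewrite /= openE => z zy.
have [i zi] : exists i, z i 0 != y i 0.
  apply: contrapT => h; apply: zy; apply/matrixP => i j; rewrite ord1.
  by apply/eqP; apply: contraT => hi; exfalso; apply: h; exists i.
apply/nbhs_ballP; exists `|z i 0 - y i 0|; first by rewrite /= normr_gt0 subr_eq0.
move=> w [_ /(_ i 0)]; rewrite /ball /= => hw E.
by move: hw; rewrite E ltxx.
Qed.

Lemma measurable_preimage1 (y : 'cV[R]_m) : measurable (X @^-1` [set y]).
Proof. by rewrite -[_ @^-1` _]setTI; apply: hX => //; exact: measurable_point. Qed.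

Variable Lat : set 'cV[R]_m.
Hypothesis cLat : countable Lat.
Hypothesis XLat : forall w, Lat (X w).

(** Values in a countable set make every preimage a countable union of preimages of points. *)
Lemma measurable_preimage_any (A : set 'cV[R]_m) : measurable (X @^-1` A).
Proof.
have /countable_injP[f finj] := cLat.
have -> : X @^-1` A = \bigcup_n (X @^-1` (A `&` Lat `&` [set y | f y = n])).
  apply/seteqP; split=> [w Aw|w [n _ [[]]]//].
  by exists (f (X w)).
apply: bigcupT_measurable => n.
have [[y [[Ay Ly] fy]]|h] := pselect (exists y, (A `&` Lat `&` [set y | f y = n]) y).
  have -> : A `&` Lat `&` [set y | f y = n] = [set y]; last exact: measurable_preimage1.
  apply/seteqP; split=> [z [[Az Lz] fz]|z ->] //=.
  by apply: finj; rewrite ?inE// fz fy.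
have -> : A `&` Lat `&` [set y | f y = n] = set0; last by rewrite preimage_set0.
by apply/seteqP; split=> // z hz; apply: h; exists z.
Qed.

(** The values that are not atoms form a countable union of null events. *)
Lemma prob_outside_supp : P (X @^-1` (~` rv_supp P X)) = 0%E.
Proof.
have /countable_injP[f finj] := cLat.
have -> : X @^-1` (~` rv_supp P X) =
    \bigcup_n (X @^-1` (~` rv_supp P X `&` Lat `&` [set y | f y = n])).
  apply/seteqP; split=> [w Aw|w [n _ [[]]]//].
  by exists (f (X w)).
have Nn : P.-negligible (\bigcup_n (X @^-1` (~` rv_supp P X `&` Lat `&` [set y | f y = n]))).
  apply: negligible_bigcup => n.
  exists (X @^-1` (~` rv_supp P X `&` Lat `&` [set y | f y = n])); split=> //.
    exact: measurable_preimage_any.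
  have [[y [[Ay Ly] fy]]|h] := pselect (exists y, (~` rv_supp P X `&` Lat `&` [set y | f y = n]) y).
    have -> : ~` rv_supp P X `&` Lat `&` [set y | f y = n] = [set y].
      apply/seteqP; split=> [z [[Az Lz] fz]|z ->] //=.
      by apply: finj; rewrite ?inE// fz fy.
    by apply/eqP; rewrite eq_le measure_ge0 andbT leNgt; apply/negP => h; exact: Ay.
  have -> : ~` rv_supp P X `&` Lat `&` [set y | f y = n] = set0; last by rewrite preimage_set0 measure0.
  by apply/seteqP; split=> // z hz; apply: h; exists z.
have [A [mA A0 sA]] := Nn.
apply/eqP; rewrite eq_le measure_ge0 andbT -A0; apply: le_measure => //; rewrite inE//.
apply: bigcupT_measurable => n; exact: measurable_preimage_any.
Qed.

Variables (k : nat) (x : 'I_k -> 'cV[R]_m).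
Hypothesis xinj : injective x.
Hypothesis xsupp : rv_supp P X = [set x i | i in [set: 'I_k]].

Definition atom_wt i : R := fine (P (X @^-1` [set x i])).

Lemma atom_wtE i : P (X @^-1` [set x i]) = (atom_wt i)%:E.
Proof. by rewrite /atom_wt fineK// fin_num_measure//; exact: measurable_preimage1. Qed.

Lemma atom_wt_ge0 i : 0 <= atom_wt i. Proof. exact: fine_ge0. Qed.

(** Almost surely h (X) is the finite sum of its values times the indicators
    of the atoms. *)
Lemma expectation_atoms (h : 'cV[R]_m -> R) :
  fine ('E_P[(fun w => h (X w))])%E = \sum_i atom_wt i * h (x i).
Proof.
rewrite unlock.
have mA (A : set 'cV[R]_m) := measurable_preimage_any A.
have mh : measurable_fun setT (fun w => (h (X w))%:E).
  move=> _ Y mY; rewrite setTI.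
  have -> : (fun w => (h (X w))%:E) @^-1` Y = X @^-1` [set y | Y (h y)%:E] by [].
  exact: mA.
pose F i w : \bar R := (h (x i) * \1_(X @^-1` [set x i]) w)%:E.
have iI i : P.-integrable setT (EFin \o \1_(X @^-1` [set x i])).
  by apply: integrable_indic => //; rewrite ltry_fin.
have iF i : P.-integrable setT (F i).
  by have := integrableZl measurableT (h (x i)) (iI i).
have -> : (\int[P]_w (h (X w))%:E = \int[P]_w (\sum_(i < k) F i w))%E.
  apply: ae_eq_integral => //.
    by apply: emeasurable_sum => i; have /integrableP[] := iF i.
  exists (X @^-1` (~` rv_supp P X)); split; first exact: mA.
    exact: prob_outside_supp.
  move=> w /= hw sw; apply: hw => _; move: sw; rewrite xsupp => -[i _ E].
  rewrite (bigD1 i)//= big1 ?adde0.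
    by rewrite /F indicE mem_set//= mulr1 E.
  move=> j ji; rewrite /F indicE memNset ?mulr0//= => Ej.
  by case/eqP: ji; apply: xinj; rewrite E Ej.
rewrite integral_sum//.
have -> : (\sum_(i < k) \int[P]_w F i w = \sum_(i < k) (atom_wt i * h (x i))%:E)%E.
  apply: eq_bigr => i _; rewrite /F.
  under eq_integral do rewrite EFinM.
  rewrite (integralZl _ (iI i))//.
  have -> : (\int[P]_w (EFin \o \1_(X @^-1` [set x i])) w = P (X @^-1` [set x i]))%E.
    by rewrite integral_indic// setIT.
  by rewrite atom_wtE -EFinM mulrC.
by rewrite sumEFin.
Qed.

Lemma atom_wt_sum : \sum_i atom_wt i = 1.
Proof.
have := expectation_atoms (fun=> 1); rewrite unlock integral_cst// mul1e.
have -> : fine (P setT) = 1 by rewrite (probability_setT P).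
by move=> ->; apply: eq_bigr => i _; rewrite mulr1.
Qed.

End DiscreteLaw.

(** * Laws with bounded support on a lattice *)

Lemma finite_set_enum (T : eqType) (A : set T) : finite_set A ->
  exists (k : nat) (x : 'I_k -> T), injective x /\ A = [set x i | i in [set: 'I_k]].
Proof.
move=> /finite_seqP[s As]; exists (size (undup s)), (tnth (in_tuple (undup s))); split.
  by apply/tuple_uniqP; exact: undup_uniq.
rewrite As; apply/seteqP; split=> [y /=|y [i _ <-]].
  rewrite -mem_undup => ys; have /tnthP[i ->] : y \in in_tuple (undup s) by [].
  by exists i.
by rewrite /= -mem_undup; apply: (mem_tnth i (in_tuple (undup s))).
Qed.

Section FiniteLaw.
Variables (R : realType) (m : nat) (Lat : set 'cV[R]_m) (L : R).
Variables (d : measure_display) (T : measurableType d) (P : probability T R) (X : T -> 'cV[R]_m).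
Hypothesis hm : (0 < m)%N.
Hypothesis hLat : is_lattice Lat.
Hypothesis hX : random_vector X.
Hypothesis hXLat : forall w, Lat (X w).
Hypothesis hcov : second_moment P X = 1%:M.
Hypothesis hsupp : rv_supp P X `<=` eucl_ball L.
Hypothesis hspan : Lat = zspan (rv_supp P X).

Lemma supp_sub_lattice : rv_supp P X `<=` Lat.
Proof.
move=> y; rewrite /rv_supp /= => y0.
have [w Xw] : (X @^-1` [set y]) !=set0.
  by apply/set0P; apply: contraTneq y0 => ->; rewrite measure0 ltxx.
by rewrite -Xw; exact: hXLat.
Qed.

(** A bounded part of a lattice is finite. *)
Lemma supp_finite : finite_set (rv_supp P X).
Proof.
apply: sub_finite_set (lattice_bounded_finite (L) hLat) => y yS; split.
  exact: supp_sub_lattice.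
move=> i /=; apply: le_trans (hsupp yS); rewrite /eucl_norm -sqrtr_sqr ler_sqrt ?dotv_ge0//.
by rewrite dotvE (bigD1 i)//= -expr2 lerDl sumr_ge0// => j _; rewrite -expr2 sqr_ge0.
Qed.

Variables (k : nat) (x : 'I_k -> 'cV[R]_m).
Hypothesis xinj : injective x.
Hypothesis xsupp : rv_supp P X = [set x i | i in [set: 'I_k]].
Let p := atom_wt P X x.
Let cLat := lattice_countable hLat.

Lemma x_supp i : rv_supp P X (x i).
Proof. by rewrite xsupp; exists i. Qed.

Lemma atoms_sum1 : \sum_i p i = 1.
Proof. exact: (atom_wt_sum hX cLat hXLat xinj xsupp). Qed.

Lemma atoms_cov a b : \sum_i p i * (x i a 0 * x i b 0) = (a == b)%:R.
Proof.
have := congr1 (fun A : 'M[R]_m => A a b) hcov; rewrite !mxE => <-.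
rewrite (expectation_atoms hX cLat hXLat xinj xsupp (fun y => (y *m y^T) a b)).
by apply: eq_bigr => i _; rewrite !mxE big_ord1 !mxE.
Qed.

Lemma atoms_norm2 : \sum_i p i * dotv (x i) (x i) = m%:R.
Proof.
transitivity (\sum_(a < m) \sum_i p i * (x i a 0 * x i a 0)).
 by rewrite [RHS]exchange_big /=; apply: eq_bigr => i _; rewrite dotvE mulr_sumr.
under eq_bigr do rewrite atoms_cov eqxx.
by rewrite sumr_const card_ord.
Qed.

Lemma atoms_in_ball i : dotv (x i) (x i) <= L ^+ 2.
Proof.
have h := hsupp (x_supp i); rewrite /eucl_ball /= /eucl_norm in h.
by rewrite -[X in X <= _]sqr_sqrtr ?dotv_ge0// lerXn2r ?nnegrE ?sqrtr_ge0// (le_trans (sqrtr_ge0 _) h).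
Qed.

(** The trace of the covariance is E |X|^2, at most L^2. *)
Lemma dim_le_sqr_radius : m%:R <= L ^+ 2.
Proof.
rewrite -atoms_norm2 -[L ^+ 2]mul1r -atoms_sum1 mulr_suml; apply: ler_sum => i _.
by rewrite ler_wpM2l ?atom_wt_ge0// atoms_in_ball.
Qed.

Lemma radius_ge1 : 1 <= L.
Proof.
have L2 : 1 <= L ^+ 2 by apply: le_trans dim_le_sqr_radius; rewrite ler1n.
have [i _] : exists i : 'I_k, True.
  apply: contrapT => h; have := atoms_sum1; rewrite big1 => [/eqP|i _]; first by rewrite eq_sym oner_eq0.
  by exfalso; apply: h; exists i.
have L0 : 0 <= L.
  by apply: le_trans (hsupp (x_supp i)); rewrite /eucl_norm sqrtr_ge0.
by rewrite -(@ler_pXn2r _ 2)// ?nnegrE// expr1n.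
Qed.

(** By isotropy E <u, X>^2 is the squared length of u. *)
Lemma atoms_separate (u : 'cV[R]_m) : (forall i, dotv u (x i) = 0) -> u = 0.
Proof.
move=> h; apply/eqP; apply: contraT => u0; have := dotv_gt0 u0.
by rewrite -(cov_quad atoms_cov) big1 ?ltxx// => i _; rewrite h expr0n mulr0.
Qed.

Lemma lattice_has_basis : exists B, lattice_basis Lat B.
Proof.
apply: (@lattice_basis_exists R m Lat k x) => //; last exact: atoms_separate.
- by move=> i; apply: supp_sub_lattice; exact: x_supp.
- by rewrite -xsupp.
Qed.

End FiniteLaw.

(** * From tuples of atoms to random columns, from the form of M to the lattice Gaussian *)

Section ColumnLaw.
Variables (R : realType) (m n : nat) (d : measure_display) (T : measurableType d).
Variables (P : probability T R) (X : T -> 'cV[R]_m).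
Variables (d' : measure_display) (T' : measurableType d') (Q : probability T' R).
Variable M : T' -> 'M[R]_(m, n).
Hypothesis hX : random_vector X.
Hypothesis hM : iid_columns P X Q M.
Variables (k : nat) (x : 'I_k -> 'cV[R]_m).
Hypothesis xinj : injective x.

Definition tuple_event (f : {ffun 'I_n -> 'I_k}) : set T' :=
  [set w | forall j, [set x (f j)] (col j (M w))].

Lemma tuple_event_measurable f : measurable (tuple_event f).
Proof.
have -> : tuple_event f = \bigcap_(j in [set: 'I_n]) ((fun w => col j (M w)) @^-1` [set x (f j)]).
  by apply/seteqP; split=> w h j; [move=> _|]; exact: h.
apply: fin_bigcap_measurable => // j _.
by have [h _ _] := hM; exact: (measurable_preimage1 (h j)).
Qed.

Lemma tuple_event_prob f : Q (tuple_event f) = (tuple_wt (atom_wt P X x) f)%:E.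
Proof.
have [_ h1 h2] := hM.
rewrite /tuple_event (h2 (fun j => [set x (f j)])); last by move=> j; exact: measurable_point.
rewrite /tuple_wt -prodEFin; apply: eq_bigr => j _.
by rewrite (h1 j [set x (f j)])//; [exact: atom_wtE|exact: measurable_point].
Qed.

Lemma tuple_event_mx f w : tuple_event f w -> M w = tuple_mx x f.
Proof.
move=> h; apply/matrixP => a j; have := h j; rewrite /= => /(congr1 (fun v : 'cV[R]_m => v a 0)).
by rewrite !mxE.
Qed.

(** The events of distinct tuples are disjoint, and their probabilities are the
    product weights by independence of the columns. *)
Lemma tuple_event_union (good : {ffun 'I_n -> 'I_k} -> bool) :
  let E := \bigcup_(f in [set f | good f]) tuple_event f in
  measurable E /\ Q E = (\sum_(f | good f) tuple_wt (atom_wt P X x) f)%:E.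
Proof.
move=> E; split; first by apply: fin_bigcup_measurable => // f _; exact: tuple_event_measurable.
have fin : finite_set [set f | good f] by [].
rewrite /E (measure_fin_bigcup _ fin); last 2 first.
- apply/trivIsetP => f g _ _ fg; apply/seteqP; split=> // w [hf hg]; case/eqP: fg.
  by apply/ffunP => j; apply: xinj; have := hf j; have := hg j; move=> /= <-.
- by move=> f _; exact: tuple_event_measurable.
rewrite -[[set f | good f]]/[set` (good : {pred _})] -(@bigfs _ _ _ _ (index_enum _))//; last first.
- by move=> f _; rewrite mem_index_enum.
- exact: index_enum_uniq.
rewrite -sumEFin; apply: eq_bigr => f _; exact: tuple_event_prob.
Qed.

End ColumnLaw.

Lemma gauss_exp0 (R : realType) m n (M : 'M[R]_(m, n)) : gauss_exp M 0 = 1.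
Proof. by rewrite /gauss_exp dotv0l mulr0 expR0. Qed.

Section GaussianMatch.
Variables (R : realType) (m n : nat) (B : 'M[R]_m) (W : 'M[int]_(m, n)).
Hypothesis n0 : (0 < n)%N.
Hypothesis uB : B \in unitmx.
Let M := B *m map_mx intr W.
Hypothesis HM : forall v, n%:R / 2 * dotv v v <= dotv v (M *m M^T *m v).

Lemma posdef_gram : posdef (M *m M^T).
Proof.
split; first by rewrite trmx_mul trmxK.
move=> u u0; apply: lt_le_trans (HM u).
by rewrite mulr_gt0 ?divr_gt0 ?ltr0n// dotv_gt0.
Qed.

Lemma gram_unit : M *m M^T \in unitmx.
Proof. by rewrite unitmxE unitfE gt_eqF//; exact: posdef_det_gt0 posdef_gram. Qed.

(** With zeta the coordinates of - lambda, both exponents equal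
    - 2 zeta^T (W W^T)^-1 zeta; the vector - B^-T (pi / 4) y solves the
    linear system for M M^T with right side lambda. *)
Lemma gauss_exp_match (l : 'cV[int]_m) (y : 'cV[R]_m) :
  cov_form R W *m y = (2 * pi) *: (2^-1 *: (map_mx intr W *m const_mx 1) - map_mx intr l) ->
  gauss_exp M (B *m map_mx intr l - 2^-1 *: (M *m const_mx 1)) =
  expR (- (qform (cov_form R W) y / 4)).
Proof.
set ze := _ - _ => Hy.
have p0 : (pi : R) != 0 by rewrite gt_eqF ?pi_gt0.
have tp0 : 2 * pi != 0 :> R by rewrite mulf_neq0.
have -> : B *m map_mx intr l - 2^-1 *: (M *m const_mx 1) = - (B *m ze).
  by rewrite /ze /M mulmxBr opprB -scalemxAr mulmxA.
have Gy : map_mx intr W *m (map_mx intr W)^T *m ((pi / 4) *: y) = ze.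
  move: Hy; rewrite /cov_form -scalemxAl -scalemxAr => /(congr1 (fun v => (2 * pi)^-1 *: v)).
  rewrite !scalerA (mulVf tp0) scale1r => <-; congr (_ *: _).
  by move: p0; generalize (pi : R) => q q0; field.
have E : invmx (M *m M^T) *m (- (B *m ze)) = - dual_pt B ((pi / 4) *: y).
  have uB' : B^T \in unitmx by rewrite unitmx_tr.
  rewrite -[RHS](mulKmx gram_unit) [in RHS]mulmxN; congr (_ *m - _).
  by rewrite -Gy /M trmx_mul -!mulmxA /dual_pt (mulKVmx uB').
rewrite /gauss_exp E dotvNl dotvNr opprK dotvC -(dotv_dual_pt uB) dotvZl.
by congr expR; rewrite /qform Hy dotvZr; field.
Qed.

Lemma powR_half (a : R) : 0 <= a -> a `^ (m%:R / 2) = Num.sqrt a ^+ m.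
Proof. by move=> a0; rewrite mulrC powRrM powR12_sqrt// powR_mulrn ?sqrtr_ge0. Qed.

(** det (M M^T) = det (B)^2 det (W W^T), and |det B| is the determinant of the lattice. *)
Lemma gauss_mass_match (Lat : set 'cV[R]_m) : lattice_det Lat = `|\det B| ->
  lattice_gaussian Lat M 0 = gauss_mass R W.
Proof.
move=> LB; rewrite /lattice_gaussian gauss_exp0 mulr1 LB !powR_half ?pi_ge0//.
have dB : \det B != 0 by rewrite -unitfE -unitmxE.
set G := map_mx intr W *m (map_mx intr W)^T : 'M[R]_m.
have E : \det (M *m M^T) = \det B ^+ 2 * \det G.
  by rewrite /M trmx_mul mulmxA -(mulmxA B) -/G !det_mulmx det_tr mulrAC expr2.
have dG : 0 < \det G.
  have := posdef_det_gt0 posdef_gram; rewrite E pmulr_rgt0//.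
  by rewrite exprn_even_gt0//= dB.
rewrite E sqrtrM ?sqr_ge0// sqrtr_sqr /gauss_mass /cov_form -/G detZ.
have p0 : 0 < (pi : R) := pi_gt0 _.
rewrite sqrtrM; last by rewrite exprn_ge0// divr_ge0// sqr_ge0.
have -> : Num.sqrt ((pi ^+ 2 / 2) ^+ m) = (pi / Num.sqrt 2) ^+ m :> R.
  have s2' : 0 <= Num.sqrt (2 : R) by exact: sqrtr_ge0.
  have h : 0 <= (pi / Num.sqrt 2 : R) by rewrite divr_ge0// ltW.
  have -> : (pi ^+ 2 / 2) ^+ m = ((pi / Num.sqrt 2) ^+ m) ^+ 2 :> R.
    by rewrite -exprM mulnC exprM [in RHS]expr_div_n sqr_sqrtr.
  by rewrite sqrtr_sqr ger0_norm// exprn_ge0.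
have s2 : 0 < Num.sqrt (2 : R) by rewrite sqrtr_gt0.
have sp : 0 < Num.sqrt (pi : R) by rewrite sqrtr_gt0.
have sG : 0 < Num.sqrt (\det G) by rewrite sqrtr_gt0.
have nB : 0 < `|\det B| by rewrite normr_gt0.
rewrite expr_div_n -[X in X ^+ m / Num.sqrt 2 ^+ m](sqr_sqrtr (ltW p0)) -exprM mulnC exprM.
set a := Num.sqrt pi ^+ m; set b := Num.sqrt 2 ^+ m.
have a0 : 0 < a by rewrite exprn_gt0.
have b0 : 0 < b by rewrite exprn_gt0.
by field; rewrite !gt_eqF.
Qed.

Lemma gauss_mass_pos : 0 < gauss_mass R W.
Proof.
rewrite divr_gt0 ?exprn_gt0 ?sqrtr_gt0 ?pi_gt0//; exact: posdef_det_gt0 (posdef_cov n0 uB HM).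
Qed.

End GaussianMatch.

Lemma lattice_gaussianE (R : realType) m n (Lat : set 'cV[R]_m) (M : 'M[R]_(m, n)) la :
  lattice_gaussian Lat M la = lattice_gaussian Lat M 0 * gauss_exp M la.
Proof. by rewrite /lattice_gaussian gauss_exp0 mulr1. Qed.

Lemma loewner_scalar (R : realType) m n (M : 'M[R]_(m, n)) a :
  (forall v, a * dotv v v <= dotv v (M *m M^T *m v)) -> loewner_ge (M *m M^T) a%:M.
Proof.
move=> h; split; first by rewrite linearB /= trmx_mul trmxK tr_scalar_mx.
by move=> v; rewrite mulmxBl dotvDr dotvNr mul_scalar_mx dotvZr subr_ge0.
Qed.

(** * Consequences of the lower bound on n *)

Section Numerics.
Variable R : realType.

Lemma ln_le_sqrt (x : R) : 0 < x -> ln x <= 2 * Num.sqrt x.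
Proof.
move=> x0; have s0 : 0 < Num.sqrt x by rewrite sqrtr_gt0.
rewrite -[X in ln X](sqr_sqrtr (ltW x0)) lnXn// -[_ *+ 2]mulr_natl ler_pM2l//.
exact: ltW (ln_sublinear s0).
Qed.

Lemma ln_ge_half (x : R) : 2 <= x -> 2^-1 <= ln x.
Proof.
move=> x2; apply: (@le_trans _ _ (ln 2)); last by rewrite ler_ln ?posrE//; lra.
have := @le_ln1Dx R (- 2^-1); have -> : 1 + - 2^-1 = 2^-1 :> R by field.
by rewrite lnV ?posrE// => h; have := h ltac:(lra); lra.
Qed.

Variables (m n : nat) (L K H : R).
Hypothesis H_large : 2048 <= H.
Hypothesis K_large : 2 * H ^+ 2 <= K.
Hypothesis m0 : (0 < m)%N.
Hypothesis n1 : (1 < n)%N.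
Hypothesis L1 : 1 <= L.
Let N : R := ln n%:R.
Let s : R := Num.sqrt n%:R.
Hypothesis Hdim : K ^+ 2 * (m%:R ^+ 2 * L ^+ 2 * (ln m%:R + ln L) ^+ 2) <= n%:R.
Hypothesis Htriv : K * L * Num.sqrt (N / n%:R) < 1.

Lemma n_ge2 : 2 <= n%:R :> R. Proof. by rewrite (ler_nat _ 2). Qed.

Lemma sqrt_n_gt0 : 0 < s.
Proof. by rewrite sqrtr_gt0; have := n_ge2; lra. Qed.

(** Put x = sqrt n / (m L), so that log n = 2 log (m L) + 2 log x.  The first
    logarithm is at most x / K by the first part of the threshold, and the second at most
    x / 1024 because x is large: for m >= 2 by the same bound, and for m = 1 because
    K L sqrt (log n / n) < 1. *)
Lemma log_n_le_sqrt : 256 * m%:R * L * N <= s.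
Proof.
have n2 := n_ge2; have s0 := sqrt_n_gt0; have l1 := L1; have Hl := H_large; have K0 : 1024 <= K by apply: le_trans K_large; nra.
have m1 : 1 <= m%:R :> R by rewrite ler1n.
have mL1 : 1 <= m%:R * L by rewrite mulr_ege1.
have mL0 : 0 < m%:R * L by lra.
have N2 : 2^-1 <= N by exact: ln_ge_half.
have sN0 : 0 <= Num.sqrt N := sqrtr_ge0 _.
have sN : 2^-1 <= Num.sqrt N.
  by rewrite -[2^-1]ger0_norm// -sqrtr_sqr ler_wsqrtr//; apply: le_trans N2; lra.
pose x := s / (m%:R * L).
have x0 : 0 < x by rewrite divr_gt0.
have sE : s = x * (m%:R * L) by rewrite /x divfK ?gt_eqF.
have lmL0 : 0 <= ln (m%:R * L) by rewrite ln_ge0.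
have h1 : K * ln (m%:R * L) <= x.
  rewrite -(ler_pM2r mL0) -sE /s.
  have Kl : 0 <= K * ln (m%:R * L) * (m%:R * L).
    by apply: mulr_ge0; [apply: mulr_ge0 => //; lra|exact: ltW].
  rewrite -[X in X <= _](ger0_norm Kl) -sqrtr_sqr ler_wsqrtr//.
  apply: le_trans Hdim; rewrite lnM ?posrE; [|lra|lra].
  by rewrite le_eqVlt; apply/orP; left; apply/eqP; ring.
have h2 : K * L * Num.sqrt N <= s.
  move: Htriv; rewrite sqrtrM; last lra.
  rewrite sqrtrV; last lra.
  by rewrite mulrA ltr_pdivrMr// mul1r => /ltW.
(* Here x is large, by the nontriviality hypothesis if m = 1 and by h1 otherwise. *)
have xbig : K / 2 <= x.
  have [mE|m2] := leqP m 1.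
    have m1E : m%:R = 1 :> R by rewrite (_ : m = 1%N)//; apply/eqP; rewrite eqn_leq mE.
    rewrite -(ler_pM2r mL0) -sE; apply: le_trans h2; rewrite m1E mul1r.
    have : 0 <= K * L by rewrite mulr_ge0//; lra.
    nra.
  have : 2^-1 <= ln (m%:R * L).
    apply: ln_ge_half; have : 2 <= m%:R :> R by rewrite (ler_nat _ 2).
    nra.
  nra.
have sx : 0 < Num.sqrt x by rewrite sqrtr_gt0.
have sx2 : Num.sqrt x ^+ 2 = x by rewrite sqr_sqrtr// ltW.
have sxb : H <= Num.sqrt x.
  have kl := K_large; rewrite leNgt; apply/negP => h.
  have : Num.sqrt x ^+ 2 < H ^+ 2.
    by rewrite ltrXn2r ?nnegrE ?(ltW sx)//; apply: le_trans (ltW sx) (ltW h).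
  lra.
have lx : ln x <= x / 1024.
  have := ln_le_sqrt x0; nra.
have NE : N = 2 * ln (m%:R * L) + 2 * ln x.
  have nE : n%:R = s ^+ 2 by rewrite sqr_sqrtr// ler0n.
  rewrite /N nE lnXn// sE lnM ?posrE// -mulr_natl; ring.
have h3 : 1024 * ln (m%:R * L) <= x by nra.
have NX : 256 * N <= x by rewrite NE; lra.
rewrite sE.
have := ler_wpM2r (ltW mL0) NX; nra.
Qed.

Lemma scale_facts : 1 <= N /\ 20 <= n%:R :> R.
Proof.
have l1 := L1; have h := log_n_le_sqrt; have n2 := n_ge2; have s0 := sqrt_n_gt0.
have m1 : 1 <= m%:R :> R by rewrite ler1n.
have mL1 : 1 <= m%:R * L by rewrite mulr_ege1.
have N2 : 2^-1 <= N by exact: ln_ge_half.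
have s1 : 128 <= s by apply: le_trans h; nra.
have nE : n%:R = s ^+ 2 by rewrite sqr_sqrtr// ler0n.
have n20 : 20 <= n%:R :> R by rewrite nE; nra.
split=> //; rewrite /N nE lnXn// -mulr_natl.
have := @ln_ge_half s; lra.
Qed.

Let A := m%:R * N.

Lemma exp_log_n k : expR (- (k%:R * N)) = (n%:R ^+ k)^-1.
Proof. by rewrite expRN expRM_natl /N lnK// posrE; have := n_ge2; lra. Qed.

Lemma A_ge : N <= A.
Proof.
have l1 := L1; have [N1 _] := scale_facts; have m1 : 1 <= m%:R :> R by rewrite ler1n.
by rewrite /A; nra.
Qed.

(** Squared form of log_n_le_sqrt, with m^2 log^2 n weakened to m log n; every
    exponent of order n / L^2 thereby beats n^m. *)
Lemma ratio_ge : 256 ^+ 2 * A <= n%:R / L ^+ 2.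
Proof.
have l1 := L1; have [N1 _] := scale_facts; have A1 := A_ge; have h := log_n_le_sqrt.
have L0 : 0 < L by lra.
rewrite ler_pdivlMr ?exprn_gt0//.
have nE : n%:R = s ^+ 2 by rewrite sqr_sqrtr// ler0n.
apply: (@le_trans _ _ ((256 * m%:R * L * N) ^+ 2)); last first.
  have h0 : 0 <= 256 * m%:R * L * N.
    by apply: mulr_ge0; [apply: mulr_ge0; [apply: mulr_ge0|exact: ltW]|lra].
  rewrite nE; move: h0 h (sqrt_n_gt0); set a := _ * N => h0 h s0; nra.
have -> : (256 * m%:R * L * N) ^+ 2 = 256 ^+ 2 * (A * A) * L ^+ 2 by rewrite /A; ring.
have : A <= A * A by nra.
by move=> AA; apply: ler_wpM2r; [exact: sqr_ge0|lra].
Qed.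

Lemma pow_le_exp (a : R) : 0 <= a <= n%:R -> a ^+ m <= expR A.
Proof.
move=> /andP[a0 an]; rewrite /A expRM_natl /N lnK ?posrE; last by have := n_ge2; lra.
by rewrite lerXn2r ?nnegrE.
Qed.

(** The exponent n / (512 L^2) is at least 128 m log n, against a factor 2^(m/2). *)
Lemma tail_total : expR (- (n%:R / (512 * L ^+ 2))) * Num.sqrt (2 ^+ m) <= m%:R ^+ 2 * L ^+ 2 / n%:R / 20.
Proof.
have l1 := L1; have [N1 n20] := scale_facts; have A1 := A_ge; have r := ratio_ge.
have L0 : 0 < L by lra.
have m1 : 1 <= m%:R :> R by rewrite ler1n.
have h1 : Num.sqrt (2 ^+ m) <= expR A.
  apply: le_trans (_ : 2 ^+ m <= _); last by apply: pow_le_exp; have := n_ge2; lra.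
  rewrite -[X in _ <= X]ger0_norm ?exprn_ge0// -sqrtr_sqr ler_wsqrtr// expr2.
  by rewrite ler_peMl ?exprn_ge0// exprn_ege1//; lra.
apply: le_trans (_ : expR (- (2%:R * N)) <= _).
  apply: le_trans (_ : expR (- (n%:R / (512 * L ^+ 2))) * expR A <= _).
    by rewrite ler_wpM2l ?expR_ge0.
  rewrite -expRD ler_expR.
  have -> : n%:R / (512 * L ^+ 2) = n%:R / L ^+ 2 / 512 by field; rewrite gt_eqF.
  lra.
rewrite exp_log_n.
apply: le_trans (_ : n%:R^-1 / 20 <= _).
  rewrite expr2 invfM ler_pM2l ?invr_gt0; last lra.
  by rewrite lef_pV2 ?posrE//; lra.
rewrite ler_pM2r ?invr_gt0// -[X in X <= _]mul1r ler_pM2r ?invr_gt0; last lra.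
by rewrite -exprMn exprn_ege1// mulr_ege1.
Qed.

End Numerics.

(** * The probability of a bad matrix *)

Section Tail.
Variable R : realType.
Variables (m n : nat) (L K H : R).
Hypothesis H_large : 2048 <= H.
Hypothesis K_large : 2 * H ^+ 2 <= K.
Hypothesis m0 : (0 < m)%N.
Hypothesis n1 : (1 < n)%N.
Hypothesis L1 : 1 <= L.
Let N : R := ln n%:R.
Let s : R := Num.sqrt n%:R.
Let A := m%:R * N.
Hypothesis Hdim : K ^+ 2 * (m%:R ^+ 2 * L ^+ 2 * (ln m%:R + ln L) ^+ 2) <= n%:R.
Hypothesis Htriv : K * L * Num.sqrt (N / n%:R) < 1.

Let facts : 1 <= N /\ 20 <= n%:R :> R := scale_facts H_large K_large m0 n1 L1 Hdim Htriv.
Let hlog : 256 * m%:R * L * N <= s := log_n_le_sqrt H_large K_large m0 n1 L1 Hdim Htriv.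
Let hratio : 256 ^+ 2 * A <= n%:R / L ^+ 2 := ratio_ge H_large K_large m0 n1 L1 Hdim Htriv.
Let hA : N <= A := A_ge H_large K_large m0 n1 L1 Hdim Htriv.

Variable B : 'M[R]_m.
Hypothesis uB : B \in unitmx.
Hypothesis Hdet : K ^+ 2 * (L ^+ 2 * ln `|\det B| ^+ 2) <= n%:R.
Let sigma := K * s / L.

Let D0 : 0 < `|\det B|. Proof. by rewrite normr_gt0 -unitfE -unitmxE. Qed.

(** Half of sigma = K sqrt n / L dominates |log det| by the third part of the threshold,
    the other half dominates m log n. *)
Lemma sigma_ge : `|ln `|\det B| | + 4 * A <= sigma.
Proof.
have l1 := L1; have [N1 n20] := facts; have h := hlog; have A1 := hA; have Hl := H_large.
have L0 : 0 < L by lra.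
have K0 : 1024 <= K by apply: le_trans K_large; nra.
have h1 : 256 * A <= s / L.
  rewrite ler_pdivlMr//; apply: le_trans h; rewrite /A; lra.
have h2 : K * `|ln `|\det B| | <= s / L.
  rewrite ler_pdivlMr//.
  have p0 : 0 <= K * `|ln `|\det B| | * L by apply: mulr_ge0; [apply: mulr_ge0 => //; lra|exact: ltW].
  rewrite -[X in X <= _](ger0_norm p0) -sqrtr_sqr ler_wsqrtr//; apply: le_trans Hdet.
  by rewrite !exprMn real_normK ?num_real// mulrA mulrAC.
have l0 : 0 <= `|ln `|\det B| | by [].
rewrite /sigma -mulrA; set u := s / L in h1 h2 *; set a := `|ln _| in h2 l0 *.
have A0 : 0 <= A by lra.
have Ka : a <= K * a by nra.
nra.
Qed.

(** The mass is |det B| times a factor polynomial in n, so its inverse costs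
    |log det| + m log n in the exponent. *)
Lemma dual_mass_ge : expR (- (`|ln `|\det B| | + A)) <= dual_mass B (upper_form R n).
Proof.
have [N1 n20] := facts; have n0 : 0 < n%:R :> R by lra.
rewrite opprD expRD /dual_mass; apply: ler_pM; rewrite ?expR_ge0//.
  rewrite -[X in _ <= X](@lnK R) ?posrE// ler_expR.
  by have := ler_norm (- ln `|\det B|); rewrite normrN; lra.
rewrite /A -mulrN expRM_natl.
have p2 := pi_ge2 R; have p4 := pihalf_lt2 R.
have e0 : expR (- N) = n%:R^-1 by rewrite expRN /N lnK.
rewrite e0 lerXn2r ?nnegrE ?invr_ge0 ?sqrtr_ge0//.
have i0 : 0 <= n%:R^-1 :> R by rewrite invr_ge0.
rewrite -[X in X <= _](ger0_norm i0) -sqrtr_sqr ler_wsqrtr// /upper_form.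
have -> : pi / (3 * pi ^+ 2 * n%:R / 4) = 4 / (3 * pi * n%:R) :> R.
  have : (pi : R) != 0 by rewrite gt_eqF// pi_gt0.
  move: (pi : R) n0 => q n0 q0; field; rewrite q0 gt_eqF//.
rewrite ler_pdivlMr ?mulr_gt0 ?pi_gt0// exprVn ler_pdivrMl ?exprn_gt0//.
nra.
Qed.

Lemma dual_mass_ratio : dual_mass B (n%:R / 32) <= expR A * dual_mass B (upper_form R n).
Proof.
have [N1 n20] := facts; have n0 : 0 < n%:R :> R by lra.
rewrite /dual_mass mulrCA ler_pM2l// /A expRM_natl /N lnK ?posrE// -exprMn.
have p2 := pi_ge2 R; have p4 := pihalf_lt2 R; have pp := pi2_le16 R.
rewrite lerXn2r ?nnegrE ?mulr_ge0 ?sqrtr_ge0//.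
rewrite -[X in _ <= X * _](ger0_norm (ltW n0)) -sqrtr_sqr -sqrtrM ?sqr_ge0// ler_wsqrtr// /upper_form.
have -> : n%:R ^+ 2 * (pi / (3 * pi ^+ 2 * n%:R / 4)) = 4 * n%:R / (3 * pi) :> R.
  have : (pi : R) != 0 by rewrite gt_eqF// pi_gt0.
  move: (pi : R) n0 => q n0 q0; field; rewrite q0 gt_eqF//.
have -> : pi / (n%:R / 32) = 32 * pi / n%:R :> R by rewrite invfM invrK mulrA mulrAC [pi * 32]mulrC mulrAC.
rewrite ler_pdivrMr// mulrAC ler_pdivlMr ?mulr_gt0 ?pi_gt0//.
nra.
Qed.

Lemma far_mean_le : far_mean n B L sigma <= 3 * (n%:R ^+ 3)^-1 * dual_mass B (upper_form R n).
Proof.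
have l1 := L1; have L0 : 0 < L by lra.
have [N1 n20] := facts; have n0 : 0 < n%:R :> R by lra.
have sg := sigma_ge; have A1 := hA; have r := hratio.
set dm := dual_mass _ (upper_form R n).
have dg := dual_mass_ge; have dr := dual_mass_ratio.
have dm0 : 0 <= dm by apply: le_trans dg; exact: expR_ge0.
have E3 : (n%:R ^+ 3)^-1 = expR (- (3%:R * N)) by rewrite exp_log_n.
rewrite E3 /far_mean.
have h1 : expR (- sigma) <= expR (- (3%:R * N)) * dm.
  apply: le_trans (_ : expR (- (3%:R * N)) * expR (- (`|ln `|\det B| | + A)) <= _).
    by rewrite -expRD ler_expR; lra.
  by rewrite ler_wpM2l ?expR_ge0.
have h2 : expR (- (n%:R * cutoff L / 32)) * (2 * dual_mass B (n%:R / 32)) <= 2 * expR (- (3%:R * N)) * dm.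
  apply: le_trans (_ : expR (- (n%:R * cutoff L / 32)) * (2 * (expR A * dm)) <= _).
    by rewrite ler_wpM2l ?expR_ge0// ler_pM2l.
  rewrite [X in X <= _]mulrCA -[X in _ <= X]mulrA ler_pM2l// [X in X <= _]mulrA ler_wpM2r// -expRD ler_expR.
  have -> : n%:R * cutoff L / 32 = n%:R / L ^+ 2 / 256 / 32 by rewrite /cutoff; field; rewrite gt_eqF.
  lra.
lra.
Qed.

(** The Chebyshev term is 4 (L / sqrt n) (m L / sqrt n), at most L / sqrt n, and
    the Markov term is O (1 / n). *)
Lemma bad_prob_le : 4 * m%:R * L ^+ 2 / n%:R + far_mean n B L sigma / far_level n B L <=
  K * L * Num.sqrt (N / n%:R).
Proof.
have l1 := L1; have L0 : 0 < L by lra.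
have [N1 n20] := facts; have n0 : 0 < n%:R :> R by lra.
have h := hlog.
have m1 : 1 <= m%:R :> R by rewrite ler1n.
have K0 : 1024 <= K by have := H_large; have := K_large; nra.
have s0 : 0 < s by rewrite sqrtr_gt0.
have ns : n%:R = s ^+ 2 by rewrite sqr_sqrtr// ltW.
have s4 : 4 <= s by nra.
set q := Num.sqrt (N / n%:R).
have qs : s^-1 <= q.
  have -> : s^-1 = Num.sqrt (n%:R^-1) by rewrite sqrtrV// ltW.
  rewrite /q ler_wsqrtr// -[X in X <= _]mul1r ler_pM2r ?invr_gt0//.
have sL : s^-1 <= 1 by rewrite invf_le1//; lra.
have s10 : 0 < s^-1 by rewrite invr_gt0.
have t1 : 4 * m%:R * L ^+ 2 / n%:R <= L * q.
  rewrite ns ler_pdivrMr ?exprn_gt0//.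
  have : L * s <= L * q * s ^+ 2.
    rewrite -mulrA ler_pM2l// expr2 mulrA -[X in X <= _]mul1r ler_pM2r//.
    by rewrite -ler_pdivrMr// mul1r.
  have : 4 * (m%:R * L) <= s.
    apply: le_trans h; have : 0 <= m%:R * L by rewrite mulr_ge0//; lra.
    nra.
  nra.
have t2 : far_mean n B L sigma / far_level n B L <= 3 * (L * q).
  have dm0 := dual_mass_gt0 uB (upper_form_gt0 R (ltnW n1)).
  have mu0 : 0 < m%:R ^+ 2 * L ^+ 2 / n%:R by rewrite divr_gt0// mulr_gt0 ?exprn_gt0//; lra.
  rewrite ler_pdivrMr; last by rewrite mulr_gt0// divr_gt0.
  apply: le_trans far_mean_le _; rewrite /far_level [X in _ <= X]mulrA ler_pM2r//.
  have mL1 : 1 <= m%:R ^+ 2 * L ^+ 2 by rewrite -exprMn exprn_ege1// mulr_ege1.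
  apply: le_trans (_ : 3 * (L * q) * (n%:R^-1 / 20) <= _); last first.
    apply: ler_wpM2l; first by rewrite mulr_ge0// mulr_ge0 ?sqrtr_ge0// ltW.
    rewrite ler_pM2r// -[X in X <= _]mul1r ler_pM2r ?invr_gt0//.
  rewrite -!mulrA ler_pM2l//.
  apply: le_trans (_ : s^-1 * (n%:R^-1 / 20) <= _); last first.
    rewrite [X in _ <= X]mulrA ler_pM2r ?divr_gt0 ?invr_gt0//.
    nra.
  rewrite (_ : n%:R ^+ 3 = n%:R * n%:R * n%:R); last by ring.
  rewrite !invfM -mulrA [X in _ <= X]mulrCA ler_pM2l ?invr_gt0//.
  apply: ler_pM; rewrite ?invr_ge0 ?(ltW n0)//.
    by rewrite lef_pV2 ?posrE// ns; nra.
  by rewrite lef_pV2 ?posrE.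
have Lq : 0 <= L * q by rewrite mulr_ge0 ?sqrtr_ge0// ltW.
rewrite -mulrA; nra.
Qed.

End Tail.

(** * Unfolding the threshold *)

Section Threshold.
Variables (R : realType) (c : R) (m n : nat) (L D : R) (S : \bar R).
Hypothesis c0 : 0 <= c.
Hypothesis hn : (n_threshold c m L S D <= (n%:R)%:E)%E.

Lemma threshold_dim : c * (m%:R ^+ 2 * L ^+ 2 * (ln m%:R + ln L) ^+ 2) <= n%:R.
Proof.
rewrite -lee_fin EFinM; apply: le_trans hn; apply: lee_wpmul2l; first by rewrite lee_fin.
by rewrite le_max le_max lexx.
Qed.

Lemma threshold_det : c * (L ^+ 2 * ln D ^+ 2) <= n%:R.
Proof.
rewrite -lee_fin EFinM; apply: le_trans hn; apply: lee_wpmul2l; first by rewrite lee_fin.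
by rewrite le_max lexx orbT.
Qed.

Lemma threshold_span : (c%:E * (S^-1 ^+ 4 * (L ^- 2)%:E) <= (n%:R)%:E)%E.
Proof.
apply: le_trans hn; apply: lee_wpmul2l; first by rewrite lee_fin.
by rewrite le_max le_max lexx orbT.
Qed.

End Threshold.

(** From n >= K^2 S^-4 L^-2 follows (n S^2)^2 >= K^2 n / L^2.  For S = 0 the
    threshold is infinite because the inverse of 0 is. *)
Lemma threshold_span_le (R : realType) (K : R) (m n : nat) (L D : R) (S : \bar R) (a : R) :
  0 < K -> 0 < L -> (0 < n)%N -> 
  (n_threshold (K ^+ 2) m L S D <= (n%:R)%:E)%E -> (0 <= S)%E -> (S <= a%:E)%E ->
  K * Num.sqrt n%:R / L <= n%:R * a ^+ 2.
Proof.
move=> K0 L0 n0 /(threshold_span (sqr_ge0 K)); case: S => [r| |]//.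
rewrite !lee_fin => h r0 ra.
have nR : 0 < n%:R :> R by rewrite ltr0n.
have [rz|rn] := eqVneq r 0.
  move: h; rewrite rz inve0 /= !mulyy.
  have i0 : (0 < (L ^- 2)%:E)%E by rewrite lte_fin invr_gt0 exprn_gt0.
  rewrite gt0_mulye// gt0_muley ?lte_fin ?exprn_gt0//.
have rp : 0 < r by rewrite lt_neqAle eq_sym rn.
move: h; rewrite inver (negPf rn) -EFin_expe -!EFinM lee_fin => h.
apply: (@le_trans _ _ (n%:R * r ^+ 2)); last first.
  apply: ler_wpM2l; first exact: ltW.
  by rewrite lerXn2r ?nnegrE// (le_trans r0).
have p0 : 0 <= K * Num.sqrt n%:R / L by rewrite divr_ge0 ?mulr_ge0 ?sqrtr_ge0// ltW.
rewrite -(@ler_pXn2r _ 2)// ?nnegrE ?mulr_ge0 ?sqr_ge0 ?(ltW nR)//.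
rewrite expr_div_n exprMn sqr_sqrtr ?ler0n// ler_pdivrMr ?exprn_gt0//.
have E : n%:R * (r ^+ 4 * L ^+ 2) * (K ^+ 2 * (r^-1 ^+ 4 * L ^- 2)) = n%:R * K ^+ 2.
  by field; rewrite rn gt_eqF.
have q0 : 0 <= n%:R * (r ^+ 4 * L ^+ 2).
  by rewrite !mulr_ge0 ?exprn_ge0// ltW.
have := ler_wpM2l q0 h; rewrite E => h2.
by rewrite mulrC; apply: le_trans h2 _; rewrite le_eqVlt; apply/orP; left; apply/eqP; ring.
Qed.

(** * The theorem *)

Section Spread.
Variables (R : realType) (m : nat) (Lat : set 'cV[R]_m) (B : 'M[R]_m).
Variables (d : measure_display) (T : measurableType d) (P : probability T R) (X : T -> 'cV[R]_m).
Hypothesis hX : random_vector X.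
Hypothesis cLat : countable Lat.
Hypothesis hXLat : forall w, Lat (X w).
Hypothesis LB : lattice_basis Lat B.
Variables (k : nat) (z : 'I_k -> 'cV[int]_m).
Let x i : 'cV[R]_m := B *m map_mx intr (z i).
Hypothesis xinj : injective x.
Hypothesis xsupp : rv_supp P X = [set x i | i in [set: 'I_k]].

Let uB : B \in unitmx. Proof. by have [] := LB. Qed.

Lemma xt2_ge0 t : 0 <= xt2 (atom_wt P X x) z t.
Proof. by apply: sumr_ge0 => i _; rewrite mulr_ge0 ?atom_wt_ge0 ?sqr_ge0. Qed.

Lemma xtilde_dual_pt t : xtilde P X (dual_pt B t) = Num.sqrt (xt2 (atom_wt P X x) z t).
Proof.
rewrite /xtilde (expectation_atoms hX cLat hXLat xinj xsupp (fun y => `|mod1 (dotv (dual_pt B t) y)| ^+ 2)).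
congr Num.sqrt; apply: eq_bigr => i _.
by rewrite real_normK ?num_real// (dotv_dual_pt uB t).
Qed.

Lemma spanningness_ge0 : (0 <= spanningness P X Lat)%E.
Proof. by apply: le_ereal_inf_tmp => _ [th _ <-]; rewrite lee_fin sqrtr_ge0. Qed.

(** Noninteger t are exactly the coordinates of points outside the dual lattice. *)
Lemma spanningness_le t : (forall q : 'cV[int]_m, t <> map_mx intr q) ->
  Num.sqrt (xt2 (atom_wt P X x) z t) <= dual_dist Lat B t / 2 ->
  (spanningness P X Lat <= (Num.sqrt (xt2 (atom_wt P X x) z t))%:E)%E.
Proof.
move=> tq td; apply: ereal_inf_lbound; exists (dual_pt B t); last by rewrite xtilde_dual_pt.
split; first by rewrite /pseudodual xtilde_dual_pt.
move=> /(dual_lattice_basis _ LB)[q]; rewrite /dual_pt => E; apply: (tq q).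
have uB' : B^T \in unitmx by rewrite unitmx_tr.
by rewrite -(mulKVmx uB' t) E (mulKVmx uB').
Qed.

End Spread.

Section Main.
Variables (R : realType) (H K : R).
Hypothesis H_large : 2048 <= H.
Hypothesis K_large : 2 * H ^+ 2 <= K.
Variables (m : nat) (Lat : set 'cV[R]_m) (L : R).
Variables (d : measure_display) (T : measurableType d) (P : probability T R) (X : T -> 'cV[R]_m).
Hypothesis hm : (0 < m)%N.
Hypothesis hLat : is_lattice Lat.
Hypothesis hX : random_vector X.
Hypothesis hXLat : forall w, Lat (X w).
Hypothesis hcov : second_moment P X = 1%:M.
Hypothesis hsupp : rv_supp P X `<=` eucl_ball L.
Hypothesis hspan : Lat = zspan (rv_supp P X).
Variable n : nat.
Hypothesis hn1 : (1 < n)%N.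
Hypothesis hn : (n_threshold (K ^+ 2) m L (spanningness P X Lat) (lattice_det Lat) <= (n%:R)%:E)%E.
Hypothesis nontrivial : K * L * Num.sqrt (ln n%:R / n%:R) < 1.

Definition good_matrix (M : 'M[R]_(m, n)) : Prop :=
  [/\ loewner_ge (M *m M^T) (2^-1 * n%:R)%:M,
      forall lambda, shifted_lattice Lat M lambda ->
        `| sign_prob M lambda - lattice_gaussian Lat M lambda |
          <= lattice_gaussian Lat M 0 * (2 * m%:R ^+ 2 * L ^+ 2 / n%:R)
    & forall lambda, shifted_lattice Lat M lambda ->
        2 * m%:R ^+ 2 * L ^+ 2 / n%:R < gauss_exp M lambda -> 0 < sign_prob M lambda].

(** The finite theorem applied to the atoms of X, expressed in the basis whose
    determinant defines lattice_det. *)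
Lemma good_tuples : exists (k : nat) (x : 'I_k -> 'cV[R]_m) (good : {ffun 'I_n -> 'I_k} -> bool),
  [/\ injective x, \sum_i atom_wt P X x i = 1,
      \sum_(f | ~~ good f) tuple_wt (atom_wt P X x) f <= K * L * Num.sqrt (ln n%:R / n%:R)
    & forall f, good f -> good_matrix (tuple_mx x f)].
Proof.
have [k [x [xinj xsupp]]] := finite_set_enum (supp_finite hLat hXLat hsupp).
have cLat := lattice_countable hLat.
have xsum := atoms_sum1 hLat hX hXLat xinj xsupp.
have L1 := radius_ge1 hm hLat hX hXLat hcov hsupp xinj xsupp.
have xL := atoms_in_ball hsupp xsupp.
have xcov := atoms_cov hLat hX hXLat hcov xinj xsupp.
have hB := lattice_has_basis hLat hX hXLat hcov hspan xinj xsupp.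
(* The basis chosen by lattice_det, so that no invariance of determinants is needed. *)
set B := get [set B | lattice_basis Lat B].
have LB : lattice_basis Lat B by have [B' hB'] := hB; exact: (@getI _ [set B | lattice_basis Lat B] B').
have uB : B \in unitmx by have [] := LB.
have LatE y : Lat y <-> exists a : 'cV[int]_m, y = B *m map_mx intr a.
  have [_ E] := LB; rewrite {1}E; exact: zspan_cols.
have /choice[z xE] : forall i, exists a : 'cV[int]_m, x i = B *m map_mx intr a.
  move=> i; apply/LatE; apply: (supp_sub_lattice hXLat); exact: (x_supp xsupp).
have {}xE : x = (fun i => B *m map_mx intr (z i)) by apply: funext.
subst x.
exists k, (fun i => B *m map_mx intr (z i)).
set p := atom_wt P X _ in xsum xcov *.
have L0 : 0 < L by lra.
have n0 : (0 < n)%N by exact: ltnW.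
have K0 : 0 < K by have := H_large; have := K_large; nra.
have Hdim := threshold_dim (sqr_ge0 K) hn.
have Hdet := threshold_det (sqr_ge0 K) hn.
have HT := tail_total H_large K_large hm hn1 L1 Hdim nontrivial.
have Hbad := bad_prob_le H_large K_large hm hn1 L1 Hdim nontrivial uB Hdet.
have Hsigma : forall t, (forall q : 'cV[int]_m, t <> map_mx intr q) ->
    Num.sqrt (xt2 p z t) <= dual_dist Lat B t / 2 -> K * Num.sqrt n%:R / L <= n%:R * xt2 p z t.
  move=> t tq td; rewrite -[xt2 p z t]sqr_sqrtr; last exact: xt2_ge0.
  apply: (threshold_span_le K0 L0 n0 hn (spanningness_ge0 _ _ _)).
  exact: (spanningness_le hX cLat hXLat LB xinj xsupp tq td).
have p0 i : 0 <= p i by exact: atom_wt_ge0.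
have [good [hbad hgood]] := finite_limit hm n0 p0 xsum uB L0 xL xcov (dual_dist_le LB) (dual_dist_lt LB) Hsigma HT.
exists good; split=> //; first exact: le_trans hbad Hbad.
move=> f /hgood[/= HM Hlim].
have M_E := tuple_mxE B z f.
rewrite /good_matrix.
set M := tuple_mx _ f in HM Hlim M_E *; set W := tuple_coord z f in Hlim M_E *.
have HM' : forall v, n%:R / 2 * dotv v v <= dotv v (B *m map_mx intr W *m (B *m map_mx intr W)^T *m v).
  by move=> v; rewrite -M_E.
have g0 := gauss_mass_pos n0 uB HM'.
have gE : lattice_gaussian Lat M 0 = gauss_mass R W.
  by rewrite M_E; exact: gauss_mass_match.
have muE : 2 * m%:R ^+ 2 * L ^+ 2 / n%:R = 2 * (m%:R ^+ 2 * L ^+ 2 / n%:R) :> R by rewrite !mulrA.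
have part2 lambda : shifted_lattice Lat M lambda ->
    `| sign_prob M lambda - lattice_gaussian Lat M lambda |
      <= lattice_gaussian Lat M 0 * (2 * m%:R ^+ 2 * L ^+ 2 / n%:R).
  move=> [la /LatE[l ->] <-]; rewrite muE.
  have uQ : cov_form R W \in unitmx.
    by rewrite unitmxE unitfE gt_eqF//; exact: posdef_det_gt0 (posdef_cov n0 uB HM').
  have Hy := mulKVmx uQ ((2 * pi) *: (2^-1 *: (map_mx intr W *m const_mx 1) - map_mx intr l)).
  have := Hlim l _ Hy; rewrite -(gauss_exp_match n0 uB HM' Hy) -M_E.
  by rewrite [lattice_gaussian Lat M (_ - _)]lattice_gaussianE gE.
split=> //.
  by apply: loewner_scalar => v; rewrite [2^-1 * _]mulrC.
move=> lambda hl he; have := part2 _ hl; rewrite [X in `|_ - X|]lattice_gaussianE gE => h.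
have h2 : lattice_gaussian Lat M 0 * (2 * m%:R ^+ 2 * L ^+ 2 / n%:R) < lattice_gaussian Lat M 0 * gauss_exp M lambda.
  by rewrite gE ltr_pM2l.
move: h2 h; rewrite gE ler_distl => h2 /andP[h3 _]; lra.
Qed.

End Main.

Theorem theorem2p1 (R : realType) :
  exists c C : R, 0 < c /\ 0 < C /\
  forall (m : nat) (hm : (0 < m)%N)
    (Lat : set 'cV[R]_m) (hLat : is_lattice Lat) (L : R)
    (d : measure_display) (T : measurableType d) (P : probability T R)
    (X : T -> 'cV[R]_m) (hX : random_vector X)
    (hXLat : forall w, Lat (X w))
    (hcov : second_moment P X = 1%:M)
    (hsupp : rv_supp P X `<=` eucl_ball L)
    (hspan : Lat = zspan (rv_supp P X))
    (n : nat) (hn1 : (1 < n)%N)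
    (hn : (n_threshold c m L (spanningness P X Lat) (lattice_det Lat) <= (n%:R)%:E)%E)
    (d' : measure_display) (T' : measurableType d') (Q : probability T' R)
    (M : T' -> 'M[R]_(m, n)) (hM : iid_columns P X Q M),
  exists E : set T',
    [/\ measurable E,
        ((1 - C * L * Num.sqrt (ln n%:R / n%:R))%:E <= Q E)%E
      & forall w, E w ->
        [/\ loewner_ge (M w *m (M w)^T) (2^-1 * n%:R)%:M,
            forall lambda, shifted_lattice Lat (M w) lambda ->
              `| sign_prob (M w) lambda - lattice_gaussian Lat (M w) lambda |
                <= lattice_gaussian Lat (M w) 0 * (2 * m%:R ^+ 2 * L ^+ 2 / n%:R)
          & forall lambda, shifted_lattice Lat (M w) lambda ->
              2 * m%:R ^+ 2 * L ^+ 2 / n%:R < gauss_exp (M w) lambda ->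
              0 < sign_prob (M w) lambda]].
Proof.
have [H HH] : exists H : R, 2048 <= H by exists 2048; exact: lexx.
(* Abstracting the numerals as H and K keeps large unary numbers from being unfolded. *)
pose K := 2 * H ^+ 2; have KK : 2 * H ^+ 2 <= K by exact: lexx.
have K0 : 0 < K by rewrite /K; nra.
exists (K ^+ 2), K; split; first exact: exprn_gt0.
split=> // m hm Lat hLat L d T P X hX hXLat hcov hsupp hspan n hn1 hn d' T' Q M hM.
have [W|W] := ltP (K * L * Num.sqrt (ln n%:R / n%:R)) 1; last first.
  exists set0; split=> //; by rewrite measure0 lee_fin subr_le0.
have [k [x [good [xinj xsum hbad hgood]]]] :=
  good_tuples HH KK hm hLat hX hXLat hcov hsupp hspan hn1 hn W.
have [mE QE] := tuple_event_union hX hM xinj good.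
exists (\bigcup_(f in [set f | good f]) tuple_event M x f); split=> //.
  have := tuple_wt_sum n xsum; rewrite (bigID good) /= QE lee_fin => total.
  by rewrite lerBlDl; apply: le_trans (lerD hbad (lexx _)); rewrite addrC total.
by move=> w [f /hgood gf /tuple_event_mx ->].
Qed.
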